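(* Let $p>1$, let $\mathbf{X}$ be an $\mathbb{R}^\ell$-valued weak geometric Hölder $p$-rough path defined on $[0,T]$, and let $V_1,\dots,V_\ell$ be vector fields on $\mathbb{R}^d$. Suppose that for every $1\le n\le [p]$ and every tuple $(i_1,\dots,i_n)\in\{1,\dots,\ell\}^n$ the function $V_{i_1}\cdots V_{i_n}\mathrm{Id}:\mathbb{R}^d\to\mathbb{R}^d$ is $C^2$ with bounded derivatives (of first and second order). Then there is no explosion for the solutions of the rough differential equation $$dz_t=\mathrm{F}(z_t)\,d\mathbf{X}_t,\qquad \mathrm{F}=(V_1,\dots,V_\ell).$$
   Context: $[p]$ is the integer part of $p$; $T>0$ is fixed and $\Delta_T=\{(t,s)\in[0,T]^2: 0\le s\le t\le T\}$. Rough paths. A weak geometric Hölder $p$-rough path is a family $\mathbf{X}_{ts}=1\oplus X^1_{ts}\oplus\cdots\oplus X^{[p]}_{ts}$, $(t,s)\in\Delta_T$, in the truncated tensor algebra $\bigoplus_{i=0}^{[p]}(\mathbb{R}^\ell)^{\otimes i}$, taking values in the step-$[p]$ free nilpotent Lie group, satisfying $\mathbf{X}_{us}\mathbf{X}_{tu}=\mathbf{X}_{ts}$ for $s\le u\le t$, with $\|\mathbf{X}\|:=\max_{1\le i\le[p]}\sup_{s<t}|X^i_{ts}|^{1/i}/|t-s|^{1/p}<\infty$. Set $\mathbf{\Lambda}_{ts}:=\log\mathbf{X}_{ts}=0\oplus\Lambda^1_{ts}\oplus\cdots\oplus\Lambda^{[p]}_{ts}$. With $(e_i)$ the canonical basis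 of $\mathbb{R}^\ell$ and, for $I=(i_1,\dots,i_k)$, $e_{[I]}:=[e_{i_1},\dots,[e_{i_{k-1}},e_{i_k}]]$, the numbers $\Lambda^{k,I}_{ts}$ are the coefficients for which $\Lambda^k_{ts}=\sum_{I\in\{1,\dots,\ell\}^k}\Lambda^{k,I}_{ts}e_{[I]}$, namely $\Lambda^{k,I}_{ts}=\frac1k\times$ the coordinate of $\Lambda^k_{ts}$ on $e_{i_1}\otimes\cdots\otimes e_{i_k}$. Vector fields. A vector field $V$ is identified with the first order differential operator $f\mapsto (Df)(V)$; products $V_{i_1}\cdots V_{i_n}$ are compositions of operators, $\mathrm{Id}$ is the identity map of $\mathbb{R}^d$, and $V_{[I]}:=[V_{i_1},\dots,[V_{i_{k-1}},V_{i_k}]]$ (a vector field). Solutions and non-explosion. Let $\mu_{ts}(x)$ be the value at time $1$ of the solution of the ordinary differential equation $y'_r=\sum_{k=1}^{[p]}\sum_{I\in\{1,\dots,\ell\}^k}\Lambda^{k,I}_{ts}V_{[I]}(y_r)$, $y_0=x$. A flow is a family of maps $\varphi_{ts}:\mathbb{R}^d\to\mathbb{R}^d$, $(t,s)\in\Delta_T$, with $\varphi_{ss}=\mathrm{Id}$ and $\varphi_{tu}\circ\varphi_{us}=\varphi_{ts}$ for $s\le u\le t$. It is a (global in time and space) solution flow to the equation if there is an exponent $\eta>1$ independent of $\mathbf{X}$, a constant $\epsilon_{\mathbf{X}}>0$ and, for each $R>0$, a constant $C_{R,\mathbf{X}}>0$ such that $\sup_{|x|\le R}|\varphi_{ts}(x)-\mu_{ts}(x)|\le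 C_{R,\mathbf{X}}|t-s|^\eta$ whenever $|t-s|\le\epsilon_{\mathbf{X}}$. ''No explosion'' means that the equation has such a solution flow, so that the solution $t\mapsto\varphi_{ts}(x)$ started from any point $x\in\mathbb{R}^d$ at any time $s\in[0,T]$ is defined on all of $[s,T]$. *)

(* Defs.v *)
From HB Require Import structures.
From mathcomp Require Import all_boot all_order all_algebra.
From mathcomp Require Import all_classical all_reals all_analysis.
Set Implicit Arguments.
Unset Strict Implicit.
Unset Printing Implicit Defensive.
Import Order.TTheory GRing.Theory Num.Theory.
Import numFieldNormedType.Exports.

Local Open Scope classical_set_scope.
Local Open Scope ring_scope.

Section TruncatedTensorAlgebra.
Variables (R : realType) (ell N : nat).

(* The direct sum of the (R^ell)^{(x) i}, 0 <= i <= N: [a w] is the coordinate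
   of [a] on e_{w_1} (x) ... (x) e_{w_k}, for a word [w] of length k <= N. *)
Definition tens : Type := {ffun N.-bseq 'I_ell -> R}.

Implicit Types a b : tens.

Definition tens1 : tens := [ffun w : N.-bseq 'I_ell => (nilp w)%:R].

Definition tens_gen (i : 'I_ell) : tens :=
  [ffun w : N.-bseq 'I_ell => ((w : seq 'I_ell) == [:: i])%:R].

(* Words of length at most N are closed under taking prefixes and suffixes, so
   the deconcatenation formula is the product truncated at level N. *)
Definition tens_mul a b : tens :=
  [ffun w : N.-bseq 'I_ell =>
     \sum_(k < (size w).+1) a [bseq of take k w]
       * b (widen_bseq (leq_subr k N) [bseq of drop k w])].

Definition tens_pow a (k : nat) : tens := iter k (tens_mul a) tens1.

(* [tens_exp] is meant for elements with zero scalar part and [tens_log] for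
   elements with scalar part 1; the higher terms then vanish. *)
Definition tens_exp a : tens :=
  \sum_(0 <= k < N.+1) (k`!%:R)^-1 *: tens_pow a k.

Definition tens_log a : tens :=
  \sum_(1 <= k < N.+1) ((-1) ^+ k.+1 / k%:R) *: tens_pow (a - tens1) k.

Inductive free_nilpotent_lie : tens -> Prop :=
| fnl_gen i : free_nilpotent_lie (tens_gen i)
| fnl_zero : free_nilpotent_lie 0
| fnl_lin (c : R) a b : free_nilpotent_lie a -> free_nilpotent_lie b ->
    free_nilpotent_lie (c *: a + b)
| fnl_bracket a b : free_nilpotent_lie a -> free_nilpotent_lie b ->
    free_nilpotent_lie (tens_mul a b - tens_mul b a).

Definition free_nilpotent_group : set tens :=
  tens_exp @` [set a | free_nilpotent_lie a].

Definition level_norm (i : nat) a : R :=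
  Num.sqrt (\sum_(w : N.-bseq 'I_ell | size w == i) a w ^+ 2).

End TruncatedTensorAlgebra.

Arguments tens1 {R ell N}.

Section RoughPaths.
Variables (R : realType) (ell : nat) (p T : R).

Let N := Num.truncn p.

Definition rough_norm (X : R -> R -> tens R ell N) : \bar R :=
  \big[maxe/0%E]_(1 <= i < N.+1) ereal_sup
    [set (level_norm i (X ts.1 ts.2) `^ i%:R^-1
            / `|ts.1 - ts.2| `^ p^-1)%:E
       | ts in [set ts : R * R | 0 <= ts.2 /\ ts.2 < ts.1 /\ ts.1 <= T]].

(* As everywhere below, two-parameter families take the later time first:
   [X t s] is X_{ts} with s <= t, and only 0 <= s <= t <= T matters. *)
Record weak_geometric_rough_path (X : R -> R -> tens R ell N) : Prop := {
  wgrp_scalar : forall t s, 0 <= s -> s <= t -> t <= T -> X t s [bseq] = 1 ;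
  wgrp_group : forall t s, 0 <= s -> s <= t -> t <= T ->
    free_nilpotent_group (X t s) ;
  wgrp_chen : forall t u s, 0 <= s -> s <= u -> u <= t -> t <= T ->
    tens_mul (X u s) (X t u) = X t s ;
  wgrp_holder : (rough_norm X < +oo)%E
}.

End RoughPaths.

Section VectorFields.
Variables (R : realType) (d : nat).

Local Notation E := 'rV[R]_d.

Definition vf_act (V f : E -> E) : E -> E := fun x => 'd f x (V x).

(* [V, W] = VW - WV as differential operators, evaluated at the identity. *)
Definition vf_bracket (V W : E -> E) : E -> E :=
  fun x => vf_act V W x - vf_act W V x.

Section Words.
Variables (ell : nat) (V : 'I_ell -> E -> E).

Definition vf_word (I : seq 'I_ell) : E -> E :=
  foldr (fun i f => vf_act (V i) f) id I.

Fixpoint vf_bracket_word (I : seq 'I_ell) : E -> E :=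
  match I with
  | [::] => fun=> 0
  | [:: i] => V i
  | i :: I' => vf_bracket (V i) (vf_bracket_word I')
  end.

End Words.

(* Since E is finite-dimensional, continuity of x |-> D^k f(x) for the operator
   norm amounts to its continuity when evaluated at fixed directions. *)
Fixpoint class_C (k : nat) (f : E -> E) : Prop :=
  match k with
  | 0 => continuous f
  | k'.+1 => (forall x, differentiable f x) /\
             forall v, class_C k' (fun x => 'd f x v)
  end.

Definition C2_bounded_derivatives (f : E -> E) : Prop :=
  [/\ class_C 2 f,
      exists M : R, forall x v, `|'d f x v| <= M * `|v| &
      exists M : R, forall x u v,
        `|'d (fun z => 'd f z v) x u| <= M * `|u| * `|v|].

Definition ode_solution01 (W : E -> E) (x : E) (y : R -> E) : Prop :=
  [/\ y 0 = x, {within `[0, 1], continuous y} &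
      forall r : R, 0 < r -> r < 1 -> is_derive r 1 y (W (y r))].

Definition ode_time1 (W : E -> E) (x m : E) : Prop :=
  (exists2 y, ode_solution01 W x y & y 1 = m) /\
  (forall y, ode_solution01 W x y -> y 1 = m).

End VectorFields.

Section SolutionFlows.
Variables (R : realType) (ell d : nat) (p T : R).

Local Notation E := 'rV[R]_d.
Let N := Num.truncn p.

Variables (V : 'I_ell -> E -> E) (X : R -> R -> tens R ell N).

(* By Dynkin's formula, Lambda^k = \sum_(|I| = k) Lambda^{k,I} e_[I] for
   Lambda^{k,I} := k^-1 * (coordinate of Lambda^k on e_I). *)
Definition log_vf (t s : R) : E -> E := fun x =>
  \sum_(I : N.-bseq 'I_ell | (0 < size I)%N)
     ((size I)%:R^-1 * tens_log (X t s) I) *: vf_bracket_word V I x.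

Definition is_log_ode_map (mu : R -> R -> E -> E) : Prop :=
  forall t s, 0 <= s -> s <= t -> t <= T ->
  forall x, ode_time1 (log_vf t s) x (mu t s x).

Definition is_flow (phi : R -> R -> E -> E) : Prop :=
  (forall s, 0 <= s -> s <= T -> phi s s = id) /\
  (forall t u s, 0 <= s -> s <= u -> u <= t -> t <= T ->
     phi t u \o phi u s = phi t s).

Definition is_solution_flow (eta : R) (phi : R -> R -> E -> E) : Prop :=
  is_flow phi /\
  exists2 mu, is_log_ode_map mu &
  exists2 eps : R, 0 < eps &
  forall r : R, 0 < r -> exists2 C : R, 0 < C &
  forall t s, 0 <= s -> s <= t -> t <= T -> `|t - s| <= eps ->
  forall x, `|x| <= r ->
    `|phi t s x - mu t s x| <= C * `|t - s| `^ eta.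

End SolutionFlows.

(* Main.v *)
From HB Require Import structures.
Require Import Defs.
From mathcomp Require Import all_boot all_order all_algebra.
From mathcomp Require Import all_classical all_reals all_analysis.
From mathcomp Require Import ring lra zify.
Import Order.TTheory GRing.Theory Num.Theory.
Import numFieldNormedType.Exports.
Set Implicit Arguments.
Unset Strict Implicit.
Unset Printing Implicit Defensive.
Local Open Scope classical_set_scope.
Local Open Scope ring_scope.

(** Non-explosion rests on one observation: although the vector fields of the
    log-ODE are only controlled through first and second derivatives of the
    functions f_J = V_{j_1} ... V_{j_n} Id, and may grow linearly, the defect
    mu_tu o mu_us - mu_ts of the log-ODE maps is bounded by
    c (1 + |x|) |t - s|^eta, with *linear* growth in x and eta = (N + 1) / p > 1,
    where N is the integer part of p.

    Such a family is called here an almost flow.  Iterating the maps mu along a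
    partition, the linear growth of the defect and of mu - Id is preserved: by
    induction on the number of points, cutting the interval near its middle, the
    iterates stay within C1 (1 + |x|) (t - s)^eta of mu_ts x with C1 independent
    of the partition ([partition_estimate]), so that they never leave a ball on
    [0, T] ([partition_bound]).  By compactness there is a path obeying the same
    estimate between any two close times ([exists_path]).  Two such paths with the
    same starting point coincide ([unique_path]): here the difference of two
    paths is compared with the difference of two orbits of mu, which needs a
    control of mu and of its defect on four points, available on balls because
    the f_J are C2.  Uniqueness gives the flow property ([exists_flow]).

    The same abstract result, applied to the Euler scheme x + (t - s) W x of one
    vector field, solves the ordinary differential equations that define mu
    ([ode_exists], [ode_unique]).

    It remains to see that the log-ODE maps form an almost flow.  Let Lambda be
    the logarithm of X_ts.  Dynkin's formula ([dynkin]), together with the fact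
    that elements of the free Lie algebra act as first order operators
    ([lie_derivation]), rewrites the sum of the Lambda^{k,I} V_[I] as the sum of
    the Lambda_J f_J over words of length 1 to N ([log_vfE]).  Along a solution y
    of the log-ODE the functions f_I(y_r), |I| <= N, satisfy a linear system with
    a remainder in which the derivatives of f_I meet f_K with |I| + |K| > N; only
    words of length at most N and first derivatives occur, so the remainder grows
    linearly, and it has order |t - s|^((N + 1 - |I|) / p).  Solving the system
    without remainder gives a Taylor polynomial, whose value at time 1 is the
    action of exp Lambda = X_ts on f_I ([taylor1]).  By Chen's relation these
    polynomials compose exactly, and the defect only contains the Taylor rests
    ([defect_expansion]). *)

(** * Almost flows: estimates along partitions *)

(** The inductive step of the partition estimate.  Here [o2], [o] are the
    weights of half of the interval and of the whole of it: halving turns the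
    constant C1 into at most lam * C1, and the two defects of the step, of total
    size 4 c, fit in the remaining (1 - lam) * C1. *)
Lemma sewing_arith (R : realFieldType) (kap c C1 lam : R)
    (k0 : 0 <= kap) (k1 : kap <= 1) (c0 : 0 <= c)
    (C0 : 0 <= C1) (Cc : 4 * c <= C1 * (1 - lam))
    (Y Yk Yk1 o2 o o1 o1' ok : R) :
  1 <= Y -> 0 <= Yk -> 0 <= Yk1 -> 1 + Yk <= (1 + 2 * kap) * Y ->
  1 + Yk1 <= (1 + kap) * (1 + Yk) -> 0 <= o2 -> 0 <= ok ->
  o1 <= o2 -> o1' <= o2 -> ok <= o -> 2 * (1 + kap) ^+ 2 * o2 <= lam * o ->
  C1 * (1 + Yk1) * o1' + c * (1 + Yk) * ok
    + (1 + kap) * (C1 * Y * o1) + c * Y * o <= C1 * Y * o.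
Proof.
move=> Y1 yk yk1 N1 N2 o20 ok0 l1 l2 l3 oh.
have o0 : 0 <= o := le_trans ok0 l3.
have Y0 : 0 <= Y by rewrite (le_trans _ Y1).
have A1 : C1 * (1 + Yk1) * o1' <= C1 * ((1 + kap) * ((1 + 2 * kap) * Y)) * o2.
  apply: (@le_trans _ _ (C1 * (1 + Yk1) * o2)).
    by rewrite ler_wpM2l// mulr_ge0// addr_ge0.
  rewrite ler_wpM2r// ler_wpM2l//; apply: le_trans N2 _.
  by rewrite ler_wpM2l// addr_ge0.
have A2 : c * (1 + Yk) * ok <= c * (3 * Y) * o.
  apply: ler_pM => //; rewrite ?mulr_ge0 ?addr_ge0// ler_wpM2l//.
  by apply: le_trans N1 _; rewrite ler_wpM2r//; clear -k1; lra.
have A3 : (1 + kap) * (C1 * Y * o1) <= (1 + kap) * (C1 * Y * o2).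
  by rewrite ler_wpM2l ?addr_ge0// ler_wpM2l// mulr_ge0.
have B : C1 * Y * (2 * (1 + kap) ^+ 2 * o2) <= C1 * Y * (lam * o).
  by rewrite ler_wpM2l// mulr_ge0.
have D : 4 * c * (Y * o) <= C1 * (1 - lam) * (Y * o).
  by rewrite ler_wpM2r// mulr_ge0.
have B2 : C1 * ((1 + kap) * ((1 + 2 * kap) * Y)) * o2
    + (1 + kap) * (C1 * Y * o2) = C1 * Y * (2 * (1 + kap) ^+ 2 * o2) by ring.
by clear -A1 A2 A3 B D B2; lra.
Qed.

Lemma ler_normD4 (R : numDomainType) (E : normedZmodType R) (a b e f : E) :
  `|a + b + e + f| <= `|a| + `|b| + `|e| + `|f|.
Proof.
apply: le_trans (ler_normD _ _) _; rewrite lerD2r.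
by apply: le_trans (ler_normD _ _) _; rewrite lerD2r ler_normD.
Qed.

Section AlmostFlow.
Variables (R : realType) (d : nat).
Local Notation E := 'rV[R]_d.

(** The model case is [om h] = h^eta with eta > 1: then [af_om_half] holds for
    some [lam] < 1 as soon as [kap] is small, and [af_om_eps] holds for small
    [eps].  Growth, Lipschitz constant and defect are controlled uniformly in
    space (up to linear growth); the estimates comparing two or four points,
    which serve for uniqueness only, are required on balls. *)
Record almost_flow (T eps kap lam c C1 : R) (om : R -> R)
    (mu : R -> R -> E -> E) : Prop := AlmostFlow {
  af_eps : 0 < eps ;
  af_kap0 : 0 <= kap ;
  af_kap1 : kap <= 1 ;
  af_lam0 : 0 <= lam ;
  af_lam1 : lam < 1 ;
  af_c : 0 <= c ;
  af_om0 : forall h, 0 <= h -> 0 <= om h ;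
  af_om_le : forall h k, 0 <= h -> h <= k -> om h <= om k ;
  af_om_half : forall h, 0 <= h -> h <= eps ->
    2 * (1 + kap) ^+ 2 * om (h / 2) <= lam * om h ;
  af_C1 : 0 <= C1 ;
  af_C1c : 4 * c <= C1 * (1 - lam) ;
  af_om_eps : C1 * om eps <= kap ;
  af_id : forall s x, 0 <= s -> s <= T -> mu s s x = x ;
  af_growth : forall t s x, 0 <= s -> s <= t -> t <= T -> t - s <= eps ->
    `|mu t s x - x| <= kap * (1 + `|x|) ;
  af_lip : forall t s x z, 0 <= s -> s <= t -> t <= T -> t - s <= eps ->
    `|mu t s x - mu t s z| <= (1 + kap) * `|x - z| ;
  af_defect : forall t u s x, 0 <= s -> s <= u -> u <= t -> t <= T ->
    t - s <= eps ->
    `|mu t u (mu u s x) - mu t s x| <= c * (1 + `|x|) * om (t - s) ;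
  af_local : forall r, 0 <= r -> exists2 b, 0 <= b &
    (forall t u s x z, 0 <= s -> s <= u -> u <= t -> t <= T ->
       t - s <= eps -> `|x| <= r -> `|z| <= r ->
       `|(mu t u (mu u s x) - mu t s x) - (mu t u (mu u s z) - mu t s z)|
         <= b * om (t - s) * `|x - z|) /\
    (forall t s a a' z z', 0 <= s -> s <= t -> t <= T -> t - s <= eps ->
       `|a| <= r -> `|a'| <= r -> `|z| <= r -> `|z'| <= r ->
       `|(mu t s a - mu t s a') - (mu t s z - mu t s z')|
         <= (1 + kap) * `|(a - a') - (z - z')|
            + b * (`|a - z| + `|a' - z'| + om (t - s))
                * (`|a - a'| + `|z - z'|)) }.

Variables (T eps kap lam c C1 : R) (om : R -> R) (mu : R -> R -> E -> E).
Hypothesis AF : almost_flow T eps kap lam c C1 om mu.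

Let C1_ge0 : 0 <= C1 := af_C1 AF.
#[local] Hint Resolve C1_ge0 : core.

Lemma exists_last_below (t : nat -> R) (i j : nat) (a : R) :
  (i <= j)%N -> t i <= a -> a < t j ->
  exists k, [/\ (i <= k)%N, (k < j)%N, t k <= a & a < t k.+1].
Proof.
move=> ij tia atj.
have ex : exists m, a < t (i + m)%N by exists (j - i)%N; rewrite subnKC.
case: (ex_minnP ex) => -[|m] am mmin; first by move: am; rewrite addn0 ltNge tia.
exists (i + m)%N; split.
- exact: leq_addr.
- have /mmin : a < t (i + (j - i))%N by rewrite subnKC.
  by move: ij; lia.
- by rewrite leNgt; apply/negP => /mmin; rewrite ltnn.
- by rewrite -addnS.
Qed.

Section Partition.
Variables (t : nat -> R) (y : nat -> E).
Hypothesis t0 : forall i, 0 <= t i.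
Hypothesis tT : forall i, t i <= T.
Hypothesis t_le : forall i j, (i <= j)%N -> t i <= t j.
Hypothesis yS : forall i, y i.+1 = mu (t i.+1) (t i) (y i).

Lemma partition_same i j : (i <= j)%N -> t i = t j -> y i = y j.
Proof.
elim: j => [|j IH]; first by rewrite leqn0 => /eqP ->.
rewrite leq_eqVlt => /orP[/eqP -> //|]; rewrite ltnS => ij tij.
have tj : t j = t i.
  by apply: le_anti; rewrite (t_le ij) andbT tij; apply: t_le.
by rewrite yS -tij -tj (af_id AF)// IH.
Qed.

Lemma mu_size_le u s x : 0 <= s -> s <= u -> u <= T -> u - s <= eps ->
  1 + `|mu u s x| <= (1 + kap) * (1 + `|x|).
Proof.
move=> s0 su uT ue; have := af_growth AF x s0 su uT ue => h.
have : `|mu u s x| <= `|mu u s x - x| + `|x| by rewrite -{1}(subrK x (mu u s x)) ler_normD.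
by move: h; lra.
Qed.

(** Cut the partition at the last point k before the middle of the interval.
    Both [i, k] and [k + 1, j] are at most half as long as [i, j], and contain
    fewer points; they are joined by the single step from k to k + 1, which costs
    two defects.  The constant C1 is the same for every partition. *)
Lemma partition_estimate n i j : (j - i <= n)%N -> (i <= j)%N ->
  t j - t i <= eps ->
  `|y j - mu (t j) (t i) (y i)| <= C1 * (1 + `|y i|) * om (t j - t i).
Proof.
have [k0 k1 l0 l1 c0] := And5 (af_kap0 AF) (af_kap1 AF) (af_lam0 AF) (af_lam1 AF) (af_c AF).
elim: n i j => [|n IH] i j.
  rewrite leqn0 subn_eq0 => ji ij; have -> : i = j by apply/eqP; rewrite eqn_leq ij.
  by rewrite (af_id AF)// !subrr normr0 !mulr_ge0 ?addr_ge0// (af_om0 AF).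
move=> jin ij tije.
have [tij|tij] := eqVneq (t i) (t j).
  have -> : y j - mu (t j) (t i) (y i) = 0.
    by rewrite -(partition_same ij tij) -tij (af_id AF)// subrr.
  by rewrite normr0 !mulr_ge0 ?addr_ge0// (af_om0 AF)// subr_ge0 t_le.
have hpos : 0 < t j - t i by rewrite subr_gt0 lt_neqAle tij t_le.
have {tij} [h hE] : exists h, h = t j - t i by exists (t j - t i).
rewrite -hE in tije hpos *; have h0 := ltW hpos.
have [||k [ik kj tk tk1]] := @exists_last_below t i j (t i + h / 2) ij.
- by clear -AF C1_ge0 t0 tT t_le yS hpos; lra.
- by clear -AF C1_ge0 t0 tT t_le yS hpos hE; lra.
have tik := t_le ik; have tkk := t_le (leqnSn k); have tkj := t_le kj.
have tk' : t k - t i <= h / 2 by clear -AF C1_ge0 t0 tT t_le yS tk; lra.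
have tk1' : t j - t k.+1 <= h / 2 by clear -AF C1_ge0 t0 tT t_le yS tk1 hE; lra.
have tjk' : t j - t k <= h by clear -AF C1_ge0 t0 tT t_le yS tik hE; lra.
have h2e : h / 2 <= eps by clear -AF C1_ge0 t0 tT t_le yS tije hpos; lra.
have tjk : t k <= t j by clear -AF C1_ge0 t0 tT t_le yS tkk tkj; lra.
have h2h : h / 2 <= h by clear -AF C1_ge0 t0 tT t_le yS hpos; lra.
have IH1 : `|y k - mu (t k) (t i) (y i)| <= C1 * (1 + `|y i|) * om (t k - t i).
  by apply: IH; [clear -AF C1_ge0 t0 tT t_le yS jin ik kj; lia|by []|exact: le_trans tk' h2e].
have IH2 : `|y j - mu (t j) (t k.+1) (y k.+1)|
    <= C1 * (1 + `|y k.+1|) * om (t j - t k.+1).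
  by apply: IH; [clear -AF C1_ge0 t0 tT t_le yS jin ik kj; lia|by []|exact: le_trans tk1' h2e].
have om1 : om (t k - t i) <= om (h / 2) by apply: (af_om_le AF); rewrite ?subr_ge0.
have om2 : om (t j - t k.+1) <= om (h / 2).
  by apply: (af_om_le AF); rewrite ?subr_ge0.
have om3 : om (t j - t k) <= om h by apply: (af_om_le AF); rewrite ?subr_ge0.
have omh0 : 0 <= om (h / 2) by apply: (af_om0 AF); rewrite divr_ge0.
have omH : 2 * (1 + kap) ^+ 2 * om (h / 2) <= lam * om h by apply: (af_om_half AF).
have omhe : om h <= om eps by apply: (af_om_le AF).
have omh1 : om (h / 2) <= om h by apply: (af_om_le AF); rewrite ?divr_ge0.
have C1e : C1 * om eps <= kap := af_om_eps AF.
have D1 : `|mu (t j) (t k.+1) (y k.+1) - mu (t j) (t k) (y k)|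
    <= c * (1 + `|y k|) * om (t j - t k).
  rewrite yS; apply: (af_defect AF) => //; exact: le_trans tjk' tije.
have D2 : `|mu (t j) (t k) (mu (t k) (t i) (y i)) - mu (t j) (t i) (y i)|
    <= c * (1 + `|y i|) * om h.
  by rewrite hE; apply: (af_defect AF) => //; rewrite -hE.
have L : `|mu (t j) (t k) (y k) - mu (t j) (t k) (mu (t k) (t i) (y i))|
    <= (1 + kap) * `|y k - mu (t k) (t i) (y i)|.
  by apply: (af_lip AF) => //; exact: le_trans tjk' tije.
have Y0 : 0 <= `|y i| by [].
set Yi := 1 + `|y i| in IH1 D2 *.
have Yi1 : 1 <= Yi by rewrite /Yi lerDl.
have N1 : 1 + `|y k| <= (1 + 2 * kap) * Yi.
  have M1 : 1 + `|mu (t k) (t i) (y i)| <= (1 + kap) * Yi.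
    by apply: mu_size_le => //; exact: le_trans tk' h2e.
  have : `|y k| <= `|y k - mu (t k) (t i) (y i)| + `|mu (t k) (t i) (y i)|.
    by rewrite -{1}(subrK (mu (t k) (t i) (y i)) (y k)) ler_normD.
  have : C1 * Yi * om (t k - t i) <= kap * Yi.
    rewrite mulrAC ler_wpM2r//; first by rewrite (le_trans _ Yi1).
    apply: le_trans C1e; rewrite ler_wpM2l//.
    by rewrite (le_trans om1)// (le_trans omh1).
  by clear -AF C1_ge0 t0 tT t_le yS M1 IH1; lra.
have N2 : 1 + `|y k.+1| <= (1 + kap) * (1 + `|y k|).
  by rewrite yS; apply: mu_size_le => //; clear -AF C1_ge0 t0 tT t_le yS tkj tjk' tije; lra.
rewrite (_ : y j - _ = (y j - mu (t j) (t k.+1) (y k.+1))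
   + (mu (t j) (t k.+1) (y k.+1) - mu (t j) (t k) (y k))
   + (mu (t j) (t k) (y k) - mu (t j) (t k) (mu (t k) (t i) (y i)))
   + (mu (t j) (t k) (mu (t k) (t i) (y i)) - mu (t j) (t i) (y i))); last first.
  by rewrite !addrA !subrK.
apply: le_trans (ler_normD4 _ _ _ _) _.
apply: le_trans (lerD (lerD (lerD IH2 D1) (le_trans L _)) D2) _.
  by apply: ler_wpM2l IH1; rewrite addr_ge0.
have om4 : 0 <= om (t j - t k) by apply: (af_om0 AF); rewrite subr_ge0.
exact: (sewing_arith k0 k1 c0 C1_ge0 (af_C1c AF) Yi1 _ _ N1 N2 omh0 om4 om1 om2 om3).
Qed.

Hypothesis mesh : forall i, t i.+1 - t i <= eps.

(** A window of length [eps] multiplies 1 + |y| by at most 1 + 2 kap <= 3, and the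
    step leaving the window by at most 1 + kap <= 2. *)
Lemma partition_bound n i j : (i <= j)%N -> t j - t i <= n%:R * eps ->
  1 + `|y j| <= 6 ^+ n * (1 + `|y i|).
Proof.
have [k0 k1 e0] := And3 (af_kap0 AF) (af_kap1 AF) (af_eps AF).
elim: n i => [|n IH] i ij tij.
  rewrite mul0r subr_le0 in tij; rewrite expr0 mul1r.
  by rewrite (partition_same ij) //; apply: le_anti; rewrite tij t_le.
have Yi : 0 <= 1 + `|y i| by rewrite addr_ge0.
have short k : (i <= k)%N -> t k - t i <= eps -> 1 + `|y k| <= 3 * (1 + `|y i|).
  move=> ik tik; have tik' := t_le ik.
  have M1 : 1 + `|mu (t k) (t i) (y i)| <= (1 + kap) * (1 + `|y i|).
    by apply: mu_size_le.
  have M2 : `|y k| <= `|y k - mu (t k) (t i) (y i)| + `|mu (t k) (t i) (y i)|.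
    by rewrite -{1}(subrK (mu (t k) (t i) (y i)) (y k)) ler_normD.
  have M3 := partition_estimate (leqnn _) ik tik.
  have M4 : C1 * (1 + `|y i|) * om (t k - t i) <= kap * (1 + `|y i|).
    rewrite mulrAC ler_wpM2r//; apply: le_trans (af_om_eps AF).
    by rewrite ler_wpM2l//; apply: (af_om_le AF); rewrite ?subr_ge0.
  have M5 : kap * (1 + `|y i|) <= 1 * (1 + `|y i|) by rewrite ler_wpM2r.
  by clear -AF C1_ge0 t0 tT t_le yS mesh M1 M2 M3 M4 M5; lra.
have six : 1 <= 6 ^+ n :> R by apply: exprn_ege1; rewrite ler1n.
have [tje|tje] := leP (t j - t i) eps.
  apply: le_trans (short j ij tje) _; rewrite exprS -mulrA.
  have H : 1 * (1 + `|y i|) <= 6 ^+ n * (1 + `|y i|) by rewrite ler_wpM2r.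
  by clear -AF C1_ge0 t0 tT t_le yS mesh H Yi; lra.
have [||k [ik kj tk tk1]] := @exists_last_below t i j (t i + eps) ij.
- by clear -AF C1_ge0 t0 tT t_le yS mesh e0; lra.
- by clear -AF C1_ge0 t0 tT t_le yS mesh tje; lra.
have yk : 1 + `|y k| <= 3 * (1 + `|y i|) by apply: short => //; clear -AF C1_ge0 t0 tT t_le yS mesh tk; lra.
have yk1 : 1 + `|y k.+1| <= (1 + kap) * (1 + `|y k|).
  by rewrite yS; apply: mu_size_le => //; apply: t_le.
have yk1' : 1 + `|y k.+1| <= 6 * (1 + `|y i|).
  apply: le_trans yk1 _; apply: (@le_trans _ _ (2 * (3 * (1 + `|y i|)))).
    by apply: ler_pM => //; rewrite ?addr_ge0//; clear -AF C1_ge0 t0 tT t_le yS mesh k1; lra.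
  by lra.
apply: (le_trans (IH k.+1 kj _)).
  by move: tij; rewrite -natr1 mulrDl mul1r; clear -AF C1_ge0 t0 tT t_le yS mesh tk1; lra.
rewrite exprS -mulrA mulrCA ler_wpM2l//; exact: le_trans six.
Qed.

End Partition.

End AlmostFlow.

(** * Existence of a path close to an almost flow *)
Lemma lipschitz_cont (R : realType) d (f : 'rV[R]_d -> 'rV[R]_d) (k : R) :
  (forall x z, `|f x - f z| <= k * `|x - z|) -> continuous f.
Proof.
move=> fk x A /(@nbhs_normP R 'rV[R]_d)[e /= e0 eA].
apply/(@nbhs_normP R 'rV[R]_d).
have k1 : 0 < `|k| + 1 by rewrite ltr_wpDl.
exists (e / (`|k| + 1)); first by rewrite /= divr_gt0.
move=> z /=; rewrite ltr_pdivlMr// mulrC => xz; apply: eA => /=.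
apply: le_lt_trans xz.
apply: le_trans (fk x z) _.
by rewrite ler_wpM2r// (le_trans (ler_norm k))// lerDl.
Qed.

Section Existence.
Variable (R : realType).

Lemma exists_partition (eps T s : R) (S : seq R) : 0 < eps -> s <= T ->
  exists t : nat -> R,
    [/\ t 0 = s, forall i, s <= t i /\ t i <= T,
        forall i j, (i <= j)%N -> t i <= t j,
        forall i, t i.+1 - t i <= eps
      & forall r, r \in S -> s <= r -> r <= T -> exists i, t i = r].
Proof.
move=> e0 sT.
pose m := (Num.truncn ((T - s) / eps)).+1.
pose g := [seq s + k%:R * eps | k <- iota 0 m].
pose L := sort <=%R [seq r <- S ++ g | s <= r & r <= T].
have memL r : (r \in L) = [&& r \in S ++ g, s <= r & r <= T].
  by rewrite mem_sort mem_filter andbC.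
pose t i := nth T (s :: L) i.
have tst i : s <= t i <= T.
  have : all (fun r => s <= r <= T) (s :: L).
    by rewrite /= lexx sT; apply/allP => r; rewrite memL => /and3P[_ -> ->].
  move=> /all_nthP H; case: (ltnP i (size (s :: L))) => il; first exact: H.
  by rewrite /t nth_default ?lexx ?sT.
have sortL : sorted <=%R (s :: L).
  rewrite /= path_min_sorted ?sort_le_sorted//.
  by apply/allP => r; rewrite memL => /and3P[_ -> _].
have t_le i j : (i <= j)%N -> t i <= t j.
  move=> ij; case: (ltnP j (size (s :: L))) => jl.
    apply: (sorted_leq_nth le_trans lexx) => //; rewrite inE//.
    exact: leq_ltn_trans ij jl.
  by rewrite [leRHS]/t nth_default//; case/andP: (tst i).
have tL r : r \in s :: L -> exists i, t i = r.
  by move=> rL; exists (index r (s :: L)); rewrite /t nth_index.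
exists t; split=> //.
- by move=> i; apply/andP.
- move=> i; rewrite leNgt; apply/negP => te.
  have /andP[sti tiT] := tst i; have /andP[_ tiT1] := tst i.+1.
  pose k := (Num.truncn ((t i - s) / eps)).+1.
  have ti0 : 0 <= (t i - s) / eps by rewrite divr_ge0 ?subr_ge0// ltW.
  have k1 : t i < s + k%:R * eps.
    by rewrite -ltrBlDl -ltr_pdivrMr// truncnS_gt.
  have k2 : s + k%:R * eps <= t i + eps.
    rewrite -natr1 mulrDl mul1r addrA lerD2r -lerBrDl -ler_pdivlMr//.
    by case/andP: (truncn_itv ti0).
  have k3 : s + k%:R * eps <= T by move: te tiT1 k2; clear; lra.
  have [|j tj] := tL (s + k%:R * eps).
    rewrite inE memL mem_cat; apply/orP; right; apply/and3P; split=> //.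
      apply/orP; right; apply/mapP; exists k => //; rewrite mem_iota/= add0n.
      rewrite ltnS -ltnS -/k /m -(ltr_nat R) -natr1.
      have : k%:R <= (T - s) / eps by rewrite ler_pdivlMr// lerBrDl.
      move=> /le_lt_trans; apply.
      by apply: lt_le_trans (truncnS_gt _) _; rewrite -natr1 lerD2r ler_nat//.
    by move: sti k1; clear; lra.
  case: (ltnP i j) => [ij|ji].
    have := t_le _ _ ij; rewrite tj; move: k2 te; clear; lra.
  by have := t_le _ _ ji; rewrite tj; move: k1; clear; lra.
- move=> r rS sr rT; apply: tL; rewrite inE memL mem_cat rS sr rT /=.
  by rewrite orbT.
Qed.

Variables (d : nat).
Local Notation E := 'rV[R]_d.
Variables (T eps kap lam c C1 : R) (om : R -> R) (mu : R -> R -> E -> E).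
Hypothesis AF : almost_flow T eps kap lam c C1 om mu.

(** For a finite set S of times, the iterates of mu along a fine partition
    containing S satisfy the estimate between the times of S, within a bound B
    that depends neither on S nor on the partition.  These closed conditions
    decrease with S, so by Tychonoff's theorem some path satisfies them all. *)
Lemma exists_path s x : 0 <= s -> s <= T ->
  exists y : R -> E,
    [/\ y s = x, exists B, forall t, s <= t -> t <= T -> `|y t| <= B
      & forall t u, s <= u -> u <= t -> t <= T -> t - u <= eps ->
          `|y t - mu t u (y u)| <= C1 * (1 + `|y u|) * om (t - u)].
Proof.
move=> s0 sT.
have e0 := af_eps AF.
pose n := (Num.truncn ((T - s) / eps)).+1.
pose B := 6 ^+ n * (1 + `|x|).
pose K (S : seq R) : set (prod_topology (fun _ : R => E)) := [set y |
  [/\ y s = x, forall t, `|y t| <= B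
    & forall t u, t \in S -> u \in S -> s <= u -> u <= t -> t <= T ->
        t - u <= eps ->
        `|y t - mu t u (y u)| <= C1 * (1 + `|y u|) * om (t - u)]].
have K0 S : K S !=set0.
  have [t [t0 tst t_le mesh tS]] := exists_partition S e0 sT.
  pose z := fix z i := if i is j.+1 then mu (t j.+1) (t j) (z j) else x.
  have ti0 i : 0 <= t i by apply: le_trans s0 _; case: (tst i).
  have tiT i : t i <= T by case: (tst i).
  have zS i : z i.+1 = mu (t i.+1) (t i) (z i) by [].
  have zB i : `|z i| <= B.
    have H : t i - t 0 <= n%:R * eps.
      rewrite t0 -ler_pdivrMr//.
      apply: (@le_trans _ _ ((T - s) / eps)).
        by rewrite ler_pM2r ?invr_gt0// lerD2r.
      by apply: ltW; apply: truncnS_gt.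
    have := partition_bound AF ti0 tiT t_le zS mesh (leq0n i) H.
    by apply: le_trans; rewrite lerDr.
  have B0 : 0 <= B := le_trans (normr_ge0 _) (zB 0).
  pose y r : E := if pselect (exists i, t i = r) is left ex then z (projT1 (cid ex)) else 0.
  have yt i : y (t i) = z i.
    rewrite /y; case: pselect => [ex|[]]; last by exists i.
    case: cid => j /= tj; case/orP: (leq_total i j) => ij.
      by apply/esym/(partition_same AF ti0 tiT t_le zS).
    by apply: (partition_same AF ti0 tiT t_le zS).
  exists y; split.
  - by rewrite -t0 yt.
  - by move=> r; rewrite /y; case: pselect => // _; rewrite normr0.
  - move=> r u rS uS su ur rT rue.
    have [i ti] := tS r rS (le_trans su ur) rT.
    have [j tj] := tS u uS su (le_trans ur rT).
    have {i ti} [i ti ji] : exists2 i, t i = r & (j <= i)%N.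
      case/orP: (leq_total j i) => ij; first by exists i.
      by exists j => //; apply: le_anti; rewrite tj ur /= -ti -tj t_le.
    rewrite -ti -tj in rue *; rewrite !yt.
    exact: (partition_estimate AF ti0 tiT t_le zS (leqnn _)).
have Kanti S S' : {subset S <= S'} -> K S' `<=` K S.
  move=> SS' y [ys yB yK]; split=> // t u tS uS; exact: yK (SS' _ tS) (SS' _ uS).
have FK : ProperFilter (filter_from [set: seq R] K).
  apply: filter_from_proper => //; apply: filter_fromT_filter; first by exists [::].
  move=> S S'; exists (S ++ S') => y Ky; split; apply: Kanti Ky => r;
    by rewrite mem_cat => ->; rewrite ?orbT.
have cB : compact [set v : E | `|v| <= B].
  apply: bounded_closed_compact.
    by exists B; split; [exact: num_real|move=> M BM v /= /le_trans; apply; exact: ltW].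
  apply: (@closed_comp _ _ (Num.norm : E -> R) [set r | r <= B]); last exact: closed_le.
  by move=> v _; exact: norm_continuous.
have cT := @tychonoff R (fun=> E) (fun=> [set v : E | `|v| <= B]) (fun=> cB).
have [y [yB]] := cT _ FK (ex_intro2 _ _ [::] I (fun y Ky t => let: And3 _ yB _ := Ky in yB t)).
rewrite clusterE => ycl.
have clos (A : set (prod_topology (fun _ : R => E))) S : closed A -> K S `<=` A -> A y.
  by move=> /closure_id AE KA; rewrite AE; apply: ycl; exists S.
have contp r : continuous (fun y : prod_topology (fun _ : R => E) => (y r : E)).
  exact: (@proj_continuous R (fun=> E) r).
exists y; split.
- apply: (clos [set z | z s = x] [::]) => [|z [] //].
  apply: (@closed_comp _ _ (fun z : prod_topology (fun _ : R => E) => z s : E) [set x]).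
    by move=> z _; exact: contp.
  by apply: accessible_closed_set1; apply: hausdorff_accessible; exact: norm_hausdorff.
- by exists B => t _ _; apply: yB.
- move=> t u su ut tT tue.
  apply: (clos [set z | `|z t - mu t u (z u)| <= C1 * (1 + `|z u|) * om (t - u)]
    [:: t; u]); last first.
    by move=> z [_ _ zK]; apply: zK; rewrite ?inE ?eqxx ?orbT.
  have cmu : continuous (mu t u : E -> E).
    apply: (@lipschitz_cont _ _ _ (1 + kap)) => a b; apply: (af_lip AF) => //.
    exact: le_trans su.
  pose o := om (t - u).
  rewrite (_ : mkset _ = (fun z : prod_topology (fun _ : R => E) =>
     `|z t - mu t u (z u)| - C1 * (1 + `|z u|) * o) @^-1` [set r : R | r <= 0]); last first.
    by apply/seteqP; split=> z /=; rewrite subr_le0.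
  apply: closed_comp; last exact: closed_le.
  move=> z _.
  apply: (@continuousB R R _ (fun z : prod_topology (fun _ : R => E) =>
     `|z t - mu t u (z u)|) (fun z : prod_topology (fun _ : R => E) => C1 * (1 + `|z u|) * o)).
    apply: (@continuous_comp _ _ _ (fun z : prod_topology (fun _ : R => E) =>
     z t - mu t u (z u)) (Num.norm : E -> R)); last exact: norm_continuous.
    apply: (@continuousB R E _ (fun z : prod_topology (fun _ : R => E) => z t : E)
      (fun z : prod_topology (fun _ : R => E) => mu t u (z u) : E)).
      exact: contp.
    apply: (@continuous_comp _ _ _ (fun z : prod_topology (fun _ : R => E) => z u : E)
      (mu t u : E -> E)); [exact: contp|exact: cmu].
  apply: (@continuousM R _ (fun z : prod_topology (fun _ : R => E) => C1 * (1 + `|z u|))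
    (fun=> o)); last exact: cst_continuous.
  apply: (@continuousM R _ (fun=> C1) (fun z : prod_topology (fun _ : R => E) =>
    (1 + `|z u|))); first exact: cst_continuous.
  apply: (@continuousD R R _ (fun=> 1) (fun z : prod_topology (fun _ : R => E) => `|z u|));
    first exact: cst_continuous.
  apply: (@continuous_comp _ _ _ (fun z : prod_topology (fun _ : R => E) =>
     z u : E) (Num.norm : E -> R)); [exact: contp|exact: norm_continuous].
Qed.

End Existence.

(** * Uniqueness of the path *)
Section Uniqueness.
Variables (R : realType) (d : nat).
Local Notation E := 'rV[R]_d.
Variables (T eps kap lam c C1 : R) (om : R -> R) (mu : R -> R -> E -> E).
Hypothesis AF : almost_flow T eps kap lam c C1 om mu.

Definition sol_path (s : R) (y : R -> E) : Prop :=
  (exists B, forall t, s <= t -> t <= T -> `|y t| <= B) /\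
  exists C, forall t u, s <= u -> u <= t -> t <= T -> t - u <= eps ->
    `|y t - mu t u (y u)| <= C * om (t - u).

(** By [af_om_half], halving the argument at least halves [om]. *)
Lemma om_small a : 0 < a -> exists2 e, 0 < e <= eps & om e <= a.
Proof.
move=> a0; have e0 := af_eps AF.
have pos n : 0 < eps / 2 ^+ n by rewrite divr_gt0// exprn_gt0.
have le_eps n : eps / 2 ^+ n <= eps.
  by rewrite ler_pdivrMr ?exprn_gt0// ler_peMr// ?(ltW e0)// exprn_ege1// ler1n.
have omn n : om (eps / 2 ^+ n) * 2 ^+ n <= om eps.
  elim: n => [|n IH]; first by rewrite expr0 divr1 mulr1.
  apply: le_trans IH.
  have -> : eps / 2 ^+ n.+1 = eps / 2 ^+ n / 2 by rewrite exprSr invfM mulrA.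
  rewrite exprS mulrA ler_wpM2r// ?exprn_ge0//.
  have h1 := af_om_half AF (ltW (pos n)) (le_eps n).
  have h2 : lam * om (eps / 2 ^+ n) <= 1 * om (eps / 2 ^+ n).
    by rewrite ler_wpM2r// ?(af_om0 AF)// ltW// (af_lam1 AF).
  have h3 : 2 * 1 * om (eps / 2 ^+ n / 2) <= 2 * (1 + kap) ^+ 2 * om (eps / 2 ^+ n / 2).
    apply: ler_wpM2r; first by apply: (af_om0 AF); rewrite divr_ge0// ltW.
    by apply: ler_wpM2l => //; rewrite exprn_ege1// lerDl (af_kap0 AF).
  by clear -AF h1 h2 h3; lra.
have [n nP] : exists n, om eps / a <= 2 ^+ n.
  exists (Num.truncn (om eps / a)).+1.
  apply: (le_trans (ltW (truncnS_gt _))).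
  by rewrite -natrX ler_nat ltnW// ltn_expl.
exists (eps / 2 ^+ n); first by rewrite pos le_eps.
rewrite -(ler_pM2r (_ : 0 < 2 ^+ n)) ?exprn_gt0//.
by apply: le_trans (omn n) _; rewrite mulrC -ler_pdivrMr.
Qed.

(** Let J be the difference of the local errors of the two paths.  On a short
    interval, a bound a for |J| / om and a bound m for |y - z| are improved by
    turns: splitting an interval at its middle replaces a by lam * a + b' * m,
    since the four-point estimates bound everything else by m, and a bound for J
    with y = z at the left end is a bound for y - z.  Iterating, both tend to 0. *)
Lemma unique_path s y z : 0 <= s -> sol_path s y -> sol_path s z ->
  y s = z s -> forall t, s <= t -> t <= T -> y t = z t.
Proof.
move=> s0 [[By yB] [Cy yC]] [[Bz zB] [Cz zC]] yz.
have [k0 k1 e0 l1 l0] := And5 (af_kap0 AF) (af_kap1 AF) (af_eps AF) (af_lam1 AF) (af_lam0 AF).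
pose B := Num.max 0 (Num.max By Bz); pose C := Num.max 0 (Num.max Cy Cz).
have B0 : 0 <= B by rewrite /B le_max lexx.
have C0 : 0 <= C by rewrite /C le_max lexx.
have {}yB t : s <= t -> t <= T -> `|y t| <= B.
  by move=> st tT; rewrite /B !le_max yB ?orbT.
have {}zB t : s <= t -> t <= T -> `|z t| <= B.
  by move=> st tT; rewrite /B !le_max zB ?orbT.
have {}yC t u : s <= u -> u <= t -> t <= T -> t - u <= eps ->
    `|y t - mu t u (y u)| <= C * om (t - u).
  move=> su ut tT tue; apply: le_trans (yC t u su ut tT tue) _.
  by rewrite ler_wpM2r ?(af_om0 AF) ?subr_ge0// /C !le_max lexx orbT.
have {}zC t u : s <= u -> u <= t -> t <= T -> t - u <= eps ->
    `|z t - mu t u (z u)| <= C * om (t - u).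
  move=> su ut tT tue; apply: le_trans (zC t u su ut tT tue) _.
  by rewrite ler_wpM2r ?(af_om0 AF) ?subr_ge0// /C !le_max lexx !orbT.
clearbody B C; clear By Bz Cy Cz.
pose r := 2 * (1 + B).
have r0 : 0 <= r by rewrite mulr_ge0// addr_ge0.
have [b b0 [loc loc4]] := af_local AF r0.
pose J t u := (y t - mu t u (y u)) - (z t - mu t u (z u)).
pose b' := b + 3 * (b * (2 * C + 1)).
have b'0 : 0 <= b' by rewrite addr_ge0// !mulr_ge0// addr_ge0// mulr_ge0.
(* The three groups of [JE]: the error on the right half, the error on the left
   half transported by mu, and the difference of two defects. *)
have step a m p e : 0 <= a -> s <= p -> e <= eps ->
    (forall t u, p <= u -> u <= t -> t <= T -> t - p <= e ->
       `|J t u| <= a * om (t - u)) ->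
    (forall t, p <= t -> t <= T -> t - p <= e -> `|y t - z t| <= m) ->
    forall t u, p <= u -> u <= t -> t <= T -> t - p <= e ->
       `|J t u| <= (lam * a + b' * m) * om (t - u).
  move=> a0 sp ee HJ Hm t u pu ut tT tpe.
  pose v := (t + u) / 2.
  have vE : v = (t + u) / 2 by [].
  have uv : u <= v by rewrite vE; clear -AF ut; lra.
  have vt : v <= t by rewrite vE; clear -AF ut; lra.
  have tvE : t - v = (t - u) / 2 by rewrite vE; field.
  have vuE : v - u = (t - u) / 2 by rewrite vE; field.
  have su := le_trans sp pu; have sv := le_trans su uv.
  have u0 := le_trans s0 su; have v0 := le_trans u0 uv.
  have vT := le_trans vt tT; have uT := le_trans uv vT.
  have vpe : v - p <= e by apply: le_trans tpe; rewrite lerD2r.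
  have upe : u - p <= e by apply: le_trans vpe; rewrite lerD2r.
  have tue : t - u <= eps.
    by apply: le_trans ee; apply: le_trans tpe; rewrite lerB.
  have tve : t - v <= eps by apply: le_trans tue; rewrite lerB.
  have vue : v - u <= eps by apply: le_trans tue; rewrite lerB.
  have pv := le_trans pu uv.
  have h0 : 0 <= t - u by rewrite subr_ge0.
  have h20 : 0 <= (t - u) / 2 by rewrite divr_ge0.
  have o0 := af_om0 AF h0; have o20 := af_om0 AF h20.
  have o2 : om ((t - u) / 2) <= om (t - u).
    by apply: (af_om_le AF) => //; rewrite -tvE lerB.
  have oh := af_om_half AF h0 tue.
  have JE : J t u = J t v + ((mu t v (y v) - mu t v (z v))
      - (mu t v (mu v u (y u)) - mu t v (mu v u (z u))))
      + ((mu t v (mu v u (y u)) - mu t u (y u))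
         - (mu t v (mu v u (z u)) - mu t u (z u))).
    by rewrite /J; apply/rowP => i; rewrite !mxE; ring.
  have small (w : E) : `|w| <= B -> `|w| <= r by move=> wB; rewrite /r; clear -AF wB B0; lra.
  have mubd (w : E) : `|w| <= B -> `|mu v u w| <= r.
    move=> wB; have := mu_size_le AF w u0 uv vT vue.
    have : (1 + kap) * (1 + `|w|) <= 2 * (1 + B).
      by apply: ler_pM; rewrite ?addr_ge0//; clear -AF k1 wB; lra.
    by rewrite /r; clear -AF; lra.
  have yu := yB _ su uT; have zu := zB _ su uT.
  have yv := yB _ sv vT; have zv := zB _ sv vT.
  have H1 := HJ t v pv vt tT tpe; rewrite tvE in H1.
  have H2 := HJ v u pu uv vT vpe; rewrite vuE in H2.
  have H3 := loc t v u (y u) (z u) u0 uv vt tT tue (small _ yu) (small _ zu).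
  have H4 := loc4 t v (y v) (z v) (mu v u (y u)) (mu v u (z u)) v0 vt tT tve
    (small _ yv) (small _ zv) (mubd _ yu) (mubd _ zu).
  have H5 := af_lip AF (y u) (z u) u0 uv vT vue.
  have m1 := Hm u pu uT upe; have m2 := Hm v pv vT vpe.
  have c1 := yC v u su uv vT vue; have c2 := zC v u su uv vT vue.
  rewrite vuE in c1 c2; rewrite tvE in H4.
  have m0 : 0 <= m := le_trans (normr_ge0 _) m1.
  have H5' : `|mu v u (y u) - mu v u (z u)| <= 2 * m.
    by apply: le_trans H5 _; apply: ler_pM => //; rewrite ?addr_ge0//; clear -AF k1; lra.
  have JvuE : (y v - z v) - (mu v u (y u) - mu v u (z u)) = J v u.
    by rewrite /J; apply/rowP => i; rewrite !mxE; ring.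
  rewrite JvuE in H4.
  have H6 : b * (`|y v - mu v u (y u)| + `|z v - mu v u (z u)| + om ((t - u) / 2))
         * (`|y v - z v| + `|mu v u (y u) - mu v u (z u)|)
      <= b * ((2 * C + 1) * om (t - u)) * (3 * m).
    apply: ler_pM; rewrite ?addr_ge0 ?mulr_ge0 ?addr_ge0//.
      rewrite ler_wpM2l//.
      have : C * om ((t - u) / 2) <= C * om (t - u) by rewrite ler_wpM2l.
      by clear -AF c1 c2 o2; lra.
    by clear -AF m2 H5'; lra.
  have H7 : b * om (t - u) * `|y u - z u| <= b * om (t - u) * m.
    by rewrite ler_wpM2l// mulr_ge0.
  have H8 : (1 + kap) * `|J v u| <= (1 + kap) * (a * om ((t - u) / 2)).
    by rewrite ler_wpM2l// addr_ge0.
  have H9 : a * (2 * (1 + kap) ^+ 2 * om ((t - u) / 2)) <= a * (lam * om (t - u)).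
    by rewrite ler_wpM2l.
  have H10 : (a * om ((t - u) / 2)) * (2 + kap)
     <= (a * om ((t - u) / 2)) * (2 * (1 + kap) ^+ 2).
    rewrite ler_wpM2l// ?mulr_ge0// expr2.
    have : 0 <= kap * kap by rewrite mulr_ge0.
    by clear -AF k0; lra.
  rewrite JE; apply: le_trans (ler_normD _ _) _.
  apply: le_trans (lerD (ler_normD _ _) H3) _.
  have bE : b' * m * om (t - u) = b * om (t - u) * m
       + b * ((2 * C + 1) * om (t - u)) * (3 * m) by rewrite /b'; ring.
  by rewrite mulrDl bE; clear -AF H1 H4 H6 H7 H8 H9 H10; lra.
(* The bounds will be A * rho^n for |J| / om and A * rho^n * k for |y - z|; the
   choice of k gives lam + b' * k <= rho, and that of e gives om e <= k * rho. *)
pose rho := (1 + lam) / 2.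
pose k := (1 - lam) / (2 * (b' + 1)).
have b'1 : 0 < b' + 1 by rewrite ltr_wpDl.
have kpos : 0 < k by rewrite divr_gt0 ?subr_gt0// mulr_gt0.
have b'k : b' * k <= (1 - lam) / 2.
  have kE : k * (b' + 1) = (1 - lam) / 2 by rewrite /k; field; rewrite gt_eqF.
  by clearbody k; clear -AF kE kpos; lra.
have rho0 : 0 < rho by rewrite divr_gt0// ltr_wpDr.
have rho1 : rho < 1 by rewrite /rho; clear -AF l1; lra.
have [|e /andP[epos ee] ome] := @om_small (k * rho); first by rewrite mulr_gt0.
have local p : s <= p -> y p = z p ->
    forall t, p <= t -> t <= T -> t - p <= e -> y t = z t.
  move=> sp yzp.
  pose A := Num.max (2 * C) (2 * B / k).
  have A0 : 0 <= A by rewrite /A le_max mulr_ge0.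
  have iter n : (forall t u, p <= u -> u <= t -> t <= T -> t - p <= e ->
       `|J t u| <= A * rho ^+ n * om (t - u)) /\
    (forall t, p <= t -> t <= T -> t - p <= e -> `|y t - z t| <= A * rho ^+ n * k).
    elim: n => [|n [IHJ IHm]].
      split=> [t u pu ut tT tpe|t pt tT tpe].
        have tue : t - u <= eps.
          by apply: le_trans ee; apply: le_trans tpe; rewrite lerB.
        have su := le_trans sp pu.
        apply: le_trans (ler_normB _ _) _.
        apply: le_trans (lerD (yC t u su ut tT tue) (zC t u su ut tT tue)) _.
        rewrite -mulrDl expr0 mulr1 ler_wpM2r ?(af_om0 AF) ?subr_ge0//.
        by rewrite /A le_max; apply/orP; left; clear -AF; lra.
      have st := le_trans sp pt.
      apply: le_trans (ler_normB _ _) _.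
      apply: le_trans (lerD (yB t st tT) (zB t st tT)) _.
      rewrite expr0 mulr1 -ler_pdivrMr// /A le_max; apply/orP; right.
      by rewrite ler_pM2r ?invr_gt0//; clear -AF; lra.
    have An0 : 0 <= A * rho ^+ n by rewrite mulr_ge0// exprn_ge0// ltW.
    have IHJ' : forall t u, p <= u -> u <= t -> t <= T -> t - p <= e ->
       `|J t u| <= A * rho ^+ n.+1 * om (t - u).
      move=> t u pu ut tT tpe.
      apply: le_trans (step _ _ p e An0 sp ee IHJ IHm t u pu ut tT tpe) _.
      rewrite ler_wpM2r ?(af_om0 AF) ?subr_ge0// exprSr [A * (_ * _)]mulrA.
      have : (A * rho ^+ n) * (b' * k) <= (A * rho ^+ n) * ((1 - lam) / 2).
        by rewrite ler_wpM2l.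
      have rE : rho = (1 + lam) / 2 by [].
      by move: (A * rho ^+ n) => x; rewrite rE; clear -AF; lra.
    split=> // t pt tT tpe.
    have := IHJ t p (lexx _) pt tT tpe; rewrite /J yzp.
    rewrite (_ : _ - _ = y t - z t); last by rewrite opprB addrA subrK.
    move=> /le_trans; apply.
    rewrite (_ : A * rho ^+ n.+1 * k = A * rho ^+ n * (k * rho)); last first.
      by rewrite exprSr; ring.
    rewrite ler_wpM2l//; apply: le_trans ome; apply: (af_om_le AF) => //; by rewrite subr_ge0.
  move=> t pt tT tpe; apply/eqP; rewrite -subr_eq0 -normr_le0.
  have cv : (fun n => A * rho ^+ n * k) @ \oo --> (0 : R).
    rewrite -(mul0r k) -(mulr0 A).
    apply: cvgMl; apply: cvgMr; apply: cvg_expr.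
    by rewrite ger0_norm// ltW.
  apply: (cvgr_to_ge cv); apply: nearW => n.
  by case: (iter n) => _; apply.
have glob n : forall t, s <= t -> t <= T -> t - s <= n%:R * e -> y t = z t.
  elim: n => [|n IH] t st tT tse.
    have -> // : t = s by apply: le_anti; rewrite st andbT -subr_le0 -(mul0r e).
  case: (leP (t - s) (n%:R * e)) => [|nt]; first exact: IH.
  pose p := s + n%:R * e.
  have sp : s <= p by rewrite lerDl mulr_ge0// ltW.
  have pt : p <= t by rewrite -lerBrDl ltW.
  apply: (local p) => //.
    by apply: IH => //; [exact: le_trans pt tT|rewrite /p addrAC subrr add0r].
  by move: tse; rewrite /p -natr1 mulrDl mul1r; clear -AF; lra.
move=> t st tT; apply: (glob (Num.truncn ((t - s) / e)).+1) => //.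
by rewrite -ler_pdivrMr// ltW// truncnS_gt.
Qed.

End Uniqueness.

(** * The flow *)
Section Flow.
Variables (R : realType) (d : nat).
Local Notation E := 'rV[R]_d.
Variables (T eps kap lam c C1 : R) (om : R -> R) (mu : R -> R -> E -> E).
Hypothesis AF : almost_flow T eps kap lam c C1 om mu.

(** The path started at time s from x, restricted to [u, T], is also the path
    started at time u from its own position: this is the flow property. *)
Lemma exists_flow : exists2 phi, is_flow T phi &
  forall t s x, 0 <= s -> s <= t -> t <= T -> t - s <= eps ->
    `|phi t s x - mu t s x| <= C1 * (1 + `|x|) * om (t - s).
Proof.
have ex s x : {y : R -> E | 0 <= s -> s <= T ->
    [/\ y s = x, sol_path T eps om mu s y &
     forall t, s <= t -> t <= T -> t - s <= eps ->
      `|y t - mu t s x| <= C1 * (1 + `|x|) * om (t - s)]}.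
  apply: cid; case: (pselect (0 <= s /\ s <= T)) => [[s0 sT]|n]; last first.
    by exists (fun=> x) => s0 sT; case: n.
  have [y [ys [B yB] yC]] := exists_path AF x s0 sT.
  exists y => _ _; split=> //; last first.
    by move=> t st tT tse; rewrite -{1 2}ys; apply: yC.
  split; first by exists B.
  exists (C1 * (1 + B)) => t u su ut tT tue.
  apply: le_trans (yC t u su ut tT tue) _.
  rewrite ler_wpM2r ?(af_om0 AF) ?subr_ge0// ler_wpM2l ?(af_C1 AF)// lerD2l.
  by apply: yB => //; exact: le_trans tT.
pose phi t s x := sval (ex s x) t.
have phiP s x : 0 <= s -> s <= T ->
    [/\ phi s s x = x, sol_path T eps om mu s (fun t => phi t s x) &
     forall t, s <= t -> t <= T -> t - s <= eps ->
      `|phi t s x - mu t s x| <= C1 * (1 + `|x|) * om (t - s)].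
  by rewrite /phi; case: (ex s x) => y /= H /H{}H /H.
exists phi; last first.
  move=> t s x s0 st tT tse; have [_ _] := phiP s x s0 (le_trans st tT).
  exact.
split=> [s s0 sT|t u s s0 su ut tT]; apply/funext => x /=.
  by case: (phiP s x s0 sT).
have u0 := le_trans s0 su; have uT := le_trans ut tT; have sT := le_trans su uT.
have [_ [[B yB] [C yC]] _] := phiP s x s0 sT.
have [ux uS _] := phiP u (phi u s x) u0 uT.
apply: (unique_path AF u0 uS _ ux) => //.
split.
  by exists B => r ur; apply: yB; exact: le_trans ur.
by exists C => r v uv; apply: yC; exact: le_trans uv.
Qed.

End Flow.

(** * Mean value inequalities for curves *)
Section VectorCalculus.
Variables (R : realType) (d : nat).
Local Notation E := 'rV[R]_d.

Lemma norm_rV_le (x : E) (M : R) : 0 <= M ->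
  (forall j, `|x ord0 j| <= M) -> `|x| <= M.
Proof.
move=> M0 H; rewrite [leLHS]/Num.Def.normr /= mx_normrE; apply/bigmax_leP; split=> //.
by move=> [i j] _ /=; rewrite ord1.
Qed.

Lemma coord_le_norm (x : E) j : `|x ord0 j| <= `|x|.
Proof.
rewrite [leRHS]/Num.Def.normr /= mx_normrE.
by apply: (@le_bigmax _ _ _ 0 (fun ij => `|x ij.1 ij.2|) (ord0, j)).
Qed.

Lemma is_derive_coord (y : R -> E) (dy : E) (r : R) j :
  is_derive r 1 y dy -> is_derive r 1 (fun s => y s ord0 j) (dy ord0 j).
Proof.
move=> [yd yE]; have dj := (derivable_mxP _ _ _).1 yd ord0 j.
by apply: DeriveDef => //; rewrite -yE derive_mx// mxE.
Qed.

Lemma within_continuous_coord (y : R -> E) (A : set R) j :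
  {within A, continuous y} -> {within A, continuous (fun s => y s ord0 j)}.
Proof.
move=> yc r; apply: (@continuous_comp (subspace A) E R y (fun v : E => v ord0 j)).
  exact: yc.
exact: coord_continuous.
Qed.

Lemma mean_value_affine (y dy : R -> E) (v : E) (a b M : R) : a <= b ->
  {within `[a, b], continuous y} ->
  (forall r : R, a < r -> r < b -> is_derive r 1 y (dy r)) ->
  (forall r : R, a < r -> r < b -> `|dy r - v| <= M) ->
  `|y b - y a - (b - a) *: v| <= M * (b - a).
Proof.
rewrite le_eqVlt => /orP[/eqP <- _ _ _|ab yc yd yM].
  by rewrite !subrr scale0r subrr normr0 mulr0.
have mab : a < (a + b) / 2 < b by apply/andP; split; lra.
have M0 : 0 <= M by case/andP: mab => h1 h2; exact: le_trans (yM _ h1 h2).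
apply: norm_rV_le => [|j]; first by rewrite mulr_ge0// subr_ge0 ltW.
have [||r] := @MVT R (fun s => y s ord0 j) (fun s => dy s ord0 j) a b ab.
- move=> r; rewrite in_itv /= => /andP[ar rb].
  exact: is_derive_coord (yd r ar rb).
- exact: within_continuous_coord.
rewrite in_itv /= => /andP[ar rb]; rewrite !mxE => ->.
rewrite [(b - a) * _]mulrC -mulrBl normrM [`|b - a|]ger0_norm ?subr_ge0 ?(ltW ab)//.
rewrite ler_wpM2r ?subr_ge0 ?(ltW ab)//.
have := coord_le_norm (dy r - v) j; rewrite !mxE => /le_trans; apply.
exact: yM.
Qed.

Lemma mean_value_ineq (y dy : R -> E) (a b M : R) : a <= b ->
  {within `[a, b], continuous y} ->
  (forall r : R, a < r -> r < b -> is_derive r 1 y (dy r)) ->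
  (forall r : R, a < r -> r < b -> `|dy r| <= M) -> `|y b - y a| <= M * (b - a).
Proof.
move=> ab yc yd yM; rewrite -[y b - y a]subr0 -[0](scaler0 _ (b - a)).
by apply: (mean_value_affine ab yc yd) => r ar rb; rewrite subr0 yM.
Qed.

Lemma within_bounded (y : R -> E) (a b : R) : {within `[a, b], continuous y} ->
  exists B, forall r, a <= r -> r <= b -> `|y r| <= B.
Proof.
move=> yc; case: (leP a b) => [ab|ba]; last first.
  by exists 0 => r ar rb; move: (le_lt_trans (le_trans ar rb) ba); rewrite ltxx.
have [|c _ cM] := @EVT_max R (fun r => `|y r|) a b ab.
  move=> r; apply: (@continuous_comp (subspace _) E R y (fun v : E => `|v|)).
    exact: yc.
  exact: norm_continuous.
by exists `|y c| => r ar rb; apply: cM; rewrite in_itv /= ar.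
Qed.

Lemma is_derive_of_quad (y : R -> E) (r : R) (v : E) (K e : R) : 0 < e ->
  (forall h, `|h| < e -> `|y (r + h) - y r - h *: v| <= K * `|h| ^+ 2) ->
  is_derive r 1 y v.
Proof.
move=> e0 H.
suff cv : (fun h : R => h^-1 *: ((y \o shift r) (h *: (1 : R)) - y r)) @ 0^' --> v.
  by apply: DeriveDef; [apply/cvg_ex; exists v|exact: (@cvg_lim E)].
apply/cvgrPdist_le => e' e'0.
have K1 : 0 < `|K| + 1 by rewrite ltr_wpDl.
near=> h => /=.
have h0 : h != 0 by near: h; exact: nbhs_dnbhs_neq.
have hn : 0 < `|h| by rewrite normr_gt0.
have he : `|h| < e by near: h; apply: dnbhs0_lt.
have he' : `|h| <= e' / (`|K| + 1) by near: h; apply: dnbhs0_le; rewrite divr_gt0.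
rewrite [h *: 1]mulr1 [h + r]addrC.
have -> : v - h^-1 *: (y (r + h) - y r) = - (h^-1 *: (y (r + h) - y r - h *: v)).
  by rewrite [in RHS]scalerBr opprB scalerA mulVf// scale1r.
rewrite normrN normrZ normfV mulrC ler_pdivrMr//.
apply: le_trans (H h he) _; rewrite expr2 mulrA ler_wpM2r//.
apply: (@le_trans _ _ ((`|K| + 1) * `|h|)).
  by rewrite ler_wpM2r// (le_trans (ler_norm K))// lerDl.
by rewrite mulrC -ler_pdivlMr.
Unshelve. all: by end_near. Qed.

End VectorCalculus.

(** * Ordinary differential equations through the Euler scheme *)

(** The second condition is what a C2 map with bounded first and second
    derivatives satisfies (see [C2_estimates]): if (a, a') and (z, z') are close to
    each other, then so are the increments of W. *)
Definition four_point_lip (R : realType) d (M : R) (W : 'rV[R]_d -> 'rV[R]_d) : Prop :=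
  (forall x z, `|W x - W z| <= M * `|x - z|) /\
  (forall a a' z z', `|(W a - W a') - (W z - W z')|
     <= M * (`|(a - a') - (z - z')|
             + (`|a - z| + `|a' - z'|) * (`|a - a'| + `|z - z'|))).

Lemma four_point_lip_le (R : realType) d (M M' : R) (W : 'rV[R]_d -> 'rV[R]_d) :
  M <= M' -> four_point_lip M W -> four_point_lip M' W.
Proof.
move=> MM' [H1 H2]; split=> [x z|a a' z z'].
  by apply: le_trans (H1 x z) _; rewrite ler_wpM2r.
apply: le_trans (H2 a a' z z') _; by rewrite ler_wpM2r.
Qed.

Lemma lip_growth (R : realType) d (M : R) (W : 'rV[R]_d -> 'rV[R]_d) x :
  0 <= M -> four_point_lip M W -> `|W 0| <= M ->
  `|W x| <= M * (1 + `|x|).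
Proof.
move=> M0 [H1 _] W0; have := H1 x 0; rewrite subr0 => H.
rewrite mulrDr mulr1 addrC -[W x](subrK (W 0)).
by apply: le_trans (ler_normD _ _) _; apply: lerD.
Qed.

Definition euler_step (R : realType) d (W : 'rV[R]_d -> 'rV[R]_d) (t s : R) (x : 'rV[R]_d) :=
  x + (t - s) *: W x.

(** The defect of an Euler step is (t - u) (W (x + (u - s) W x) - W x), of order
    L^2 (1 + |x|) (t - s)^2.  With steps at most 1 / (10 L) one may take kap = 1 / 4,
    hence lam = 2 (1 + kap)^2 / 4 = 25 / 32; then 20 L^2 exceeds 4 L^2 / (1 - lam),
    and 20 L^2 eps^2 = 1 / 5 is below kap. *)
Lemma euler_almost_flow (R : realType) d (L : R) (W : 'rV[R]_d -> 'rV[R]_d) :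
  1 <= L -> four_point_lip L W -> `|W 0| <= L ->
  almost_flow 1 (10 * L)^-1 (1 / 4) (25 / 32) (L ^+ 2) (20 * L ^+ 2)
    (fun h => h ^+ 2) (euler_step W).
Proof.
move=> L1 W4 W0; have L0 : 0 < L by rewrite (lt_le_trans ltr01).
have Wg x := lip_growth x (ltW L0) W4 W0.
case: W4 => Wlip W4.
have LL : L <= L ^+ 2 by rewrite expr2 ler_peMl// ltW.
have epsL : L * (10 * L)^-1 = 1 / 10 by field; rewrite gt_eqF.
have eps1 : (10 * L)^-1 <= 1 / 10.
  by rewrite -epsL ler_peMl// invr_ge0 mulr_ge0// ltW.
have window t s : s <= t -> t - s <= (10 * L)^-1 ->
    [/\ 0 <= t - s, t - s <= 1 / 10 & L * (t - s) <= 1 / 10].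
  move=> st te; rewrite subr_ge0; split=> //; first exact: le_trans eps1.
  by rewrite -epsL ler_wpM2l// ltW.
split.
- by rewrite invr_gt0 mulr_gt0.
- by clear; lra.
- by clear; lra.
- by clear; lra.
- by clear; lra.
- by rewrite exprn_ge0// ltW.
- by move=> h _; exact: sqr_ge0.
- by move=> h k h0 hk; rewrite ler_pXn2r// ?nnegrE// (le_trans h0).
- by move=> h h0 _; have : 0 <= h ^+ 2 by [rewrite sqr_ge0]; clear; lra.
- by rewrite mulr_ge0// exprn_ge0// ltW.
- by have : 0 <= L ^+ 2 by [rewrite sqr_ge0]; clear; lra.
- rewrite -mulrA -exprMn epsL; clear; lra.
- by move=> s x _ _; rewrite /euler_step subrr scale0r addr0.
- move=> t s x s0 st tT tse; have [h0 h1 h2] := window _ _ st tse.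
  rewrite /euler_step addrC addrA addNr add0r normrZ ger0_norm//.
  apply: le_trans (ler_wpM2l h0 (Wg x)) _; rewrite mulrA [_ * L]mulrC.
  by rewrite ler_wpM2r ?addr_ge0//; clear -h2; lra.
- move=> t s x z s0 st tT tse; have [h0 h1 h2] := window _ _ st tse.
  have -> : euler_step W t s x - euler_step W t s z = (x - z) + (t - s) *: (W x - W z).
    by rewrite /euler_step; apply/rowP => i; rewrite !mxE; ring.
  apply: le_trans (ler_normD _ _) _; rewrite normrZ ger0_norm//.
  have H1 := ler_wpM2l h0 (Wlip x z).
  have H2 : L * (t - s) * `|x - z| <= 1 / 10 * `|x - z| by rewrite ler_wpM2r.
  have H3 : 0 <= `|x - z| by [].
  by move: H1 H2 H3; clear; lra.
- move=> t u s x s0 su ut tT tse.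
  have [h0 h1 h2] := window _ _ (le_trans su ut) tse.
  have k0 : 0 <= u - s by rewrite subr_ge0.
  have k'0 : 0 <= t - u by rewrite subr_ge0.
  have kh : u - s <= t - s by rewrite lerD2r.
  have k'h : t - u <= t - s by rewrite lerB.
  have -> : euler_step W t u (euler_step W u s x) - euler_step W t s x
      = (t - u) *: (W (euler_step W u s x) - W x).
    by rewrite /euler_step; apply/rowP => i; rewrite !mxE; ring.
  rewrite normrZ ger0_norm//.
  have H1 := Wlip (euler_step W u s x) x.
  have H2 : `|euler_step W u s x - x| <= (t - s) * (L * (1 + `|x|)).
    rewrite /euler_step addrC addrA addNr add0r normrZ ger0_norm//.
    by apply: ler_pM => //.
  apply: (@le_trans _ _ ((t - s) * (L * ((t - s) * (L * (1 + `|x|)))))).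
    apply: ler_pM => //; apply: le_trans H1 _.
    by rewrite ler_wpM2l// ltW.
  by rewrite le_eqVlt; apply/orP; left; apply/eqP; ring.
- move=> r r0; exists (7 * L ^+ 2 * (1 + r)).
    by rewrite !mulr_ge0 ?addr_ge0 ?exprn_ge0 ?(ltW L0).
  split.
    move=> t u s x z s0 su ut tT tse xr zr.
    have [h0 h1 h2] := window _ _ (le_trans su ut) tse.
    have k0 : 0 <= u - s by rewrite subr_ge0.
    have k'0 : 0 <= t - u by rewrite subr_ge0.
    have kh : u - s <= t - s by rewrite lerD2r.
    have k'h : t - u <= t - s by rewrite lerB.
    have -> : euler_step W t u (euler_step W u s x) - euler_step W t s x -
         (euler_step W t u (euler_step W u s z) - euler_step W t s z)
      = (t - u) *: (W (euler_step W u s x) - W x - (W (euler_step W u s z) - W z)).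
      by rewrite /euler_step; apply/rowP => i; rewrite !mxE; ring.
    rewrite normrZ ger0_norm//.
    have H := W4 (euler_step W u s x) x (euler_step W u s z) z.
    have E1 w : euler_step W u s w - w = (u - s) *: W w.
      by rewrite /euler_step addrC addrA addNr add0r.
    rewrite !E1 -scalerBr in H.
    have N1 : `|(u - s) *: (W x - W z)| <= (t - s) * (L * `|x - z|).
      by rewrite normrZ ger0_norm//; apply: ler_pM.
    have N2 w : `|w| <= r -> `|(u - s) *: W w| <= (t - s) * (L * (1 + r)).
      move=> wr; rewrite normrZ ger0_norm//; apply: ler_pM => //.
      apply: le_trans (Wg w) _; rewrite ler_wpM2l ?(ltW L0)//.
      by rewrite lerD2l.
    have N3 : `|euler_step W u s x - euler_step W u s z| <= 2 * `|x - z|.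
      have -> : euler_step W u s x - euler_step W u s z = (x - z) + (u - s) *: (W x - W z).
        by rewrite /euler_step; apply/rowP => i; rewrite !mxE; ring.
      apply: le_trans (ler_normD _ _) _.
      have : (t - s) * (L * `|x - z|) <= 1 * `|x - z|.
        rewrite mulrA ler_wpM2r// mulrC; clear -h2; lra.
      by clear -N1; lra.
    have N4 : (`|euler_step W u s x - euler_step W u s z| + `|x - z|) *
        (`|(u - s) *: W x| + `|(u - s) *: W z|)
        <= (3 * `|x - z|) * (2 * ((t - s) * (L * (1 + r)))).
      apply: ler_pM; rewrite ?addr_ge0//; first by clear -N3; lra.
      by have := N2 _ xr; have := N2 _ zr; clear; lra.
    have N5 : L * (`|(u - s) *: (W x - W z)| +
        (`|euler_step W u s x - euler_step W u s z| + `|x - z|) *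
        (`|(u - s) *: W x| + `|(u - s) *: W z|))
      <= L * ((t - s) * (L * `|x - z|) + (3 * `|x - z|) * (2 * ((t - s) * (L * (1 + r))))).
      by rewrite ler_wpM2l ?(ltW L0)// lerD.
    have N6 := le_trans H N5.
    apply: le_trans (ler_pM k'0 (normr_ge0 _) k'h N6) _.
    have r1 : 1 * (L ^+ 2 * ((t - s) ^+ 2 * `|x - z|)) <= (1 + r) * (L ^+ 2 * ((t - s) ^+ 2 * `|x - z|)).
      apply: ler_wpM2r; last by rewrite lerDl.
      by rewrite mulr_ge0 ?sqr_ge0// mulr_ge0 ?sqr_ge0.
    move: r1; move: `|x - z| => X; rewrite !expr2; clear; lra.
  move=> t s a a' z z' s0 st tT tse _ _ _ _.
  have [h0 h1 h2] := window _ _ st tse.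
  have -> : euler_step W t s a - euler_step W t s a' - (euler_step W t s z - euler_step W t s z')
     = (a - a' - (z - z')) + (t - s) *: (W a - W a' - (W z - W z')).
    by rewrite /euler_step; apply/rowP => i; rewrite !mxE; ring.
  apply: le_trans (ler_normD _ _) _; rewrite normrZ ger0_norm//.
  have H := ler_wpM2l h0 (W4 a a' z z').
  set X := `|a - a' - (z - z')| in H *; have X0 : 0 <= X := normr_ge0 _.
  set Y := `|a - a'| + `|z - z'| in H *; have Y0 : 0 <= Y by apply: addr_ge0.
  set Z := `|a - z| + `|a' - z'| in H *; have Z0 : 0 <= Z by apply: addr_ge0.
  have H1 : (L * (t - s)) * X <= (1 / 10) * X by rewrite ler_wpM2r.
  have H2 : (L * (t - s)) * (Z * Y) <= (1 / 10) * (Z * Y).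
    by rewrite ler_wpM2r// mulr_ge0.
  have H3 : 1 * (Z * Y) <= (7 * L ^+ 2 * (1 + r)) * (Z * Y).
    rewrite ler_wpM2r ?mulr_ge0//.
    have : 1 * 1 <= L ^+ 2 * (1 + r) by apply: ler_pM => //; [exact: le_trans LL|rewrite lerDl].
    by rewrite -mulrA; clear; lra.
  have H4 : 0 <= (7 * L ^+ 2 * (1 + r)) * ((t - s) ^+ 2 * Y).
    apply: mulr_ge0; last by rewrite mulr_ge0 ?sqr_ge0.
    by rewrite mulr_ge0 ?addr_ge0// mulr_ge0 ?sqr_ge0.
  have H5 : 0 <= Z * Y by rewrite mulr_ge0.
  move: H; set N := `|W a - _ - _| => H; clearbody X Y Z N.
  by move: H H1 H2 H3 H4 H5 X0; clear; lra.
Qed.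

Definition clamp (R : realType) (r : R) : R := Num.max 0 (Num.min 1 r).

Lemma clampP (R : realType) (r : R) :
  [/\ 0 <= clamp r, clamp r <= 1 & (0 <= r -> r <= 1 -> clamp r = r)].
Proof.
rewrite /clamp le_max lexx ge_max ler01 ge_min lexx; split=> // r0 r1.
by rewrite min_r// max_r.
Qed.

Lemma clamp_le (R : realType) (r s : R) : r <= s ->
  clamp r <= clamp s /\ clamp s - clamp r <= s - r.
Proof.
by move=> rs; rewrite /clamp !maxEle !minEle; do !case: ifPn; rewrite -?ltNge => *; split; lra.
Qed.

Lemma clamp_window (R : realFieldType) (r h : R) : `|h| < r -> `|h| < 1 - r ->
  0 <= r + h /\ r + h <= 1.
Proof.
by move=> /ltr_normlP[h1 h2] /ltr_normlP[h3 h4]; split; lra.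
Qed.

Section ODESolutions.
Variables (R : realType) (d : nat).
Local Notation E := 'rV[R]_d.
Variables (M : R) (W : E -> E).
Hypothesis M0 : 0 <= M.
Hypothesis W4 : four_point_lip M W.

Let L := 1 + M + `|W 0|.

Let L1 : 1 <= L.
Proof. by rewrite /L -addrA lerDl addr_ge0. Qed.

Let L0 : 0 <= L. Proof. exact: le_trans L1. Qed.

Let WL : four_point_lip L W.
Proof. by apply: four_point_lip_le W4; rewrite /L addrAC addrC lerDl addr_ge0. Qed.

Let W0L : `|W 0| <= L.
Proof. by rewrite /L lerDr addr_ge0. Qed.

Let AF := euler_almost_flow L1 WL W0L.
Let eps := (10 * L)^-1.
Let om (h : R) := h ^+ 2.

Lemma ode_sol_path x y : ode_solution01 W x y -> sol_path 1 eps om (euler_step W) 0 y.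
Proof.
move=> [yx yc yd]; have [B yB] := within_bounded yc.
split; first by exists B.
have B0 : 0 <= B := le_trans (normr_ge0 _) (yB 0 (lexx _) ler01).
pose K := L * (1 + B).
have K0 : 0 <= K by rewrite mulr_ge0// addr_ge0.
have WK r : 0 <= r -> r <= 1 -> `|W (y r)| <= K.
  move=> r0 r1; apply: le_trans (lip_growth _ L0 WL W0L) _.
  by rewrite ler_wpM2l// lerD2l yB.
have sub (u t : R) : 0 <= u -> t <= 1 -> {within `[u, t], continuous y}.
  move=> u0 t1; apply: continuous_subspaceW yc => r /=.
  by rewrite !in_itv /= => /andP[ur rt]; rewrite (le_trans u0)// (le_trans rt).
have yL u t : 0 <= u -> u <= t -> t <= 1 -> `|y t - y u| <= K * (t - u).
  move=> u0 ut t1; apply: (mean_value_ineq (dy := W \o y) ut (sub _ _ u0 t1)) => r ur rt.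
    by apply: yd; [exact: le_lt_trans ur|exact: lt_le_trans t1].
  by apply: WK; [rewrite (le_trans u0)// ltW|rewrite (le_trans (ltW rt))].
exists (L * K) => t u u0 ut t1 _; rewrite /euler_step opprD addrA /om expr2 mulrA.
apply: (mean_value_affine (dy := W \o y) ut (sub _ _ u0 t1)) => r ur rt /=.
  by apply: yd; [exact: le_lt_trans ur|exact: lt_le_trans t1].
have r1 := le_trans (ltW rt) t1.
apply: le_trans (WL.1 _ _) _; rewrite -mulrA ler_wpM2l//.
apply: le_trans (yL u r u0 (ltW ur) r1) _.
by rewrite ler_wpM2l// lerD2r ltW.
Qed.

Lemma ode_unique x y z : ode_solution01 W x y -> ode_solution01 W x z -> y 1 = z 1.
Proof.
move=> Hy Hz; apply: (unique_path AF (lexx 0) (ode_sol_path Hy) (ode_sol_path Hz)) => //.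
by case: Hy => -> _ _; case: Hz => ->.
Qed.

(** The path close to the Euler scheme satisfies
    |y_t - y_u - (t - u) W (y_u)| <= C (t - u)^2, so it has the right derivative.
    It is extended by constants outside [0, 1] to speak of its continuity and of
    two-sided increments without case distinctions. *)
Lemma ode_exists x : exists y, ode_solution01 W x y.
Proof.
have [y [y0 [B yB] yC]] := exists_path AF x (lexx 0) ler01.
have clP := @clampP R; have cl_le := @clamp_le R.
pose z r := y (clamp r).
pose C := 20 * L ^+ 2 * (1 + B).
have B0 : 0 <= B := le_trans (normr_ge0 _) (yB 0 (lexx _) ler01).
have C0 : 0 <= C by rewrite mulr_ge0 ?addr_ge0// mulr_ge0 ?sqr_ge0.
have e0 : 0 < eps := af_eps AF.
pose K := L * (1 + B).
have K0 : 0 <= K by rewrite mulr_ge0// addr_ge0.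
have yC' t u : 0 <= u -> u <= t -> t <= 1 -> t - u <= eps ->
    `|y t - y u - (t - u) *: W (y u)| <= C * (t - u) ^+ 2.
  move=> u0 ut t1 tue; rewrite -addrA -opprD.
  apply: le_trans (yC t u u0 ut t1 tue) _.
  rewrite ler_wpM2r ?sqr_ge0// ler_wpM2l ?(mulr_ge0 _ (sqr_ge0 _))// lerD2l.
  by apply: yB => //; exact: le_trans t1.
have WK u : 0 <= u -> u <= 1 -> `|W (y u)| <= K.
  move=> u0 u1; apply: le_trans (lip_growth _ L0 WL W0L) _.
  by rewrite ler_wpM2l// lerD2l yB.
have yL t u : 0 <= u -> u <= t -> t <= 1 -> t - u <= eps ->
    `|y t - y u| <= (C * eps + K) * (t - u).
  move=> u0 ut t1 tue; have u1 := le_trans ut t1; have tu0 : 0 <= t - u by rewrite subr_ge0.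
  rewrite -[y t - y u](subrK ((t - u) *: W (y u))).
  apply: le_trans (ler_normD _ _) _; rewrite mulrDl; apply: lerD.
    apply: le_trans (yC' _ _ u0 ut t1 tue) _.
    by rewrite expr2 mulrA ler_wpM2r// ler_wpM2l.
  by rewrite normrZ ger0_norm// mulrC ler_wpM2r// WK.
pose Q := C * eps + K.
have Q0 : 0 <= Q by rewrite addr_ge0// mulr_ge0// ltW.
have zc : continuous z.
  move=> r A /(@nbhs_normP R E)[e /= e'0 eA]; apply/(@nbhs_normP R R).
  have Q1 : 0 < Q + 1 by rewrite ltr_wpDl.
  exists (Num.min eps (e / (Q + 1))); first by rewrite /= lt_min e0 divr_gt0.
  move=> s /=; rewrite lt_min => /andP[rse rsq]; apply: eA => /=.
  have H : `|z r - z s| <= Q * `|r - s|.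
    wlog rs : r s rse rsq / r <= s => [H|].
      case/orP: (le_total r s) => rs; first exact: H.
      by rewrite distrC [X in _ * X]distrC; apply: H => //; rewrite distrC.
    have [c1 c2] := cl_le _ _ rs; have [? _ _] := clP r; have [_ ? _] := clP s.
    rewrite distrC [X in _ * X]distrC [X in _ * X]ger0_norm ?subr_ge0//.
    apply: le_trans (yL (clamp s) (clamp r) _ _ _ _) _ => //.
      apply: le_trans c2 _; apply: le_trans (ltW rse).
      by rewrite distrC ler_norm.
    by rewrite ler_wpM2l.
  apply: le_lt_trans H _; apply: le_lt_trans (_ : _ <= (Q + 1) * `|r - s|) _.
    by rewrite ler_wpM2r// lerDl.
  by rewrite mulrC -ltr_pdivlMr.
exists z; split.
- by rewrite /z; have [_ _ ->] := clP 0.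
- exact: continuous_subspaceT.
- move=> r r0 r1.
  pose e := Num.min eps (Num.min r (1 - r)).
  have e'0 : 0 < e by rewrite !lt_min e0 r0 subr_gt0.
  have zr : z r = y r by rewrite /z; have [_ _ ->] := clP r; rewrite ?ltW.
  apply: (is_derive_of_quad (K := C + L * Q) e'0) => h.
  rewrite !lt_min => /and3P[he hr hr1].
  have [rh0 rh1] := clamp_window hr hr1.
  have -> : z (r + h) = y (r + h) by rewrite /z; have [_ _ ->] := clP (r + h).
  rewrite zr; have LQ : 0 <= L * Q by rewrite mulr_ge0.
  case/orP: (le_total 0 h) => h0.
    have := @yC' (r + h) r (ltW r0); rewrite lerDl addrAC subrr add0r => /(_ h0 rh1).
    rewrite -{1}(ger0_norm h0) => /(_ (ltW he)) /le_trans; apply.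
    by rewrite ger0_norm// ler_wpM2r ?sqr_ge0// lerDl.
  have rhr : r + h <= r by rewrite gerDl.
  have hE : r - (r + h) = `|h| by rewrite ler0_norm//; ring.
  have H1 := @yC' r (r + h) rh0 rhr (ltW r1).
  have H2 := @yL r (r + h) rh0 rhr (ltW r1).
  rewrite hE in H1 H2.
  have {}H1 := H1 (ltW he); have {}H2 := H2 (ltW he).
  have -> : y (r + h) - y r - h *: W (y r)
     = - (y r - y (r + h) - `|h| *: W (y (r + h))) + `|h| *: (W (y r) - W (y (r + h))).
    by rewrite ler0_norm//; apply/rowP => i; rewrite !mxE; ring.
  apply: le_trans (ler_normD _ _) _; rewrite normrN mulrDl; apply: lerD => //.
  rewrite normrZ normr_id mulrC expr2 mulrA ler_wpM2r//.
  by apply: le_trans (WL.1 _ _) _; rewrite -mulrA ler_wpM2l.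
Qed.

End ODESolutions.

(** * The formal identity log (exp a) = a *)
Section FormalLogExp.
Variables (R : realType) (N : nat).

Let expP : {poly R} := \poly_(k < N.+1) (k`!%:R)^-1.
Let logP : {poly R} := \poly_(k < N.+1) (if k == 0%N then 0 else (-1) ^+ k.+1 / k%:R).

(** D = log (exp X) - X has a derivative divisible by X^N and no constant term.
    Indeed, truncation included, P = exp X - 1 satisfies P' = 1 + P - X^N / N!, the
    logarithm satisfies (1 + X) log' = 1 - (- X)^N, and X divides P. *)
Lemma log_exp_poly : exists S, logP \Po (expP - 1) = 'X + S * 'X^(N.+1).
Proof.
pose P := expP - 1.
have [P2 PE] : exists P2, P = P2 * 'X.
  exists (\poly_(k < N) (k.+1`!%:R)^-1); apply/polyP => -[|i].
    by rewrite coefB coef1 coefMX coef_poly /= fact0 invr1 subrr.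
  by rewrite coefB coef1 coefMX !coef_poly /= subr0 ltnS.
have dP : P^`() = 1 + P - (N`!%:R)^-1 *: 'X^N.
  have -> : 1 + P = expP by rewrite /P addrC subrK.
  apply/polyP => i; rewrite coef_deriv /P coefB coef1 coefB coefZ coefXn.
  rewrite [(i.+1 == 0)%:R]/= subr0 !coef_poly.
  have fE : (i.+1`!%:R)^-1 *+ i.+1 = (i`!%:R)^-1 :> R.
    by rewrite -[LHS]mulr_natr factS natrM invfM mulrAC mulVf ?mul1r// pnatr_eq0.
  rewrite !ltnS [(i <= N)%N]leq_eqVlt; case: (ltngtP i N) => [iN|iN|->] /=.
  - by rewrite fE mulr0 subr0.
  - by rewrite mulr0 subr0 mul0rn.
  - by rewrite mulr1 subrr mul0rn.
have dL : (1 + 'X) * logP^`() = 1 - (- 'X) ^+ N.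
  have -> : logP^`() = \sum_(k < N) (- 'X) ^+ k.
    apply/polyP => i; rewrite coef_deriv coef_poly ltnS /= coef_sum.
    under eq_bigr => k _ do rewrite exprNn -['X^k]mul1r mulrA mulr1
      -[(-1) ^+ k]/((-1 : {poly R}) ^+ k) -(rmorphN1 polyC) -rmorphXn coefCM coefXn.
    case: (ltnP i N) => iN.
      rewrite (bigD1 (Ordinal iN)) //= eqxx mulr1 big1 ?addr0 => [|j ji].
        by rewrite -[LHS]mulr_natr divfK ?pnatr_eq0// !exprS !mulN1r opprK.
      by rewrite eq_sym (negPf (_ : j != i :> nat)) ?mulr0.
    rewrite mul0rn big1// => j _; rewrite gtn_eqF ?mulr0//.
    exact: leq_trans iN.
  by rewrite -[1 in RHS](expr1n _ N) subrXX opprK; congr (_ * _);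
    apply: eq_bigr => k _; rewrite expr1n mul1r.
have {}dL : (1 + P) * (logP^`() \Po P) = 1 - (- P) ^+ N.
  have := congr1 (fun q => q \Po P) dL.
  by rewrite comp_polyM comp_polyD comp_polyB rmorphXn /= comp_polyC comp_polyX rmorphN /= comp_polyX.
pose D := (logP \Po P) - 'X.
have [S1 DE] : exists S1, D^`() = S1 * 'X^N.
  exists (- ((- P2) ^+ N) - (logP^`() \Po P) * (N`!%:R)^-1%:P).
  have PN : (- P) ^+ N = (- P2) ^+ N * 'X^N by rewrite PE -mulNr exprMn.
  rewrite /D derivB deriv_comp derivX dP mulrBr [_ * (1 + P)]mulrC dL PN -mul_polyC.
  by ring.
exists (\poly_(i < size D) D`_(i + N.+1)).
have -> : logP \Po (expP - 1) = D + 'X by rewrite subrK.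
rewrite addrC; congr (_ + _); apply/polyP => i.
rewrite coefMXn coef_poly; case: ltnP => [|iN].
  case: i => [_|i iN].
    rewrite /D coefB coefX subr0 -horner_coef0 horner_comp PE hornerMX mulr0.
    by rewrite horner_coef0 coef_poly.
  have := congr1 (fun q : {poly R} => q`_i) DE; rewrite coef_deriv coefMXn -ltnS iN.
  by move/eqP; rewrite mulrn_eq0 /= => /eqP.
rewrite subnK//; case: ltnP => // sD; rewrite nth_default//.
by apply: leq_trans sD _; apply: leq_subr.
Qed.

(** Evaluate the polynomial identity at a nilpotent element. *)
Lemma log_exp_alg (A : algType R) (a : A) : a ^+ N.+1 = 0 ->
  \sum_(1 <= k < N.+1) ((-1) ^+ k.+1 / k%:R) *:
     (\sum_(0 <= j < N.+1) (j`!%:R)^-1 *: a ^+ j - 1) ^+ k = a.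
Proof.
move=> aN; have [S SE] := log_exp_poly.
have polyE (b : A) (F : nat -> R) :
    horner_alg b (\poly_(k < N.+1) F k) = \sum_(0 <= k < N.+1) F k *: b ^+ k.
  rewrite poly_def raddf_sum big_mkord; apply: eq_bigr => k _.
  by rewrite /= linearZ /= mulr_algl rmorphXn /= horner_algX.
have := congr1 (horner_alg a) SE.
rewrite rmorphD rmorphM rmorphXn /= horner_algX aN mulr0 addr0 => Ha; rewrite -[RHS]Ha.
have -> : horner_alg a (logP \Po (expP - 1)) = horner_alg (horner_alg a (expP - 1)) logP.
  rewrite -[in RHS](coefK logP) poly_def comp_polyE !raddf_sum /=.
  by apply: eq_bigr => k _; rewrite !linearZ /= !mulr_algl !rmorphXn /= horner_algX.
rewrite polyE rmorphB rmorph1 /= polyE [RHS]big_nat_recl//= scale0r add0r.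
by rewrite big_add1; apply: eq_bigr.
Qed.

End FormalLogExp.

(** * Words and the truncated tensor algebra *)
Section Words.
Variables (ell : nat).
Local Notation word := (seq 'I_ell).

Fixpoint words (n : nat) : seq word :=
  if n is m.+1 then [seq i :: w | i <- enum 'I_ell, w <- words m] else [:: [::]].

Lemma mem_words n w : (w \in words n) = (size w == n).
Proof.
elim: n w => [|n IH] [|i w] //=.
  by apply/negbTE/allpairsP => -[[j v] /= [_ _ []]].
apply/allpairsP/idP => [[[j v] /= [_ + [_ ->]]]|]; first by rewrite IH.
by rewrite eqSS -IH => wn; exists (i, w); rewrite mem_enum.
Qed.

Lemma uniq_words n : uniq (words n).
Proof.
elim: n => [//|n IH] /=; apply: allpairs_uniq; rewrite ?enum_uniq//.
by move=> [i u] [j v] _ _ /= [-> ->].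
Qed.

Lemma big_words_bseq (V : nmodType) N n (F : word -> V) : (n <= N)%N ->
  \sum_(w : N.-bseq 'I_ell | size w == n) F w = \sum_(w <- words n) F w.
Proof.
move=> nN; rewrite -big_filter -(big_map val xpredT F).
apply: perm_big; apply: uniq_perm; last 1 first.
- move=> w; rewrite mem_words; apply/mapP/idP => [[u]|/eqP wn].
    by rewrite mem_filter => /andP[un _] ->.
  have wN : (size w <= N)%N by rewrite wn.
  by exists (Bseq wN) => //; rewrite mem_filter /= mem_index_enum wn eqxx.
- by rewrite map_inj_uniq ?filter_uniq ?index_enum_uniq//; exact: val_inj.
- exact: uniq_words.
Qed.

Lemma big_bseq_words (V : nmodType) N (F : word -> V) :
  \sum_(w : N.-bseq 'I_ell) F w = \sum_(n < N.+1) \sum_(w <- words n) F w.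
Proof.
rewrite (partition_big (fun w : N.-bseq 'I_ell => inord (size w) : 'I_N.+1) xpredT)//=.
apply: eq_bigr => n _; rewrite -(@big_words_bseq _ N); last by rewrite -ltnS.
apply: eq_bigl => w; rewrite -val_eqE /= inordK// ltnS; exact: size_bseq.
Qed.

Variable (R : realType).

(** The deconcatenation product without truncation: recursion on the word makes
    associativity immediate, and truncated products agree with it on words of
    length at most N ([coef_mul]). *)
Fixpoint conv (f g : word -> R) (w : word) : R :=
  if w is i :: w' then f [::] * g w + conv (fun u => f (i :: u)) g w'
  else f [::] * g [::].

Lemma convE f g w :
  conv f g w = \sum_(k < (size w).+1) f (take k w) * g (drop k w).
Proof.
elim: w f => [|i w IH] f; first by rewrite big_ord1.
by rewrite big_ord_recl /= IH; congr (_ + _); apply: eq_bigr.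
Qed.

Lemma eq_conv f f' g g' w :
  (forall u, (size u <= size w)%N -> f u = f' u) ->
  (forall u, (size u <= size w)%N -> g u = g' u) -> conv f g w = conv f' g' w.
Proof.
move=> ff gg; rewrite !convE; apply: eq_bigr => k _; rewrite ff ?gg//.
  by rewrite size_drop leq_subr.
by rewrite size_take_min geq_minr.
Qed.

Lemma convDl f f' g w : conv (fun u => f u + f' u) g w = conv f g w + conv f' g w.
Proof.
by rewrite !convE -big_split; apply: eq_bigr => k _ /=; rewrite mulrDl.
Qed.

Lemma convDr f g g' w : conv f (fun u => g u + g' u) w = conv f g w + conv f g' w.
Proof.
by rewrite !convE -big_split; apply: eq_bigr => k _ /=; rewrite mulrDr.
Qed.

Lemma convZl c f g w : conv (fun u => c * f u) g w = c * conv f g w.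
Proof.
by rewrite !convE big_distrr; apply: eq_bigr => k _ /=; rewrite mulrA.
Qed.

Lemma convZr c f g w : conv f (fun u => c * g u) w = c * conv f g w.
Proof.
by rewrite !convE big_distrr; apply: eq_bigr => k _ /=; rewrite mulrCA.
Qed.

Lemma convA f g h w : conv f (conv g h) w = conv (conv f g) h w.
Proof.
elim: w f g => [|i w IH] f g /=; first by rewrite mulrA.
by rewrite IH convDl convZl mulrDr mulrA addrA.
Qed.

Lemma conv_size f g w :
  (size w)%:R * conv f g w
    = conv (fun u => (size u)%:R * f u) g w + conv f (fun u => (size u)%:R * g u) w.
Proof.
rewrite !convE big_distrr -big_split; apply: eq_bigr => k _ /=.
have {1}-> : size w = (size (take k w) + size (drop k w))%N.
  by rewrite -size_cat cat_take_drop.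
by rewrite natrD; ring.
Qed.

Lemma sum_conv_words (V : lmodType R) n f g (F : word -> V) :
  \sum_(w <- words n) conv f g w *: F w =
  \sum_(k < n.+1) \sum_(u <- words k) \sum_(v <- words (n - k))
     (f u * g v) *: F (u ++ v).
Proof.
elim: n f F => [|n IH] f F.
  by rewrite big_ord1 /= !big_seq1.
rewrite [LHS]big_allpairs_dep big_ord_recl /= big_seq1.
rewrite [X in _ = X + _]big_allpairs_dep /=.
under [LHS]eq_bigr => i _ do (under eq_bigr => w _ do rewrite scalerDl; rewrite big_split).
rewrite big_split /=; congr (_ + _).
under [LHS]eq_bigr => i _ do rewrite (IH (fun u => f (i :: u)) (fun w => F (i :: w))).
rewrite exchange_big; apply: eq_bigr => k _ /=.
by rewrite [RHS]big_allpairs_dep /= /bump /= add1n subSS.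
Qed.

Lemma sum_triangle (V : nmodType) N (S : nat -> nat -> V) :
  \sum_(n < N.+1) \sum_(k < n.+1) S k (n - k)%N =
  \sum_(k < N.+1) \sum_(m < N.+1 - k) S k m.
Proof.
elim: N => [|N IH]; first by rewrite !big_ord1.
rewrite big_ord_recr IH [RHS]big_ord_recr /=.
rewrite [in RHS](_ : (N.+2 - N.+1 = 1)%N) ?subSnn// big_ord1.
rewrite [X in _ + X]big_ord_recr /= subnn addrA; congr (_ + _).
rewrite -big_split; apply: eq_bigr => k _ /=.
by rewrite [in RHS]subSn ?(ltnW (ltn_ord k))// big_ord_recr.
Qed.

End Words.

Section Coefficients.
Variables (R : realType) (ell N : nat).
Local Notation word := (seq 'I_ell).
Local Notation tens := (tens R ell N).

(** Coefficients indexed by all words, zero beyond length N: this spares the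
    length proofs carried by bounded sequences. *)
Definition coef (a : tens) (w : word) : R :=
  if insub w is Some b then a b else 0.

Lemma coef_bseq a (w : N.-bseq 'I_ell) : coef a w = a w.
Proof. by rewrite /coef valK. Qed.

Lemma coefN a w : (N < size w)%N -> coef a w = 0.
Proof. by rewrite /coef => Nw; rewrite insubF// leqNgt Nw. Qed.

Lemma coef_finfun (F : word -> R) w : (size w <= N)%N ->
  coef [ffun u : N.-bseq 'I_ell => F u] w = F w.
Proof. by move=> wN; rewrite /coef insubT /= ffunE. Qed.

Lemma tens_eqP a b : (forall w, (size w <= N)%N -> coef a w = coef b w) -> a = b.
Proof.
by move=> ab; apply/ffunP => w; rewrite -!coef_bseq ab// size_bseq.
Qed.

Lemma coef0 w : coef 0 w = 0.
Proof. by rewrite /coef; case: insub => // u; rewrite ffunE. Qed.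

Lemma coefD a b w : coef (a + b) w = coef a w + coef b w.
Proof. by rewrite /coef; case: insub => [u|]; rewrite ?ffunE ?addr0. Qed.

Lemma coefZ c a w : coef (c *: a) w = c * coef a w.
Proof. by rewrite /coef; case: insub => [u|]; rewrite ?ffunE ?mulr0. Qed.

Lemma coefB a b w : coef (a - b) w = coef a w - coef b w.
Proof. by rewrite -scaleN1r coefD coefZ mulN1r. Qed.

Lemma coef_sum I r (P : pred I) (F : I -> tens) w :
  coef (\sum_(i <- r | P i) F i) w = \sum_(i <- r | P i) coef (F i) w.
Proof. by apply: (big_morph (coef^~ w)) => [a b|]; rewrite ?coefD ?coef0. Qed.

Lemma coef_one w : coef tens1 w = (nilp w)%:R.
Proof.
case: (leqP (size w) N) => wN; first by rewrite (coef_finfun (fun w => (nilp w)%:R)).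
by rewrite coefN//; case: w wN.
Qed.

Lemma coef_gen i w : (0 < N)%N -> coef (tens_gen R N i) w = (w == [:: i])%:R.
Proof.
move=> N0; case: (leqP (size w) N) => wN.
  by rewrite (coef_finfun (fun w => (w == [:: i])%:R)).
rewrite coefN//; case: eqP => // wi; move: wN; rewrite wi /= ltnS.
by rewrite leqn0 => /eqP n0; rewrite n0 in N0.
Qed.

Lemma coef_mul a b w : (size w <= N)%N ->
  coef (tens_mul a b) w = conv (coef a) (coef b) w.
Proof.
move=> wN; rewrite /coef insubT /= ffunE convE; apply: eq_bigr => k _.
by rewrite -!coef_bseq.
Qed.

Lemma tens_mulA : associative (@tens_mul R ell N).
Proof.
move=> a b c; apply: tens_eqP => w wN; rewrite !coef_mul//.
rewrite (eq_conv (f' := coef a) (g' := conv (coef b) (coef c)))//; last first.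
  by move=> u uw; rewrite coef_mul// (leq_trans uw).
rewrite convA; apply: eq_conv => // u uw; rewrite coef_mul//.
exact: leq_trans uw wN.
Qed.

Lemma tens_mul1 : left_id tens1 (@tens_mul R ell N).
Proof.
move=> a; apply: tens_eqP => w wN; rewrite coef_mul// convE big_ord_recl /=.
rewrite take0 drop0 coef_one mul1r big1 ?addr0// => k _.
rewrite coef_one /nilp size_take_min /bump /= add1n.
by case: w k {wN} => [|i w] k /=; [case: k|rewrite minnSS mul0r].
Qed.

Lemma tens_1mul : right_id tens1 (@tens_mul R ell N).
Proof.
move=> a; apply: tens_eqP => w wN; rewrite coef_mul// convE big_ord_recr /=.
rewrite take_size drop_size coef_one mulr1 big1 ?add0r// => k _.
rewrite coef_one /nilp size_drop subn_eq0 leqNgt ltn_ord /= mulr0//.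
Qed.

Lemma tens_mulDl : left_distributive (@tens_mul R ell N) +%R.
Proof.
move=> a b c; apply: tens_eqP => w wN; rewrite coefD !coef_mul//.
by rewrite -convDl; apply: eq_conv => // u _; rewrite coefD.
Qed.

Lemma tens_mulDr : right_distributive (@tens_mul R ell N) +%R.
Proof.
move=> a b c; apply: tens_eqP => w wN; rewrite coefD !coef_mul//.
by rewrite -convDr; apply: eq_conv => // u _; rewrite coefD.
Qed.

Lemma tens_mulZl (c : R) (a b : tens) : c *: tens_mul a b = tens_mul (c *: a) b.
Proof.
apply: tens_eqP => w wN; rewrite coefZ !coef_mul//.
by rewrite -convZl; apply: eq_conv => // u _; rewrite coefZ.
Qed.

Lemma tens_mulZr (c : R) (a b : tens) : c *: tens_mul a b = tens_mul a (c *: b).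
Proof.
apply: tens_eqP => w wN; rewrite coefZ !coef_mul//.
by rewrite -convZr; apply: eq_conv => // u _; rewrite coefZ.
Qed.

Lemma tens1_neq0 : tens1 != 0 :> tens.
Proof.
apply/eqP => /(congr1 (coef^~ [::])); rewrite coef_one coef0 /=.
by apply/eqP; rewrite oner_eq0.
Qed.

(** The truncated tensor algebra: an alias of [tens] carrying [tens_mul] as its
    ring product. *)
Definition talg : Type := tens.

HB.instance Definition _ := GRing.Lmodule.on talg.
HB.instance Definition _ := GRing.Zmodule_isNzRing.Build talg
  tens_mulA tens_mul1 tens_1mul tens_mulDl tens_mulDr tens1_neq0.
HB.instance Definition _ := GRing.Lmodule_isLalgebra.Build R talg tens_mulZl.
HB.instance Definition _ := GRing.Lalgebra_isAlgebra.Build R talg tens_mulZr.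

Lemma tens_powE (a : talg) k : tens_pow a k = a ^+ k.
Proof. by elim: k => [//|k IH]; rewrite exprS /tens_pow iterS -/(tens_pow a k) IH. Qed.

Definition deg_ge (m : nat) (a : tens) := forall w, (size w < m)%N -> coef a w = 0.

Lemma deg_ge_mul m k (a b : talg) : deg_ge m a -> deg_ge k b -> deg_ge (m + k) (a * b).
Proof.
move=> am bk w wmk; case: (leqP (size w) N) => wN; last exact: coefN.
rewrite coef_mul// convE big1// => j _.
case: (ltnP (size (take j w)) m) => h; first by rewrite am// mul0r.
rewrite (bk (drop j w)) ?mulr0//.
by rewrite -(ltn_add2l m) (leq_ltn_trans _ wmk)// -[in leqRHS](cat_take_drop j w) size_cat leq_add2r.
Qed.

Lemma deg_ge_eq0 m (a : talg) : deg_ge m a -> (N < m)%N -> a = 0.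
Proof. by move=> am Nm; apply: tens_eqP => w wN; rewrite am ?coef0// (leq_ltn_trans wN). Qed.

Lemma deg_ge_exp (a : talg) k : coef a [::] = 0 -> deg_ge k (a ^+ k).
Proof.
move=> a0; elim: k => [|k IH]; first by move=> w.
by rewrite exprS -add1n; apply: deg_ge_mul => // -[].
Qed.

Lemma tens_nilpotent (a : talg) : coef a [::] = 0 -> a ^+ N.+1 = 0.
Proof. by move=> a0; apply: (deg_ge_eq0 (deg_ge_exp (k := N.+1) a0)). Qed.

Lemma tens_logK (a : tens) : coef a [::] = 0 -> tens_log (tens_exp a) = a.
Proof.
move=> a0; rewrite -[RHS](log_exp_alg (A := talg) (tens_nilpotent a0)) /tens_log.
apply: eq_bigr => k _; rewrite -tens_powE; congr (_ *: tens_pow (_ - _) k).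
by apply: eq_bigr => j _; rewrite -tens_powE.
Qed.

End Coefficients.

(** * Dynkin's formula *)
Section Dynkin.
Variables (R : realType) (ell N : nat).
Hypothesis N0 : (0 < N)%N.
Local Notation word := (seq 'I_ell).
Local Notation A := (talg R ell N).

(** The value on a tensor [f] of the linear map sending the word [w] to [F w]. *)
Definition word_sum (V : lmodType R) (f : word -> R) (F : word -> V) : V :=
  \sum_(n < N.+1) \sum_(w <- words ell n) f w *: F w.

Lemma eq_word_sum (V : lmodType R) (f f' : word -> R) (F F' : word -> V) :
  (forall w, (size w <= N)%N -> f w *: F w = f' w *: F' w) ->
  word_sum f F = word_sum f' F'.
Proof.
move=> fF; apply: eq_bigr => n _; apply: eq_big_seq => w.
by rewrite mem_words => /eqP wn; apply: fF; rewrite wn -ltnS.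
Qed.

Lemma word_sum_linear (V W : lmodType R) (h : {linear V -> W}) f (F : word -> V) :
  h (word_sum f F) = word_sum f (h \o F).
Proof.
rewrite /word_sum linear_sum; apply: eq_bigr => n _; rewrite linear_sum.
by apply: eq_bigr => w _; rewrite linearZ.
Qed.

Lemma word_sum_lin (V : lmodType R) c f g (F : word -> V) :
  word_sum (fun w => c * f w + g w) F = c *: word_sum f F + word_sum g F.
Proof.
rewrite /word_sum scaler_sumr -big_split; apply: eq_bigr => n _ /=.
rewrite scaler_sumr -big_split; apply: eq_bigr => w _ /=.
by rewrite scalerDl scalerA.
Qed.

Lemma word_sum_conv (V : lmodType R) f g (F : word -> V) :
  (forall w, (N < size w)%N -> F w = 0) ->
  word_sum (conv f g) F = word_sum f (fun u => word_sum g (fun v => F (u ++ v))).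
Proof.
move=> FN; rewrite /word_sum.
under eq_bigr => n _ do rewrite sum_conv_words.
rewrite (sum_triangle N (fun k m => \sum_(u <- words ell k) \sum_(v <- words ell m)
     (f u * g v) *: F (u ++ v))).
apply: eq_bigr => k _; rewrite [LHS]exchange_big /=.
apply: eq_big_seq => u; rewrite mem_words => /eqP uk.
rewrite scaler_sumr [RHS](bigID (fun m : 'I_N.+1 => (m < N.+1 - k)%N)) /=.
rewrite [X in _ = _ + X]big1 ?addr0 => [|m].
  rewrite (big_ord_narrow (leq_subr k N.+1)) /=.
  apply: eq_bigr => m _; rewrite scaler_sumr; apply: eq_bigr => v _.
  by rewrite scalerA.
rewrite -leqNgt => mN; rewrite big1_seq ?scaler0// => v; rewrite mem_words => /eqP vm.
rewrite FN ?scaler0// size_cat uk vm.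
by have := ltn_ord k; move: mN; lia.
Qed.

Lemma word_sum_mul (V : lmodType R) (a b : A) (F : word -> V) :
  (forall w, (N < size w)%N -> F w = 0) ->
  word_sum (coef (a * b)) F = word_sum (coef a) (fun u => word_sum (coef b) (fun v => F (u ++ v))).
Proof.
move=> FN; rewrite -word_sum_conv//; apply: eq_word_sum => w wN.
by rewrite coef_mul.
Qed.

Let e (i : 'I_ell) : A := tens_gen R N i.

Definition br (a b : A) : A := a * b - b * a.

(** The iterated bracket e_[w]. *)
Fixpoint bracket_tensor (w : word) : A :=
  match w with
  | [::] => 0
  | [:: i] => e i
  | i :: w' => br (e i) (bracket_tensor w')
  end.

Definition ad_word (w : word) (z : A) : A := foldr (fun i => br (e i)) z w.

Lemma bracket_tensor_cat u v : v != [::] -> bracket_tensor (u ++ v) = ad_word u (bracket_tensor v).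
Proof.
move=> v0; elim: u => [//|i u IH] /=; rewrite -/(ad_word u (bracket_tensor v)) -IH.
by case: u {IH} => [|j u] //=; case: v v0.
Qed.

Lemma br_linear a : linear (br a).
Proof.
by move=> c x y; rewrite /br mulrDr mulrDl -scalerAr -scalerAl opprD addrACA -scalerBr.
Qed.

HB.instance Definition _ a := GRing.isLinear.Build R A A _ (br a) (br_linear a).

Lemma ad_word_linear w : linear (ad_word w).
Proof. by elim: w => [|i w IH] c x y //=; rewrite IH linearP. Qed.

HB.instance Definition _ w := GRing.isLinear.Build R A A _ (ad_word w) (ad_word_linear w).

Definition homog (m : nat) (a : A) := forall w, size w != m -> coef a w = 0.

Lemma homog_mul m k (a b : A) : homog m a -> homog k b -> homog (m + k) (a * b).
Proof.
move=> am bk w wmk; case: (leqP (size w) N) => wN; last exact: coefN.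
rewrite coef_mul// convE big1// => j _.
case: (eqVneq (size (take j w)) m) => h; last by rewrite am// mul0r.
rewrite (bk (drop j w)) ?mulr0//; apply: contra wmk => /eqP hk.
by rewrite -(cat_take_drop j w) size_cat h hk.
Qed.

Lemma homog_br m k (a b : A) : homog m a -> homog k b -> homog (m + k) (br a b).
Proof.
move=> am bk w wmk; rewrite /br coefB (homog_mul am bk) ?sub0r//.
by rewrite addnC in wmk; rewrite (homog_mul bk am) ?oppr0.
Qed.

Lemma homog_gen i : homog 1 (e i).
Proof. by move=> w w1; rewrite coef_gen//; case: eqP => // wi; rewrite wi in w1. Qed.

Lemma homog_bracket_tensor w : homog (size w) (bracket_tensor w).
Proof.
elim: w => [|i [|j w] IH]; first by move=> u _; rewrite coef0.
  exact: homog_gen.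
exact: homog_br (homog_gen i) IH.
Qed.

Lemma bracket_tensor_big w : (N < size w)%N -> bracket_tensor w = 0.
Proof.
move=> Nw; apply: tens_eqP => u uN; rewrite coef0 homog_bracket_tensor//.
by rewrite neq_ltn (leq_ltn_trans uN Nw).
Qed.

Lemma ad_word_big w z : (N < size w)%N -> ad_word w z = 0.
Proof.
have H : deg_ge (size w) (ad_word w z).
  elim: w => [|i w IH] //= u uw; rewrite /br coefB.
  have ei : deg_ge 1 (e i) by move=> v v1; rewrite homog_gen// neq_ltn v1.
  by rewrite (deg_ge_mul ei IH) ?(deg_ge_mul IH ei) ?subr0// ?add1n ?addn1.
exact: deg_ge_eq0.
Qed.

(** [ad] is the representation of the tensor algebra extending e_i |-> [e_i, .],
    [dynkin_op] sends a word to its iterated bracket, and [degree_op] multiplies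
    the component of degree n by n. *)
Definition ad (a z : A) : A := word_sum (coef a) (fun w => ad_word w z).
Definition dynkin_op (a : A) : A := word_sum (coef a) bracket_tensor.
Definition degree_op (a : A) : A := [ffun w : N.-bseq 'I_ell => (size w)%:R * a w].

Lemma coef_degree a w : coef (degree_op a) w = (size w)%:R * coef a w.
Proof.
rewrite /degree_op /coef; case: insubP => [u _ <-|_]; last by rewrite mulr0.
by rewrite ffunE.
Qed.

Lemma ad_mul (a b z : A) : ad (a * b) z = ad a (ad b z).
Proof.
rewrite /ad word_sum_mul => [|w wN]; last exact: ad_word_big.
apply: eq_word_sum => u _; congr (_ *: _).
by rewrite word_sum_linear; apply: eq_word_sum => v _ /=; rewrite /ad_word foldr_cat.
Qed.

(** e_[uv] is obtained by applying the brackets of the letters of u to e_[v],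
    provided v is not empty; hence the condition on the scalar part of [b]. *)
Lemma dynkin_op_mul (a b : A) : coef b [::] = 0 -> dynkin_op (a * b) = ad a (dynkin_op b).
Proof.
move=> b0; rewrite /dynkin_op word_sum_mul => [|w wN]; last exact: bracket_tensor_big.
apply: eq_word_sum => u _; congr (_ *: _).
rewrite word_sum_linear; apply: eq_word_sum => v _ /=.
by case: (eqVneq v [::]) => [->|v0]; rewrite ?b0 ?scale0r ?bracket_tensor_cat.
Qed.

Lemma degree_mul (a b : A) : degree_op (a * b) = degree_op a * b + a * degree_op b.
Proof.
apply: tens_eqP => w wN; rewrite coef_degree coefD !coef_mul// conv_size.
by congr (_ + _); apply: eq_conv => // u _; rewrite coef_degree.
Qed.

Lemma word_sum_gen (V : lmodType R) i (F : word -> V) : word_sum (coef (e i)) F = F [:: i].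
Proof.
rewrite /word_sum.
have -> : \sum_(n < N.+1) \sum_(w <- words ell n) coef (e i) w *: F w
   = \sum_(w : N.-bseq 'I_ell) coef (e i) w *: F w.
  by rewrite (big_bseq_words N (fun w => coef (e i) w *: F w)).
have iN : (size [:: i] <= N)%N by [].
rewrite (bigD1 (Bseq iN)) //= coef_gen// eqxx scale1r big1 ?addr0// => w wi.
by rewrite coef_gen// (negPf (_ : (w : word) != [:: i])) ?scale0r.
Qed.

Lemma jacobi (a b z : A) : br a (br b z) - br b (br a z) = br (br a b) z.
Proof.
rewrite /br !mulrBr !mulrBl !mulrA; apply: tens_eqP => w _.
by rewrite !coefB; ring.
Qed.

(** The Dynkin operator sends [x, y] = xy - yx to ad x (deg y) - ad y (deg x), that
    is to [x, deg y] - [y, deg x], and this is deg [x, y] since deg is a derivation. *)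
Lemma lie_dynkin_br (x y : A) :
  coef x [::] = 0 -> (forall z, ad x z = br x z) -> dynkin_op x = degree_op x ->
  coef y [::] = 0 -> (forall z, ad y z = br y z) -> dynkin_op y = degree_op y ->
  [/\ coef (br x y) [::] = 0, forall z, ad (br x y) z = br (br x y) z
    & dynkin_op (br x y) = degree_op (br x y)].
Proof.
move=> x0 xad xd y0 yad yd.
have linB (V : lmodType R) (F : word -> V) (u v : A) :
    word_sum (coef ((u - v) : A)) F = word_sum (coef u) F - word_sum (coef v) F.
  have := word_sum_lin (-1) (coef v) (coef u) F; rewrite scaleN1r addrC => <-.
  by apply: eq_word_sum => w _; rewrite coefB mulN1r addrC.
split.
- by rewrite /br coefB !coef_mul//= x0 y0 !mul0r subr0.
- move=> z; rewrite -jacobi; have -> : ad (br x y) z = ad (x * y) z - ad (y * x) z.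
    exact: (linB A (fun w => ad_word w z) (x * y) (y * x)).
  by rewrite !ad_mul !xad !yad.
- have -> : dynkin_op (br x y) = dynkin_op (x * y) - dynkin_op (y * x).
    exact: (linB A bracket_tensor (x * y) (y * x)).
  rewrite !dynkin_op_mul// xad yad xd yd [in RHS]/br.
  apply: tens_eqP => w wN.
  have eB (u v : A) : degree_op (u - v) = degree_op u - degree_op v.
    by apply: tens_eqP => u' _; rewrite !(coefB, coef_degree); ring.
  by rewrite eB !degree_mul /br !(coefB, coefD); ring.
Qed.

(** On Lie elements the representation [ad] is the adjoint one, and the
    Dynkin operator multiplies by the degree (Dynkin, Specht, Wever). *)
Lemma lie_dynkin (a : A) : free_nilpotent_lie a ->
  [/\ coef a [::] = 0, forall z, ad a z = br a z & dynkin_op a = degree_op a].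
Proof.
elim=> [i||c x y _ [x0 xad xd] _ [y0 yad yd]|x y _ [x0 xad xd] _ [y0 yad yd]].
- split; first by rewrite coef_gen.
    by move=> z; rewrite /ad word_sum_gen.
  rewrite /dynkin_op word_sum_gen; apply: tens_eqP => w _; rewrite coef_degree coef_gen//.
  by case: eqP => [->|_]; rewrite ?mul1r ?mulr0.
- have z0 (V : lmodType R) (F : word -> V) : word_sum (coef (0 : A)) F = 0.
    by rewrite /word_sum big1// => n _; rewrite big1// => w _; rewrite coef0 scale0r.
  split; first by rewrite coef0.
    by move=> z; rewrite /ad z0 /br mul0r mulr0 subr0.
  by rewrite /dynkin_op z0; apply: tens_eqP => w _; rewrite coef_degree !coef0 mulr0.
- have lin (V : lmodType R) (F : word -> V) :
      word_sum (coef (c *: x + y)) F = c *: word_sum (coef x) F + word_sum (coef y) F.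
    by rewrite -word_sum_lin; apply: eq_word_sum => w _; rewrite coefD coefZ.
  split; first by rewrite coefD coefZ x0 y0 mulr0 addr0.
    move=> z; rewrite /ad lin -/(ad x z) -/(ad y z) xad yad /br.
    by rewrite mulrDl mulrDr -scalerAl -scalerAr opprD addrACA -scalerBr.
  rewrite /dynkin_op lin -/(dynkin_op x) -/(dynkin_op y) xd yd; apply: tens_eqP => w _.
  by rewrite !(coefD, coefZ, coef_degree); ring.
- exact: lie_dynkin_br.
Qed.

(** The degreewise division in [lie_dynkin], followed by an arbitrary linear map
    on tensors; below, that map is the evaluation of the operators V_w. *)
Lemma dynkin (V : lmodType R) (a : A) (F : word -> V) : free_nilpotent_lie a ->
  \sum_(w : N.-bseq 'I_ell | (0 < size w)%N)
     ((size w)%:R^-1 * a w) *: word_sum (coef (bracket_tensor w)) F = word_sum (coef a) F.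
Proof.
move=> /lie_dynkin[a0 _ ad].
have E v : coef a v = \sum_(w : N.-bseq 'I_ell | (0 < size w)%N)
    ((size w)%:R^-1 * a w) * coef (bracket_tensor w) v.
  have vE : (size v)%:R * coef a v = \sum_(w : N.-bseq 'I_ell) a w * coef (bracket_tensor w) v.
    rewrite -coef_degree -ad /dynkin_op /word_sum.
    rewrite -(big_bseq_words N (fun w => coef a w *: bracket_tensor w)) coef_sum.
    by apply: eq_bigr => w _; rewrite coefZ coef_bseq.
  case: (posnP (size v)) => [v0|vpos].
    rewrite (size0nil v0) a0 big1// => w w0; rewrite homog_bracket_tensor ?mulr0//.
    by rewrite neq_ltn w0.
  have v0 : (size v)%:R != 0 :> R by rewrite pnatr_eq0 -lt0n.
  rewrite -[LHS](mulKf v0) vE big_distrr [RHS]big_mkcond /=; apply: eq_bigr => w _.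
  case: (eqVneq (size v) (size w)) => [vw|vw].
    by rewrite -vw vpos mulrA.
  by rewrite homog_bracket_tensor// !mulr0; case: ifP.
rewrite [RHS](eq_word_sum (f' := fun v => \sum_(w : N.-bseq 'I_ell | (0 < size w)%N)
    ((size w)%:R^-1 * a w) * coef (bracket_tensor w) v) (F' := F)) => [|v _]; last by rewrite E.
rewrite /word_sum [RHS](eq_bigr (fun n : 'I_N.+1 => \sum_(w : N.-bseq 'I_ell | (0 < size w)%N)
    ((size w)%:R^-1 * a w) *: (\sum_(v <- words ell n) coef (bracket_tensor w) v *: F v))).
  rewrite exchange_big; apply: eq_bigr => w _ /=.
  by rewrite -scaler_sumr.
move=> n _; rewrite [RHS](eq_bigr (fun w : N.-bseq 'I_ell =>
   \sum_(v <- words ell n) (((size w)%:R^-1 * a w) * coef (bracket_tensor w) v) *: F v)).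
  rewrite exchange_big; apply: eq_bigr => v _ /=.
  by rewrite -scaler_suml.
by move=> w _; rewrite scaler_sumr; apply: eq_bigr => v _; rewrite scalerA.
Qed.

End Dynkin.

(** * Calculus of C2 maps *)
Section Calculus.
Variables (R : realType) (d : nat).
Local Notation E := 'rV[R]_d.

Lemma is_derive_comp_curve (f : E -> E) (y : R -> E) (r : R) (dy : E) :
  differentiable f (y r) -> is_derive r 1 y dy ->
  is_derive r 1 (fun s => f (y s)) ('d f (y r) dy).
Proof.
move=> fd [yd yE].
have yd' : differentiable y r by apply/derivable1_diffP.
have fy : differentiable (f \o y) r by apply: differentiable_comp.
apply: DeriveDef; first exact/derivable1_diffP.
by rewrite (deriveE _ fy) diff_comp//= -yE (deriveE _ yd').
Qed.

Lemma is_derive_line (p u : E) (r : R) : is_derive r 1 (fun s : R => p + s *: u) u.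
Proof.
apply: (@is_derive_of_quad _ _ _ _ _ 0 1) => // h _.
rewrite (_ : _ - _ = 0) ?normr0 ?mul0r//.
by apply/rowP => i; rewrite !mxE; ring.
Qed.

Lemma is_derive_fun_line (f : E -> E) (p u : E) (r : R) : (forall x, differentiable f x) ->
  is_derive r 1 (fun s : R => f (p + s *: u)) ('d f (p + r *: u) u).
Proof. by move=> fd; apply: (is_derive_comp_curve (fd _) (is_derive_line p u r)). Qed.

Lemma fun_line_continuous (f : E -> E) (p u : E) (A : set R) : (forall x, differentiable f x) ->
  {within A, continuous (fun s : R => f (p + s *: u))}.
Proof.
move=> fd; apply: continuous_subspaceT => r.
apply: differentiable_continuous; apply/derivable1_diffP.
by case: (is_derive_fun_line p u r fd).
Qed.

(** Two applications of the mean value theorem, first in the direction [u] to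
    the increment of [f] by t v, then in the direction [v] to its derivative. *)
Lemma second_difference (f : E -> E) (x u v : E) (t : R) i : class_C 2 f -> 0 < t ->
  exists2 z, `|z - x| <= t * (`|u| + `|v|) &
    (f (x + t *: u + t *: v) - f (x + t *: u) - (f (x + t *: v) - f x)) ord0 i =
    t ^+ 2 * ('d (fun y => 'd f y u) z v) ord0 i.
Proof.
move=> [fd f2] t0; have [fud fu2] := f2 u.
pose g (s : R) := (f (x + t *: v + s *: u) - f (x + s *: u)) ord0 i.
pose dg (s : R) := ('d f (x + t *: v + s *: u) u - 'd f (x + s *: u) u) ord0 i.
have [||s] := @MVT R g dg 0 t t0.
- move=> s _; apply: is_derive_coord; apply: is_deriveB; exact: is_derive_fun_line.
- apply: within_continuous_coord.
  move=> s; apply: continuousB; exact: fun_line_continuous.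
rewrite in_itv /= => /andP[s0 st] gE.
pose h (r : R) := ('d f (x + s *: u + r *: v) u) ord0 i.
pose dh (r : R) := ('d (fun y => 'd f y u) (x + s *: u + r *: v) v) ord0 i.
have [||r] := @MVT R h dh 0 t t0.
- move=> r _; apply: is_derive_coord.
  exact: (@is_derive_fun_line (fun y => 'd f y u)).
- apply: within_continuous_coord.
  exact: (@fun_line_continuous (fun y => 'd f y u)).
rewrite in_itv /= => /andP[r0 rt] hE.
exists (x + s *: u + r *: v).
  rewrite (_ : _ - x = s *: u + r *: v); last by apply/rowP => j; rewrite !mxE; ring.
  rewrite mulrDr.
  apply: le_trans (ler_normD _ _) _; rewrite !normrZ !gtr0_norm//.
  by apply: lerD; rewrite ler_wpM2r// ltW.
have -> : (f (x + t *: u + t *: v) - f (x + t *: u) - (f (x + t *: v) - f x)) ord0 i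
    = g t - g 0.
  by rewrite /g !scale0r !addr0 [x + t *: v + _]addrAC !mxE; ring.
rewrite gE; have -> : dg s = h t - h 0.
  by rewrite /dg /h !scale0r !addr0 [x + t *: v + _]addrAC !mxE.
by rewrite hE /dh subr0 -mulrA mulrC expr2.
Qed.

(** The second difference is symmetric in [u] and [v]; divide it by t^2. *)
Lemma schwarz (f : E -> E) (x u v : E) : class_C 2 f ->
  'd (fun z => 'd f z u) x v = 'd (fun z => 'd f z v) x u.
Proof.
move=> fC; apply/rowP => i; apply/eqP; rewrite -subr_eq0 -normr_le0.
apply/ler_addgt0Pr => e e0; rewrite add0r.
pose B (u v : E) z := ('d (fun y => 'd f y u) z v) ord0 i.
have Bc a b : exists2 k, 0 < k & forall z, `|z - x| < k -> `|B a b x - B a b z| < e / 2.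
  have cB : continuous (fun z => 'd (fun y => 'd f y a) z b) by case: fC => _ /(_ a)[_].
  have /(@nbhs_normP R E)[k /= k0 kB] : nbhs x [set z | `|B a b x - B a b z| < e / 2].
    have /cvgrPdist_lt : B a b @ (x : E) --> (B a b x : R).
      apply: (@continuous_comp E E R (fun z => 'd (fun y => 'd f y a) z b) (fun w : E => w ord0 i)).
        exact: cB.
      exact: coord_continuous.
    by apply; rewrite divr_gt0.
  by exists k => // z zx; apply: kB; rewrite /= distrC.
have [k1 k10 B1] := Bc u v; have [k2 k20 B2] := Bc v u.
pose m := `|u| + `|v| + 1.
have m0 : 0 < m by rewrite ltr_wpDl// addr_ge0.
pose t := Num.min k1 k2 / m.
have kk : 0 < Num.min k1 k2 by rewrite lt_min k10 k20.
have t0 : 0 < t by rewrite divr_gt0.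
have tk : t * (`|u| + `|v|) < Num.min k1 k2.
  by rewrite /t mulrAC ltr_pdivrMr// ltr_pM2l// ltrDl.
have [z zx zE] := second_difference x u v i fC t0.
have [w wx wE] := second_difference x v u i fC t0.
have zw : B u v z = B v u w.
  have t2 : t ^+ 2 != 0 by rewrite expf_neq0// gt_eqF.
  apply: (mulfI t2); rewrite -zE -wE !mxE [x + t *: v + _]addrAC; ring.
have h1 : `|B u v x - B u v z| < e / 2.
  by apply: B1; apply: le_lt_trans zx _; apply: lt_le_trans tk _; rewrite ge_min lexx.
have h2 : `|B v u x - B v u w| < e / 2.
  apply: B2; apply: le_lt_trans wx _; rewrite addrC; apply: lt_le_trans tk _.
  by rewrite ge_min lexx orbT.
rewrite -/(B u v x) -/(B v u x).
rewrite (_ : B u v x - B v u x = (B u v x - B u v z) - (B v u x - B v u w)); last first.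
  by rewrite zw opprB addrA subrK.
apply: le_trans (ler_normB _ _) _; apply: ltW.
by rewrite [ltRHS](splitr e); apply: ltrD.
Qed.

Lemma is_derive_of_coord (F : E -> E) (x v dF : E) :
  (forall j, is_derive x v (fun z => F z ord0 j) (dF ord0 j)) -> is_derive x v F dF.
Proof.
move=> H; have Fd : derivable F x v.
  by apply/derivable_mxP => i j; rewrite ord1; case: (H j).
apply: DeriveDef => //; rewrite derive_mx//; apply/rowP => j; rewrite mxE.
by case: (H j).
Qed.

Lemma is_derive_coordE (F : E -> E) (x v : E) j : differentiable F x ->
  is_derive x v (fun z => F z ord0 j) ('d F x v ord0 j).
Proof.
move=> Fd; have Fv := diff_derivable (v := v) Fd.
apply: DeriveDef; first by have := (derivable_mxP _ _ _).1 Fv ord0 j.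
by rewrite -(deriveE v Fd) derive_mx// mxE.
Qed.

Lemma diff_delta (f : E -> E) x (w : E) :
  'd f x w = \sum_j w ord0 j *: 'd f x (delta_mx ord0 j).
Proof.
rewrite {1}[w]row_sum_delta linear_sum; apply: eq_bigr => j _.
by rewrite linearZ.
Qed.

Lemma coord_add (a b : E) i : (a + b) ord0 i = a ord0 i + b ord0 i.
Proof. by rewrite mxE. Qed.

(** Product rule for x |-> Df(x)(g(x)).  As the derivatives of f are only given at
    fixed directions, expand g(x) on the canonical basis. *)
Lemma is_derive_act (f g : E -> E) (x v : E) : class_C 2 f -> differentiable g x ->
  is_derive x v (fun z => 'd f z (g z))
    ('d (fun z => 'd f z (g x)) x v + 'd f x ('d g x v)).
Proof.
move=> [fd f2] gd; apply: is_derive_of_coord => i.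
have fe j z : is_derive z v (fun z => 'd f z (delta_mx ord0 j) ord0 i)
   ('d (fun z => 'd f z (delta_mx ord0 j)) z v ord0 i).
  by apply: is_derive_coordE; case: (f2 (delta_mx ord0 j)).
have ge j : is_derive x v (fun z => g z ord0 j) ('d g x v ord0 j).
  exact: is_derive_coordE.
have E1 (h : E -> E) : (fun z => 'd f z (h z) ord0 i)
   = \sum_j ((fun z => h z ord0 j) * (fun z => 'd f z (delta_mx ord0 j) ord0 i)).
  apply/funext => z.
  have -> : 'd f z (h z) ord0 i = (\sum_j h z ord0 j *: 'd f z (delta_mx ord0 j)) ord0 i.
    by rewrite -diff_delta.
  rewrite summxE.
  rewrite fct_sumE.
  apply: eq_bigr => j _.
  by rewrite mxE.
rewrite (E1 g).
have E2 := is_derive_coordE v i (proj1 (f2 (g x)) x).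
rewrite (E1 (fun=> g x)) in E2.
have E3 : is_derive x v (\sum_j ((fun z => g x ord0 j) * (fun z => 'd f z (delta_mx ord0 j) ord0 i)))
   (\sum_j (g x ord0 j *: 'd (fun z => 'd f z (delta_mx ord0 j)) x v ord0 i
       + 'd f x (delta_mx ord0 j) ord0 i *: 0)).
  apply: (@is_derive_sum _ _ _ _ (fun j => (cst (g x ord0 j) : E -> R)
    * (fun z => 'd f z (delta_mx ord0 j) ord0 i))) => j.
  exact: (@is_deriveM _ _ _ _ _ _ _ _ (is_derive_cst (g x ord0 j) x v) (fe j x)).
have E4 : is_derive x v (\sum_j ((fun z => g z ord0 j) * (fun z => 'd f z (delta_mx ord0 j) ord0 i)))
   (\sum_j (g x ord0 j *: 'd (fun z => 'd f z (delta_mx ord0 j)) x v ord0 i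
       + 'd f x (delta_mx ord0 j) ord0 i *: 'd g x v ord0 j)).
  apply: (@is_derive_sum _ _ _ _ (fun j => (fun z => g z ord0 j)
    * (fun z => 'd f z (delta_mx ord0 j) ord0 i))) => j.
  exact: (@is_deriveM _ _ _ _ _ _ _ _ (ge j) (fe j x)).
apply: is_derive_eq E4 _.
rewrite coord_add.
pose S1 := \sum_j (g x ord0 j *: 'd (fun z => 'd f z (delta_mx ord0 j)) x v ord0 i
       + 'd f x (delta_mx ord0 j) ord0 i *: 0).
pose S2 := \sum_j ('d g x v ord0 j * 'd f x (delta_mx ord0 j) ord0 i).
transitivity (S1 + S2).
  rewrite /S1 /S2 -big_split; apply: eq_bigr => j _ /=.
  by rewrite scaler0 addr0; congr (_ + _); rewrite /GRing.scale /= mulrC.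
congr (_ + _).
  case: E3 => _ E3'; case: E2 => _ E2'.
  by rewrite /S1 -E3'; exact: E2'.
rewrite (diff_delta f x ('d g x v)) summxE.
by apply: eq_bigr => j _; rewrite mxE.
Qed.

Lemma diff_sub (f : E -> E) (p u w : E) : 'd f p (u - w) = 'd f p u - 'd f p w.
Proof. exact: linearB. Qed.

Lemma diff_add (f : E -> E) (p u w : E) : 'd f p (u + w) = 'd f p u + 'd f p w.
Proof. exact: linearD. Qed.

Lemma diff_sum (f : E -> E) (p : E) (T : Type) (s : seq T) (F : T -> E) :
  'd f p (\sum_(i <- s) F i) = \sum_(i <- s) 'd f p (F i).
Proof. exact: linear_sum. Qed.

Lemma diff_scale (f : E -> E) (p : E) (c : R) (u : E) : 'd f p (c *: u) = c *: 'd f p u.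
Proof. exact: linearZ. Qed.

Lemma diff_at0 (f : E -> E) (p : E) : 'd f p 0 = 0.
Proof. exact: linear0. Qed.

Lemma diff_split (f : E -> E) (p q u w : E) :
  'd f p u - 'd f q w = 'd f p (u - w) + ('d f p w - 'd f q w).
Proof.
apply: esym (etrans (congr1 (fun z => z + ('d f p w - 'd f q w)) (diff_sub f p u w)) _).
exact: subrKA.
Qed.

End Calculus.

Section VectorFieldWords.
Variables (R : realType) (d : nat).
Local Notation E := 'rV[R]_d.

Lemma diff_lincomb (T : eqType) (s : seq T) (c : T -> R) (F : T -> E -> E) (x : E) :
  (forall i, i \in s -> differentiable (F i) x) ->
  differentiable (fun z => \sum_(i <- s) c i *: F i z) x /\
  forall v, 'd (fun z => \sum_(i <- s) c i *: F i z) x v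
    = \sum_(i <- s) c i *: 'd (F i) x v.
Proof.
elim: s => [_|i s IH Fd].
  have -> : (fun z => \sum_(i <- [::]) c i *: F i z) = cst 0.
    by apply/funext => z; rewrite big_nil.
  split; first exact: differentiable_cst.
  by move=> v; rewrite big_nil diff_cst.
have [sd sE] : differentiable (fun z => \sum_(i <- s) c i *: F i z) x /\
  forall v, 'd (fun z => \sum_(i <- s) c i *: F i z) x v
    = \sum_(i <- s) c i *: 'd (F i) x v.
  by apply: IH => j js; apply: Fd; rewrite inE js orbT.
have id := Fd i (mem_head _ _).
have -> : (fun z => \sum_(j <- i :: s) c j *: F j z)
   = (c i \*: F i) + (fun z => \sum_(i <- s) c i *: F i z).
  by apply/funext => z; rewrite big_cons.
have cd : differentiable (c i \*: F i) x by apply: differentiableZ.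
split; first exact: differentiableD.
move=> v; rewrite big_cons -sE.
have DD := congr1 (fun h : E -> E => h v) (diffD cd sd).
apply: etrans DD _.
have DZ := congr1 (fun h : E -> E => h v) (diffZ (c i) id).
rewrite /=; congr (_ + _); exact: DZ.
Qed.

(** For the four-point estimate, apply the mean value inequality to
    r |-> f (a' + r (a - a')) - f (z' + r (z - z')). *)
Lemma C2_estimates (f : E -> E) : C2_bounded_derivatives f -> exists M : R,
  [/\ 0 <= M, four_point_lip M f, forall x v, `|'d f x v| <= M * `|v|
    & forall x z v, `|'d f x v - 'd f z v| <= M * `|x - z| * `|v|].
Proof.
move=> [fC [M1 f1] [M2 f2]].
pose M := Num.max 0 (Num.max M1 M2).
have M0 : 0 <= M by rewrite /M le_max lexx.
have {}f1 x v : `|'d f x v| <= M * `|v|.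
  by apply: le_trans (f1 x v) _; rewrite ler_wpM2r// /M !le_max lexx orbT.
have {}f2 x u v : `|'d (fun z => 'd f z v) x u| <= M * `|u| * `|v|.
  apply: le_trans (f2 x u v) _; rewrite ler_wpM2r// ler_wpM2r//.
  by rewrite /M !le_max lexx !orbT.
clearbody M.
have fd : forall x, differentiable f x by case: fC.
have seg (a b : E) : b + 1 *: (a - b) = a by rewrite scale1r addrC subrK.
have seg0 (a b : E) : b + 0 *: (a - b) = b by rewrite scale0r addr0.
have df_lip x z v : `|'d f x v - 'd f z v| <= M * `|x - z| * `|v|.
  have vd : forall y, differentiable (fun y => 'd f y v) y by case: fC => _ /(_ v) [].
  have := mean_value_ineq (y := fun r => 'd f (z + r *: (x - z)) v)
    (dy := fun r => 'd (fun y => 'd f y v) (z + r *: (x - z)) (x - z))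
    (M := M * `|x - z| * `|v|) ler01.
  rewrite seg seg0 subr0 mulr1; apply.
  - exact: (@fun_line_continuous _ _ (fun y => 'd f y v)).
  - by move=> r _ _; apply: (@is_derive_fun_line _ _ (fun y => 'd f y v)).
  - by move=> r _ _; apply: f2.
exists M; split=> //; split=> [x z|a a' z z'].
  have := mean_value_ineq (y := fun r => f (z + r *: (x - z)))
    (dy := fun r => 'd f (z + r *: (x - z)) (x - z)) (M := M * `|x - z|) ler01.
  rewrite seg seg0 subr0 mulr1; apply.
  - exact: fun_line_continuous.
  - by move=> r _ _; apply: is_derive_fun_line.
  - by move=> r _ _; apply: f1.
pose B := M * (`|(a - a') - (z - z')|
             + (`|a - z| + `|a' - z'|) * (`|a - a'| + `|z - z'|)).
have := mean_value_ineq (y := fun r => f (a' + r *: (a - a')) - f (z' + r *: (z - z')))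
    (dy := fun r => 'd f (a' + r *: (a - a')) (a - a')
                    - 'd f (z' + r *: (z - z')) (z - z')) (M := B) ler01.
rewrite !seg !seg0 subr0 mulr1.
have -> : f a - f z - (f a' - f z') = f a - f a' - (f z - f z').
  by rewrite !opprB addrACA [RHS]addrACA; congr (_ + _); exact: addrC.
apply.
- move=> s; apply: continuousB; exact: fun_line_continuous.
- by move=> r _ _; apply: is_deriveB; exact: is_derive_fun_line.
- move=> r r0 r1; set p := a' + _; set q := z' + _.
  rewrite (diff_split f p q (a - a') (z - z')).
  have pq : `|p - q| <= `|a - z| + `|a' - z'|.
    have -> : p - q = r *: (a - z) + (1 - r) *: (a' - z').
      by rewrite /p /q; apply/rowP => i; rewrite !mxE; ring.
    apply: le_trans (ler_normD _ _) _; rewrite !normrZ !gtr0_norm ?subr_gt0//.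
    by apply: lerD; rewrite ler_piMl// ?gerBl ltW.
  apply: le_trans (ler_normD _ _) _; rewrite /B mulrDr; apply: lerD; first exact: f1.
  apply: le_trans (df_lip _ _ _) _; rewrite -mulrA ler_wpM2l//.
  by apply: ler_pM => //; rewrite lerDr.
Qed.

Lemma class_C2_id : class_C 2 (@id E).
Proof.
have didE x v : 'd (@id E) x v = v.
  by have [_ ->] : is_diff x (@id E) id := is_diff_id x.
have idd x : differentiable (@id E) x by have [] : is_diff x (@id E) id := is_diff_id x.
split=> //= v.
have -> : (fun x => 'd (@id E) x v) = cst v by apply/funext => x; rewrite didE.
split=> [x|w]; first exact: differentiable_cst.
have -> : (fun x : E => 'd (cst v : E -> E) x w) = cst 0.
  by apply/funext => x; rewrite diff_cst.
exact: cst_continuous.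
Qed.

Lemma four_point_lip_lincomb (T : eqType) (s : seq T) (c : T -> R) (F : T -> E -> E) (M : R) :
  (forall i, i \in s -> four_point_lip M (F i)) ->
  four_point_lip (\sum_(i <- s) `|c i| * M) (fun z => \sum_(i <- s) c i *: F i z).
Proof.
elim: s => [_|i s IH Fl].
  split=> *; rewrite !big_nil ?subrr ?subr0 normr0 mul0r//.
have [H1 H2] : four_point_lip (\sum_(i <- s) `|c i| * M) (fun z => \sum_(i <- s) c i *: F i z).
  by apply: IH => j js; apply: Fl; rewrite inE js orbT.
have [G1 G2] := Fl i (mem_head _ _).
split=> [x z|a a' z z']; rewrite !big_cons mulrDl.
  rewrite (_ : _ - _ = c i *: (F i x - F i z)
     + (\sum_(i <- s) c i *: F i x - \sum_(i <- s) c i *: F i z)); last first.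
    by rewrite scalerBr opprD addrACA.
  apply: le_trans (ler_normD _ _) _; apply: lerD => //.
  by rewrite normrZ -mulrA ler_wpM2l.
rewrite (_ : _ - _ = c i *: (F i a - F i a' - (F i z - F i z'))
   + ((\sum_(i <- s) c i *: F i a - \sum_(i <- s) c i *: F i a')
     - (\sum_(i <- s) c i *: F i z - \sum_(i <- s) c i *: F i z'))); last first.
  by apply/rowP => j; rewrite !mxE; ring.
apply: le_trans (ler_normD _ _) _; apply: lerD => //.
by rewrite normrZ -mulrA ler_wpM2l.
Qed.

End VectorFieldWords.

(** * Lie elements act as derivations *)
Section LieAction.
Variables (R : realType) (d ell N : nat).
Local Notation E := 'rV[R]_d.
Local Notation A := (talg R ell N).
Local Notation word := (seq 'I_ell).
Hypothesis N0 : (0 < N)%N.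
Variable V : 'I_ell -> E -> E.
Local Notation f := (vf_word V).
Hypothesis fC : forall J : word, (size J <= N)%N -> class_C 2 (f J).

(** The part of degree n of [a], read as a differential operator through
    e_i |-> V_i and applied to the function f_I. *)
Definition act (a : A) (n : nat) (I : word) (x : E) : E :=
  \sum_(K <- words ell n) coef a K *: f (K ++ I) x.

Lemma act_diff a n I x : (n + size I <= N)%N ->
  differentiable (act a n I) x /\
  forall v, 'd (act a n I) x v = \sum_(K <- words ell n) coef a K *: 'd (f (K ++ I)) x v.
Proof.
move=> nIN.
apply: (@diff_lincomb R d _ (words ell n) (coef a) (fun K => f (K ++ I)) x) => K.
rewrite mem_words => /eqP Kn.
by have [fd _] : class_C 2 (f (K ++ I)) by apply: fC; rewrite size_cat Kn.
Qed.

(** The operator of [a] is of first order, as far as this can be tested with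
    words of length at most N, the only ones whose functions are known to be
    differentiable. *)
Definition derivation (a : A) := forall n I x, (0 < n)%N -> (n + size I <= N)%N ->
  'd (f I) x (act a n [::] x) = act a n I x.

(** If [a] and [b] act by vector fields W_a, W_b, then W_a W_b f is
    D2f (W_a, W_b) + Df (DW_b (W_a)); this is its part of bidegree (k, m). *)
Definition cross (a b : A) (k m : nat) (I : word) (x : E) : E :=
  if (0 < k)%N && (0 < m)%N then
    'd (fun z => 'd (f I) z (act b m [::] x)) x (act a k [::] x)
    + 'd (f I) x ('d (act b m [::]) x (act a k [::] x))
  else 0.

Lemma act0 n I x : act 0 n I x = 0.
Proof. by rewrite /act big1// => K _; rewrite coef0 scale0r. Qed.

Lemma act_mul (a b : A) n I x : derivation a -> derivation b ->
  coef a [::] = 0 -> coef b [::] = 0 -> (n + size I <= N)%N ->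
  act (a * b) n I x = \sum_(k < n.+1) cross a b k (n - k) I x.
Proof.
move=> aD bD a0 b0 nIN; rewrite /act.
rewrite (eq_big_seq (fun K => conv (coef a) (coef b) K *: f (K ++ I) x)); last first.
  move=> K; rewrite mem_words => /eqP Kn; rewrite coef_mul//.
  by rewrite Kn; apply: leq_trans nIN; exact: leq_addr.
rewrite (sum_conv_words n (coef a) (coef b) (fun K => f (K ++ I) x)).
apply: eq_bigr => k _; rewrite /cross.
have kn : (k <= n)%N by rewrite -ltnS.
case: (posnP k) => [k0|kpos].
  rewrite k0 /= big_seq1 big1// => K _; by rewrite a0 mul0r scale0r.
case: (posnP (n - k)%N) => [nk|nkpos] /=.
  by rewrite nk /= big1// => K _; rewrite big_seq1 b0 mulr0 scale0r.
have nkI : (n - k + size I <= N)%N by lia.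
(* Differentiate the identity D(f_I)(b) = b f_I in the direction of a. *)
pose v := act a k [::] x.
have [bd bE] := act_diff b x nkI.
have [bd0 _] : differentiable (act b (n - k) [::]) x /\ _ :=
  act_diff b x (I := [::]) (n := (n - k)%N) (ltac:(rewrite /=; lia)).
have H1 : 'd (act b (n - k) I) x v = 'd (fun z => 'd (f I) z (act b (n - k) [::] x)) x v
    + 'd (f I) x ('d (act b (n - k) [::]) x v).
  have C : class_C 2 (f I) by apply: fC; lia.
  have [_ <-] := is_derive_act v C bd0.
  have -> : (fun z => 'd (f I) z (act b (n - k) [::] z)) = act b (n - k) I.
    by apply/funext => z; apply: bD.
  by rewrite deriveE.
rewrite -/v -H1 bE exchange_big /=.
apply: eq_big_seq => B; rewrite mem_words => /eqP Bm.
rewrite /v (aD k (B ++ I) x kpos); last by rewrite size_cat Bm; lia.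
rewrite scaler_sumr; apply: eq_bigr => K _.
by rewrite scalerA mulrC catA.
Qed.

(** The part of degree n of the commutator of the vector fields of [a] and [b]. *)
Definition bracket_field (a b : A) (n : nat) (x : E) : E :=
  \sum_(k < n.+1) (if (0 < k)%N && (0 < n - k)%N then
     'd (act b (n - k) [::]) x (act a k [::] x)
     - 'd (act a k [::]) x (act b (n - k) [::] x) else 0).

(** The second order terms cancel by the symmetry of the second derivative. *)
Lemma act_bracket (a b : A) n I x : derivation a -> derivation b ->
  coef a [::] = 0 -> coef b [::] = 0 -> (n + size I <= N)%N ->
  act (br a b) n I x = 'd (f I) x (bracket_field a b n x).
Proof.
move=> aD bD a0 b0 nIN.
have -> : act (br a b) n I x = act (a * b) n I x - act (b * a) n I x.
  rewrite /act -sumrB; apply: eq_bigr => K _.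
  by rewrite /br coefB scalerBl.
rewrite !act_mul// [X in _ - X](reindex_inj rev_ord_inj) /= -sumrB.
rewrite /bracket_field diff_sum; apply: eq_bigr => k _.
have kn : (k <= n)%N by rewrite -ltnS.
rewrite subSS subKn// /cross [(0 < n - k)%N && _]andbC.
case: ifP => [_|_]; last by rewrite subrr diff_at0.
have C : class_C 2 (f I) by apply: fC; lia.
have cancel (Y P Q : E) : Y + P - (Y + Q) = P - Q by rewrite opprD addrACA subrr add0r.
rewrite [X in X + _ - _](schwarz x (act b (n - k) [::] x) (act a k [::] x) C).
by apply: etrans (cancel _ _ _) _; exact: esym (diff_sub _ _ _ _).
Qed.

Lemma derivation_br (a b : A) : derivation a -> derivation b ->
  coef a [::] = 0 -> coef b [::] = 0 -> derivation (br a b).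
Proof.
move=> aD bD a0 b0 n I x n0 nIN.
rewrite [RHS](act_bracket x aD bD a0 b0 nIN).
apply: (congr1 (fun w => 'd (f I) x w)).
rewrite (act_bracket x aD bD a0 b0); last by rewrite addn0; lia.
by have [_ ->] : is_diff (x : E) (@id E) id := is_diff_id x.
Qed.

Lemma diff_idE (x v : E) : 'd (@id E) x v = v.
Proof. by have [_ ->] : is_diff (x : E) (@id E) id := is_diff_id x. Qed.

Lemma act_gen i n J x :
  act (tens_gen R N i) n J x = if n == 1%N then f (i :: J) x else 0.
Proof.
rewrite /act (eq_big_seq (fun K => (K == [:: i])%:R *: f (K ++ J) x)); last first.
  by move=> K _; rewrite coef_gen.
case: eqP => [->|n1]; last first.
  rewrite big1_seq// => K; rewrite mem_words => /= /eqP Kn.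
  by case: eqP => [Ki|_]; rewrite ?scale0r//; case: n1; rewrite -Kn Ki.
rewrite (bigD1_seq [:: i]) ?uniq_words ?mem_words//= eqxx scale1r big1 ?addr0//.
by move=> K /negPf ->; rewrite scale0r.
Qed.

Lemma derivation_gen i : derivation (tens_gen R N i).
Proof.
move=> n I x n0 nIN; rewrite !act_gen; case: eqP => _; last exact: diff_at0.
transitivity ('d (f I) x (V i x)) => //.
exact: (congr1 (fun w => 'd (f I) x w) (diff_idE x (V i x))).
Qed.

(** First order operators are stable under brackets. *)
Lemma lie_derivation (a : A) : free_nilpotent_lie a -> derivation a.
Proof.
elim=> [i||c a' b _ aD _ bD|a' b aL aD bL bD].
- exact: derivation_gen.
- by move=> n I x _ _; rewrite !act0 diff_at0.
- have lin n I x : act (c *: a' + b) n I x = c *: act a' n I x + act b n I x.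
    rewrite /act scaler_sumr -big_split; apply: eq_bigr => K _ /=.
    by rewrite coefD coefZ scalerDl scalerA.
  move=> n I x n0 nIN; rewrite !lin diff_add diff_scale aD// bD//.
- have [a0 _ _] := lie_dynkin N0 aL; have [b0 _ _] := lie_dynkin N0 bL.
  exact: derivation_br aD bD a0 b0.
Qed.

Lemma lie_bracket_tensor (w : word) : free_nilpotent_lie (bracket_tensor R N w).
Proof.
elim: w => [|i [|j w] IH]; first exact: fnl_zero.
  exact: fnl_gen.
exact: fnl_bracket (fnl_gen _ _ _) IH.
Qed.

(** The vector field V_[K] is the action of e_[K] on the identity, so it only
    involves the functions f_J with |J| = |K|. *)
Lemma bracket_wordE (K : word) : (0 < size K)%N -> (size K <= N)%N ->
  vf_bracket_word V K = act (bracket_tensor R N K) (size K) [::].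
Proof.
elim: K => [//|i [_ _ _|j K IH _ KN]].
  by apply/funext => x; rewrite act_gen eqxx; exact: esym (diff_idE x (V i x)).
have IH' := IH isT (ltnW KN).
have eD := derivation_gen i; have tD := lie_derivation (lie_bracket_tensor (j :: K)).
have [t0 _ _] := lie_dynkin N0 (lie_bracket_tensor (j :: K)).
have e0 : coef (tens_gen R N i) [::] = 0 by rewrite coef_gen.
have Vi : V i = act (tens_gen R N i) 1 [::].
  by apply/funext => x; rewrite act_gen eqxx; exact: esym (diff_idE x (V i x)).
have Vn k : k != 1%N -> act (tens_gen R N i) k [::] = cst 0.
  by move=> k1; apply/funext => x; rewrite act_gen (negPf k1).
set t := bracket_tensor R N (j :: K) in IH' tD t0 *.
apply/funext => x.
transitivity (bracket_field (tens_gen R N i) t (size (i :: j :: K)) x); last first.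
  have := @act_bracket (tens_gen R N i) t (size (i :: j :: K)) [::] x eD tD e0 t0.
  by rewrite addn0 => /(_ KN) ->; exact: esym (diff_idE _ _).
transitivity ('d (act t (size K).+1 [::]) x (act (tens_gen R N i) 1 [::] x)
     - 'd (act (tens_gen R N i) 1 [::]) x (act t (size K).+1 [::] x)).
  rewrite -Vi; have -> : act t (size K).+1 [::] = vf_bracket_word V (j :: K) by rewrite IH'.
  by [].
have k1 : (1 < (size (i :: j :: K)).+1)%N by [].
rewrite /bracket_field (bigD1 (Ordinal k1)) //= subSS subn0 big1 ?addr0// => k kk.
have k1' : (k : nat) != 1%N by rewrite -val_eqE in kk.
case: ifP => // _; rewrite (Vn k k1').
have cst0 (v : E) : 'd (cst (0 : E) : E -> E) x v = 0 by rewrite diff_cst.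
exact: etrans (congr2 (fun a b => a - b) (diff_at0 _ _) (cst0 _)) (subrr 0).
Qed.

End LieAction.

(** * Homogeneous bounds and curve estimates *)
Section WordSums.
Variables (ell N : nat).
Local Notation word := (seq 'I_ell).

Definition allwords : seq word := flatten [seq words ell n | n <- index_iota 1 N.+1].

Lemma mem_allwords w : (w \in allwords) = (0 < size w <= N)%N.
Proof.
apply/flatten_mapP/idP => [[n]|wN].
  by rewrite mem_index_iota mem_words ltnS => nN /eqP ->.
by exists (size w); rewrite ?mem_index_iota ?mem_words.
Qed.

Lemma big_allwords (V : nmodType) (P : pred nat) (F : word -> V) :
  \sum_(w <- allwords | P (size w)) F w =
  \sum_(1 <= n < N.+1 | P n) \sum_(w <- words ell n) F w.
Proof.
rewrite /allwords big_flatten big_map [RHS]big_mkcond; apply: eq_bigr => n _.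
rewrite big_mkcond (eq_big_seq (fun w => if P n then F w else 0)); last first.
  by move=> w; rewrite mem_words => /eqP ->.
by case: ifP => // _; rewrite big1.
Qed.

End WordSums.

Section Homogeneous.
Variables (R : realType) (ell N : nat).
Local Notation word := (seq 'I_ell).
Local Notation A := (talg R ell N).

(** With q = |t - s|^(1/p), this is the Hoelder condition on a rough path: the
    component of degree k has size q^k. *)
Definition homog_bound (C q : R) (a : A) := forall w, `|coef a w| <= C * q ^+ size w.

Lemma homog_bound_mul C C' q (a b : A) : 0 <= C -> 0 <= C' -> 0 <= q ->
  homog_bound C q a -> homog_bound C' q b -> homog_bound (N.+1%:R * (C * C')) q (a * b).
Proof.
move=> C0 C'0 q0 aC bC w; case: (leqP (size w) N) => wN; last first.
  by rewrite coefN// normr0 !mulr_ge0// exprn_ge0.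
rewrite coef_mul// convE; apply: le_trans (ler_norm_sum _ _ _) _.
apply: (@le_trans _ _ (\sum_(k < (size w).+1) (C * C') * q ^+ size w)).
  apply: ler_sum => k _; rewrite normrM.
  have {3}-> : size w = (size (take k w) + size (drop k w))%N.
    by rewrite -size_cat cat_take_drop.
  by rewrite exprD mulrACA ler_pM.
rewrite sumr_const card_ord -[X in X <= _]mulr_natl mulrA ler_wpM2r ?exprn_ge0//.
by rewrite ler_wpM2r ?mulr_ge0// ler_nat.
Qed.

Lemma homog_bound_le C C' q (a : A) : C <= C' -> 0 <= q -> homog_bound C q a -> homog_bound C' q a.
Proof.
move=> CC q0 aC w; apply: le_trans (aC w) _.
by rewrite ler_wpM2r// exprn_ge0.
Qed.

Lemma homog_bound_one q : 0 <= q -> homog_bound 1 q 1.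
Proof.
move=> q0 w; rewrite coef_one; case: w => [|i w] /=; first by rewrite expr0 normr1 mulr1.
by rewrite normr0 mul1r exprn_ge0.
Qed.

Lemma homog_bound_sub C C' q (a b : A) : homog_bound C q a -> homog_bound C' q b ->
  homog_bound (C + C') q (a - b).
Proof.
move=> aC bC w; rewrite coefB mulrDl; apply: le_trans (ler_normB _ _) _.
exact: lerD.
Qed.

(** The constant does not depend on [q]: products are homogeneous. *)
Lemma homog_bound_log C : 0 <= C -> exists2 C', 0 <= C' &
  forall q (a : tens R ell N), 0 <= q -> homog_bound C q a -> homog_bound C' q (tens_log a).
Proof.
move=> C0.
pose D k : R := (N.+1%:R * (C + 1)) ^+ k.
have D0 k : 0 <= D k by rewrite exprn_ge0// mulr_ge0// addr_ge0.
have Dpow k q (a : A) : 0 <= q -> homog_bound C q a -> homog_bound (D k) q ((a - 1) ^+ k).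
  move=> q0 aC; elim: k => [|k IH]; first by rewrite /D !expr0; exact: homog_bound_one.
  have := homog_bound_mul (addr_ge0 C0 ler01) (D0 k) q0 (homog_bound_sub aC (homog_bound_one q0)) IH.
  by rewrite exprS /D exprS mulrA.
exists (\sum_(1 <= k < N.+1) `|(-1) ^+ k.+1 / k%:R| * D k).
  by rewrite sumr_ge0// => k _; rewrite mulr_ge0.
move=> q a q0 aC w; rewrite /tens_log coef_sum.
apply: le_trans (ler_norm_sum _ _ _) _; rewrite mulr_suml.
apply: ler_sum => k _; rewrite coefZ normrM -mulrA ler_wpM2l//.
by have := Dpow k q a q0 aC w; rewrite -tens_powE.
Qed.

End Homogeneous.

Section CurveEstimates.
Variables (R : realType) (d : nat).
Local Notation E := 'rV[R]_d.

Lemma is_derive_scale_curve (a : R -> R) (da r : R) (v : E) :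
  is_derive r 1 a da -> is_derive r 1 (fun s => a s *: v) (da *: v).
Proof.
move=> ad.
have cd j : is_derive r 1 (fun s => (a s *: v) ord0 j) ((da *: v) ord0 j).
  have -> : (fun s => (a s *: v) ord0 j) = a * cst (v ord0 j).
    by apply/funext => s; rewrite mxE.
  apply: is_derive_eq (@is_deriveM _ _ _ _ _ _ _ _ ad (is_derive_cst (v ord0 j) r 1)) _.
  by rewrite /= scaler0 add0r mxE /GRing.scale /= mulrC.
have Fd : derivable (fun s => a s *: v) r 1.
  by apply/derivable_mxP => i j; rewrite ord1; case: (cd j).
apply: DeriveDef => //; rewrite derive_mx//; apply/rowP => j; rewrite mxE.
by case: (cd j).
Qed.

(** With L <= 1 / 2 the maximum S of |u - u 0| satisfies S <= L (a + S), which
    replaces the exponential of Gronwall's lemma. *)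
Lemma small_gronwall (u du : R -> E) (L a : R) : 0 <= L -> L <= 1 / 2 -> 0 <= a ->
  {within `[0, 1], continuous u} ->
  (forall r : R, 0 < r -> r < 1 -> is_derive r 1 u (du r)) ->
  (forall r, 0 < r -> r < 1 -> `|du r| <= L * (a + `|u r - u 0|)) ->
  forall r, 0 <= r -> r <= 1 -> `|u r - u 0| <= 2 * L * a.
Proof.
move=> L0 L1 a0 uc ud uL.
have [|m m01 mM] := @EVT_max R (fun r => `|u r - u 0|) 0 1 ler01.
  move=> r; apply: (@continuous_comp (subspace _) E R (fun r => u r - u 0) (fun v : E => `|v|)).
    by apply: continuousB; [exact: uc|exact: cst_continuous].
  exact: norm_continuous.
set S := `|u m - u 0| in mM; have S0 : 0 <= S := normr_ge0 _.
have bnd r : 0 <= r -> r <= 1 -> `|u r - u 0| <= L * (a + S).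
  move=> r0 r1; have LaS : 0 <= L * (a + S) by rewrite mulr_ge0// addr_ge0.
  apply: le_trans (mean_value_ineq (dy := du) (M := L * (a + S)) r0 _ _ _) _.
  - apply: continuous_subspaceW uc => s /=; rewrite !in_itv /= => /andP[-> sr].
    exact: le_trans sr r1.
  - by move=> s s0 sr; apply: ud => //; exact: lt_le_trans r1.
  - move=> s s0 sr; have s1 := lt_le_trans sr r1; apply: le_trans (uL s s0 s1) _.
    by rewrite ler_wpM2l// lerD2l mM// in_itv /= (ltW s0) ltW.
  by rewrite subr0 ler_piMr.
move: m01; rewrite in_itv /= => /andP[m0 m1].
have := bnd m m0 m1; rewrite -/S => SL.
have LS : L * S <= 1 / 2 * S by rewrite ler_wpM2r.
move=> r r0 r1; apply: le_trans (bnd r r0 r1) _.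
have LL : L * (L * a) <= 1 / 2 * (L * a) by rewrite ler_wpM2r// mulr_ge0.
have LLS : L * (L * S) <= 1 / 2 * (L * S) by rewrite ler_wpM2r// mulr_ge0.
have LSL : L * S <= L * (L * (a + S)) by rewrite ler_wpM2l.
by clear -LL LLS LSL; lra.
Qed.

End CurveEstimates.

(** * Taylor expansion of the log-ODE *)

(** Descending induction on the length of I: the derivative of Y_I only involves
    longer words, each further letter being paid by a factor q of its coefficient,
    and no word at all when |I| = N. *)
Lemma triangular_bound (R : realType) (d ell N : nat) (C B q : R)
    (lam : seq 'I_ell -> R) (Y D : seq 'I_ell -> R -> 'rV[R]_d) :
  0 <= C -> 0 <= B -> 0 <= q ->
  (forall K, `|lam K| <= C * q ^+ size K) ->
  (forall I, (size I <= N)%N ->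
    [/\ Y I 0 = 0, {within `[0, 1], continuous (Y I)},
        forall r : R, 0 < r -> r < 1 -> is_derive r 1 (Y I)
          (\sum_(K <- allwords ell N | (size K + size I <= N)%N) lam K *: Y (K ++ I) r
             + D I r)
      & forall r, 0 < r -> r < 1 -> `|D I r| <= B * q ^+ (N.+1 - size I)]) ->
  forall I r, (size I <= N)%N -> 0 <= r -> r <= 1 ->
    `|Y I r| <= (1 + (size (allwords ell N))%:R * C) ^+ N * B * q ^+ (N.+1 - size I).
Proof.
move=> C0 B0 q0 lamC H; set c := (size _)%:R * C.
have c0 : 0 <= c by rewrite mulr_ge0.
suff main m I r : (size I <= N)%N -> (N <= size I + m)%N -> 0 <= r -> r <= 1 ->
    `|Y I r| <= (1 + c) ^+ m * B * q ^+ (N.+1 - size I).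
  by move=> I r IN; apply: main => //; rewrite leq_addl.
elim: m I r => [|m IH] I r IN NI r0 r1; have [Y0 Yc Yd DB] := H I IN;
  set e := q ^+ (N.+1 - size I); have e0 : 0 <= e by rewrite exprn_ge0.
all: have Yc' : {within `[0, r], continuous (Y I)}
  by apply: continuous_subspaceW Yc => s /=; rewrite !in_itv /= => /andP[-> sr];
     exact: le_trans sr r1.
all: have Yd' s (s0 : 0 < s) (sr : s < r) := Yd s s0 (lt_le_trans sr r1).
  rewrite -[Y I r]subr0 -Y0.
  apply: le_trans (mean_value_ineq (M := B * e) r0 Yc' Yd' _) _.
    move=> s s0 sr; rewrite big1_seq ?add0r => [|K]; first exact: DB (lt_le_trans sr r1).
    rewrite mem_allwords => /andP[KI /andP[K0 _]]; exfalso.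
    by move: (leq_trans KI NI); rewrite addn0 -[leqRHS]add0n leq_add2r leqNgt K0.
  by rewrite subr0 expr0 mul1r ler_piMr// mulr_ge0.
rewrite -[Y I r]subr0 -Y0.
apply: le_trans (mean_value_ineq (M := (1 + c) ^+ m.+1 * B * e) r0 Yc' Yd' _) _.
  move=> s s0 sr; have s1 := lt_le_trans sr r1.
  apply: le_trans (ler_normD _ _) _.
  apply: le_trans (lerD (ler_norm_sum _ _ _) (DB s s0 s1)) _.
  have S1 : \sum_(K <- allwords ell N | (size K + size I <= N)%N) `|lam K *: Y (K ++ I) s|
      <= \sum_(K <- allwords ell N) C * ((1 + c) ^+ m * B * e).
    rewrite big_mkcond big_seq [leRHS]big_seq; apply: ler_sum => K.
    rewrite mem_allwords => /andP[K0 KN].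
    case: ifP => KI; last by rewrite !mulr_ge0// exprn_ge0// addr_ge0.
    have KI' : (size (K ++ I) <= N)%N by rewrite size_cat.
    rewrite normrZ.
    apply: le_trans (ler_pM (normr_ge0 _) (normr_ge0 _) (lamC K) (IH (K ++ I) s KI' _ (ltW s0) (ltW s1))) _.
      by rewrite size_cat -addnA (leq_trans NI)// addnS -add1n leq_add2r.
    rewrite le_eqVlt; apply/orP; left; apply/eqP; rewrite /e.
    have -> : (N.+1 - size I = size K + (N.+1 - size (K ++ I)))%N.
      have gen k i : (k + i <= N)%N -> (N.+1 - i = k + (N.+1 - (k + i)))%N by clear; lia.
      by rewrite size_cat; exact: gen.
    by rewrite exprD; ring.
  apply: le_trans (lerD S1 (lexx _)) _.
  rewrite big_const_seq count_predT iter_addr_0 -mulr_natl mulrA -/c exprS -/e.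
  have m1 : 1 <= (1 + c) ^+ m by rewrite exprn_ege1// lerDl.
  have m2 : 1 * (B * e) <= (1 + c) ^+ m * (B * e) by rewrite ler_wpM2r// mulr_ge0.
  by move: ((1 + c) ^+ m) m2 => x; clear; lra.
rewrite subr0 ler_piMr// !mulr_ge0// exprn_ge0// addr_ge0//.
Qed.

(** Acting by a product truncated at total length N is acting by the factors
    successively, with the same truncation. *)
Lemma act_mul_sum (R : realType) (d ell N : nat) (V : 'I_ell -> 'rV[R]_d -> 'rV[R]_d)
    (a b : talg R ell N) (I : seq 'I_ell) (x : 'rV[R]_d) : (size I <= N)%N ->
  \sum_(n < (N - size I).+1) act V (a * b) n I x =
  \sum_(n < (N - size I).+1) \sum_(v <- words ell n)
     coef b v *: \sum_(m < (N - size (v ++ I)).+1) act V a m (v ++ I) x.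
Proof.
move=> IN.
pose S j m := \sum_(u <- words ell j) \sum_(v <- words ell m)
  (coef a u * coef b v) *: vf_word V (u ++ v ++ I) x.
have E1 (n : 'I_(N - size I).+1) : act V (a * b) n I x = \sum_(j < n.+1) S (n - j)%N j.
  rewrite /act (eq_big_seq (fun K => conv (coef a) (coef b) K *: vf_word V (K ++ I) x)).
    rewrite (sum_conv_words n (coef a) (coef b) (fun K => vf_word V (K ++ I) x)).
    rewrite [LHS](reindex_inj rev_ord_inj) /=.
    apply: eq_bigr => j _; have jn : (j <= n)%N by rewrite -ltnS.
    rewrite /S subSS (subKn jn); apply: eq_bigr => u _; apply: eq_bigr => v _.
    by rewrite -(catA u v I).
  move=> K; rewrite mem_words => /eqP Kn; rewrite coef_mul// Kn.
  by have := ltn_ord n; lia.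
rewrite (eq_bigr _ (fun n _ => E1 n)) (sum_triangle (N - size I) (fun k m => S m k)).
apply: eq_bigr => n _.
transitivity (\sum_(m < (N - size I).+1 - n) \sum_(v <- words ell n)
    coef b v *: act V a m (v ++ I) x).
  apply: eq_bigr => m _; rewrite /S [LHS]exchange_big; apply: eq_bigr => v _.
  by rewrite /act scaler_sumr; apply: eq_bigr => u _; rewrite scalerA mulrC.
rewrite exchange_big; apply: eq_big_seq => v; rewrite mem_words => /eqP vn.
rewrite -scaler_sumr; congr (_ *: _).
have -> : (N - size (v ++ I)).+1 = ((N - size I).+1 - n)%N; last by [].
have gen j i : (j < (N - i).+1)%N -> ((N - (j + i)).+1 = (N - i).+1 - j)%N by clear; lia.
by rewrite size_cat vn; exact: gen (ltn_ord n).
Qed.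

Section Taylor.
Variables (R : realType) (d ell N : nat).
Local Notation E := 'rV[R]_d.
Local Notation A := (talg R ell N).
Local Notation word := (seq 'I_ell).
Hypothesis N0 : (0 < N)%N.
Variable V : 'I_ell -> E -> E.
Local Notation f := (vf_word V).
Hypothesis fC : forall J : word, (size J <= N)%N -> class_C 2 (f J).
Variable Lam : A.
Hypothesis lieLam : free_nilpotent_lie Lam.

Let Lam0 : coef Lam [::] = 0.
Proof. by have [] := lie_dynkin N0 lieLam. Qed.

Let dLam : derivation V Lam.
Proof. exact: lie_derivation. Qed.

(** In the equation y' = [log_field] y, the derivative of f_I(y) is the sum of the
    Lambda_K f_{KI}(y), as far as KI has length at most N, plus the remainder. *)
Definition log_field (x : E) : E := \sum_(J <- allwords ell N) coef Lam J *: f J x.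

Definition remainder_field (I : word) (x : E) : E :=
  \sum_(K <- allwords ell N | ~~ (size K + size I <= N)%N) coef Lam K *: 'd (f I) x (f K x).

(** The first order operators of degree n of the Lie element [Lam] send f_I to a
    combination of the f_{KI}, |K| = n, for n + |I| <= N. *)
Lemma diff_log_field I x : (size I <= N)%N ->
  'd (f I) x (log_field x) =
  \sum_(K <- allwords ell N | (size K + size I <= N)%N) coef Lam K *: f (K ++ I) x
    + remainder_field I x.
Proof.
move=> IN; rewrite /log_field diff_sum (bigID (fun K => (size K + size I <= N)%N)) /=.
congr (_ + _); last by apply: eq_bigr => K _; exact: diff_scale.
rewrite (big_allwords N (fun n => (n + size I <= N)%N) (fun K => 'd (f I) x (coef Lam K *: f K x))).
rewrite (big_allwords N (fun n => (n + size I <= N)%N) (fun K => coef Lam K *: f (K ++ I) x)).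
rewrite big_nat_cond [RHS]big_nat_cond; apply: eq_bigr => n /andP[/andP[n1 _] nI].
rewrite -[RHS](dLam x n1 nI) /act -diff_sum; congr ('d (f I) x _).
by apply: eq_bigr => K _; rewrite cats0.
Qed.

(** [Lam] acting k times on f_I, keeping words of total length at most N. *)
Definition iter_act (k : nat) (I : word) (x : E) : E :=
  \sum_(n < (N - size I).+1) act V (Lam ^+ k) n I x.

Lemma iter_act0 I x : iter_act 0 I x = f I x.
Proof.
rewrite /iter_act big_ord_recl /= big1 ?addr0 => [|n _].
  by rewrite /act big_seq1 coef_one /= scale1r.
rewrite /act big1_seq// => K; rewrite mem_words => /andP[_ /eqP Kn].
by rewrite coef_one /nilp Kn scale0r.
Qed.

Lemma iter_act_nil I x : iter_act N.+1 I x = 0.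
Proof.
rewrite /iter_act big1// => n _; rewrite tens_nilpotent//; exact: act0.
Qed.

Lemma iter_actS k I x : (size I <= N)%N ->
  iter_act k.+1 I x =
  \sum_(K <- allwords ell N | (size K + size I <= N)%N) coef Lam K *: iter_act k (K ++ I) x.
Proof.
move=> IN; rewrite /iter_act exprSr act_mul_sum// big_ord_recl /= big_seq1 Lam0 scale0r add0r.
rewrite (big_allwords N (fun n => (n + size I <= N)%N)
   (fun K => coef Lam K *: \sum_(n < (N - size (K ++ I)).+1) act V (Lam ^+ k) n (K ++ I) x)).
have -> : \sum_(1 <= n < N.+1 | (n + size I <= N)%N) \sum_(K <- words ell n)
     coef Lam K *: \sum_(n < (N - size (K ++ I)).+1) act V (Lam ^+ k) n (K ++ I) x
  = \sum_(1 <= n < (N - size I).+1) \sum_(K <- words ell n)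
     coef Lam K *: \sum_(n < (N - size (K ++ I)).+1) act V (Lam ^+ k) n (K ++ I) x.
  rewrite [RHS](big_nat_widen _ _ N.+1); last by rewrite ltnS leq_subr.
  by apply: eq_bigl => n; rewrite ltnS leq_subRL// addnC.
by rewrite big_add1 big_mkord; apply: eq_bigr.
Qed.

(** The action of exp (r Lam) on f_I.  It solves the linear system satisfied by
    the f_I(y_r) without its remainder ([is_derive_taylor]). *)
Definition taylor (I : word) (x : E) (r : R) : E :=
  \sum_(k < N.+1) ((k`!%:R)^-1 * r ^+ k) *: iter_act k I x.

Lemma taylor0 I x : taylor I x 0 = f I x.
Proof.
rewrite /taylor big_ord_recl /= expr0 fact0 invr1 mulr1 scale1r iter_act0.
by rewrite big1 ?addr0// => k _; rewrite exprS mul0r mulr0 scale0r.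
Qed.

Lemma taylor1 I x : taylor I x 1 =
  \sum_(n < (N - size I).+1) act V (tens_exp Lam) n I x.
Proof.
rewrite /taylor /iter_act.
under eq_bigr => k _ do rewrite expr1n mulr1 scaler_sumr.
rewrite exchange_big; apply: eq_bigr => n _; rewrite /act.
under eq_bigr => k _ do rewrite scaler_sumr.
rewrite exchange_big; apply: eq_bigr => K _ /=.
rewrite /tens_exp coef_sum scaler_suml big_mkord; apply: eq_bigr => k _.
by rewrite coefZ -tens_powE scalerA.
Qed.

Lemma taylor_rec I x r : (size I <= N)%N ->
  \sum_(k < N) ((k`!%:R)^-1 * r ^+ k) *: iter_act k.+1 I x =
  \sum_(K <- allwords ell N | (size K + size I <= N)%N) coef Lam K *: taylor (K ++ I) x r.
Proof.
move=> IN; rewrite /taylor.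
transitivity (\sum_(k < N.+1) ((k`!%:R)^-1 * r ^+ k) *: iter_act k.+1 I x).
  by rewrite big_ord_recr /= iter_act_nil scaler0 addr0.
under eq_bigr => k _ do rewrite (iter_actS k x IN) scaler_sumr.
rewrite exchange_big; apply: eq_bigr => K _ /=.
rewrite scaler_sumr; apply: eq_bigr => k _.
by rewrite !scalerA mulrC.
Qed.

Lemma is_derive_taylor I x (r : R) : (size I <= N)%N ->
  is_derive r 1 (taylor I x)
   (\sum_(K <- allwords ell N | (size K + size I <= N)%N) coef Lam K *: taylor (K ++ I) x r).
Proof.
move=> IN; rewrite -taylor_rec//.
have -> : taylor I x = \sum_(k < N.+1) (fun r : R => ((k`!%:R)^-1 * r ^+ k) *: iter_act k I x).
  by apply/funext => s; rewrite /taylor fct_sumE.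
have der (k : 'I_N.+1) : is_derive r 1 (fun r : R => ((k`!%:R)^-1 * r ^+ k) *: iter_act k I x)
    (((k`!%:R)^-1 * (k%:R * r ^+ k.-1)) *: iter_act k I x).
  apply: is_derive_scale_curve.
  have H : is_derive r 1 (fun s : R => s ^+ k) (k%:R * r ^+ k.-1).
    apply: DeriveDef; first exact: exprn_derivable.
    by rewrite exp_derive /GRing.scale /= mulr1.
  exact: (@is_deriveZ _ _ _ _ ((k`!%:R)^-1) _ _ _ H).
apply: is_derive_eq (is_derive_sum der) _.
rewrite big_ord_recl /= mul0r mulr0 scale0r add0r.
apply: eq_bigr => k _; congr (_ *: _).
rewrite /bump /= add1n /= mulrA; congr (_ * _).
by rewrite factS natrM invfM mulrAC mulVf ?mul1r// pnatr_eq0.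
Qed.

End Taylor.

Lemma within_continuousB (R : realType) (d : nat) (u w : R -> 'rV[R]_d) (D : set R) :
  {within D, continuous u} -> {within D, continuous w} ->
  {within D, continuous (fun r => u r - w r)}.
Proof. by move=> uc wc r; apply: continuousB; [exact: uc|exact: wc]. Qed.

(** * Estimates along the log-ODE *)
Section LogODE.
Variables (R : realType) (d ell N : nat).
Local Notation E := 'rV[R]_d.
Local Notation A := (talg R ell N).
Local Notation word := (seq 'I_ell).
Local Notation cnt := ((size (allwords ell N))%:R : R).
Hypothesis N0 : (0 < N)%N.
Variable V : 'I_ell -> E -> E.
Local Notation f := (vf_word V).
Variable M : R.
Hypothesis M0 : 0 <= M.
Hypothesis fC : forall J : word, (size J <= N)%N -> class_C 2 (f J).
Hypothesis fM : forall J : word, (0 < size J <= N)%N ->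
  [/\ four_point_lip M (f J), `|f J 0| <= M, forall x v, `|'d (f J) x v| <= M * `|v|
    & forall x z v, `|'d (f J) x v - 'd (f J) z v| <= M * `|x - z| * `|v|].

Lemma word_growth J x : (0 < size J <= N)%N -> `|f J x| <= M * (1 + `|x|).
Proof. by move=> /fM[f4 f0 _ _]; exact: lip_growth. Qed.

Lemma log_field_four_point_lip (Lam : A) :
  four_point_lip (\sum_(J <- allwords ell N) `|coef Lam J| * M) (log_field V Lam).
Proof.
by apply: four_point_lip_lincomb => J; rewrite mem_allwords => /fM[].
Qed.

Variables (C q : R) (Lam : A).
Hypotheses (C0 : 0 <= C) (q0 : 0 <= q) (q1 : q <= 1).
Hypothesis lieLam : free_nilpotent_lie Lam.
Hypothesis LamC : homog_bound C q Lam.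

Let L := cnt * C * M * q.

Let L0 : 0 <= L. Proof. by rewrite !mulr_ge0. Qed.

Lemma pow_q_le (m n : nat) : (m <= n)%N -> q ^+ n <= q ^+ m.
Proof. by move=> mn; apply: ler_wiXn2l. Qed.

Lemma sum_coef_le : \sum_(J <- allwords ell N) `|coef Lam J| * M <= L.
Proof.
apply: (@le_trans _ _ (\sum_(J <- allwords ell N) C * q * M)).
  rewrite big_seq [leRHS]big_seq; apply: ler_sum => J; rewrite mem_allwords => /andP[J0 _].
  rewrite ler_wpM2r//; apply: le_trans (LamC J) _; rewrite ler_wpM2l//.
  by rewrite -[leRHS]expr1; exact: pow_q_le.
by rewrite big_const_seq count_predT iter_addr_0 -mulr_natl /L le_eqVlt;
  apply/orP; left; apply/eqP; ring.
Qed.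

Let W4 : four_point_lip L (log_field V Lam).
Proof. exact: four_point_lip_le sum_coef_le (log_field_four_point_lip Lam). Qed.

Let W0 : `|log_field V Lam 0| <= L.
Proof.
apply: le_trans sum_coef_le; apply: le_trans (ler_norm_sum _ _ _) _.
rewrite big_seq [leRHS]big_seq; apply: ler_sum => J; rewrite mem_allwords => JN.
by rewrite normrZ ler_wpM2l//; have [] := fM JN.
Qed.

Hypothesis L1 : L <= 1 / 2.

(** The vector field of the log-ODE has Lipschitz constant and size at the
    origin at most L = O(q), so its flow at times up to 1 is O(q)-close to Id. *)
Lemma flow_growth y x : ode_solution01 (log_field V Lam) x y ->
  forall r, 0 <= r -> r <= 1 -> `|y r - x| <= 2 * L * (1 + `|x|).
Proof.
move=> [yx yc yd] r r0 r1; rewrite -{1}yx.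
have a0 : 0 <= 1 + `|x| by rewrite addr_ge0.
apply: (small_gronwall (du := log_field V Lam \o y) L0 L1 a0 yc yd) => //.
move=> s s0 s1 /=; apply: le_trans (lip_growth _ L0 W4 W0) _.
rewrite ler_wpM2l// -addrA lerD2l yx -{1}(subrK x (y s)) addrC.
by apply: le_trans (ler_normD _ _) _; rewrite addrC.
Qed.

Lemma flow_lip y z x x' : ode_solution01 (log_field V Lam) x y ->
  ode_solution01 (log_field V Lam) x' z ->
  forall r, 0 <= r -> r <= 1 -> `|(y r - z r) - (x - x')| <= 2 * L * `|x - x'|.
Proof.
move=> [yx yc yd] [zx zc zd] r r0 r1.
have := @small_gronwall _ _ (fun s => y s - z s)
  (fun s => log_field V Lam (y s) - log_field V Lam (z s)) L `|x - x'| L0 L1 (normr_ge0 _).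
rewrite /= yx zx; apply => //.
- by move=> s; apply: continuousB; [exact: yc|exact: zc].
- by move=> s s0 s1; apply: is_deriveB; [exact: yd|exact: zd].
- move=> s s0 s1; apply: le_trans (W4.1 _ _) _; rewrite ler_wpM2l//.
  by rewrite -{1}(subrK (x - x') (y s - z s)) addrC; apply: ler_normD.
Qed.

Lemma flow_size y x : ode_solution01 (log_field V Lam) x y ->
  forall r, 0 <= r -> r <= 1 -> 1 + `|y r| <= 2 * (1 + `|x|).
Proof.
move=> ys r r0 r1; have H := flow_growth ys r0 r1.
have H1 : `|y r| <= `|y r - x| + `|x| by rewrite -{1}(subrK x (y r)) ler_normD.
have H2 : (2 * L) * (1 + `|x|) <= 1 * (1 + `|x|).
  by rewrite ler_wpM2r ?addr_ge0//; move: L1; rewrite ler_pdivlMr// mulrC.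
have H3 := le_trans H H2.
move: H1 H3; move: `|y r| `|x| `|y r - x| => a b e; lra.
Qed.

(** Linear growth in x: f_I has bounded derivative and f_K grows linearly.  The
    order in q comes from |K| + |I| > N. *)
Lemma remainder_bound I x : (size I <= N)%N ->
  `|remainder_field V Lam I x| <= cnt * C * M ^+ 2 * (1 + `|x|) * q ^+ (N.+1 - size I).
Proof.
move=> IN; apply: le_trans (ler_norm_sum _ _ _) _; set e := q ^+ _.
have e0 : 0 <= e by rewrite exprn_ge0.
apply: (@le_trans _ _ (\sum_(K <- allwords ell N) C * M ^+ 2 * (1 + `|x|) * e)).
  rewrite big_mkcond big_seq [leRHS]big_seq; apply: ler_sum => K.
  rewrite mem_allwords => /andP[K0 KN].
  case: ifP => KI; last by rewrite !mulr_ge0 ?exprn_ge0 ?addr_ge0.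
  have IN' : (0 < size I <= N)%N.
    rewrite IN andbT lt0n; apply: contraNneq KI => ->; by rewrite addn0.
  have [_ _ dfM _] := fM IN'.
  rewrite normrZ.
  have KIq : q ^+ size K <= e.
    apply: pow_q_le; move: KI; rewrite -ltnNge.
    by have gen i k : (N < k + i)%N -> (N.+1 - i <= k)%N; [lia|exact: gen].
  have B1 : `|coef Lam K| <= C * e by apply: le_trans (LamC K) _; rewrite ler_wpM2l.
  have B2 : `|'d (f I) x (f K x)| <= M * (M * (1 + `|x|)).
    apply: le_trans (dfM _ _) _; rewrite ler_wpM2l//.
    by apply: word_growth; rewrite K0.
  apply: le_trans (ler_pM (normr_ge0 _) (normr_ge0 _) B1 B2) _.
  by rewrite le_eqVlt; apply/orP; left; apply/eqP; ring.
rewrite big_const_seq count_predT iter_addr_0 -mulr_natl.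
by rewrite le_eqVlt; apply/orP; left; apply/eqP; ring.
Qed.

Lemma remainder_lip I x z : (size I <= N)%N ->
  `|remainder_field V Lam I x - remainder_field V Lam I z|
    <= cnt * C * M ^+ 2 * (2 + `|z|) * `|x - z| * q ^+ (N.+1 - size I).
Proof.
move=> IN; set e := q ^+ _; have e0 : 0 <= e by rewrite exprn_ge0.
rewrite /remainder_field -sumrB; apply: le_trans (ler_norm_sum _ _ _) _.
apply: (@le_trans _ _ (\sum_(K <- allwords ell N) C * M ^+ 2 * (2 + `|z|) * `|x - z| * e)).
  rewrite big_mkcond big_seq [leRHS]big_seq; apply: ler_sum => K.
  rewrite mem_allwords => /andP[K0 KN].
  case: ifP => KI; last by rewrite !mulr_ge0 ?exprn_ge0 ?addr_ge0.
  have IN' : (0 < size I <= N)%N.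
    rewrite IN andbT lt0n; apply: contraNneq KI => ->; by rewrite addn0.
  have KN' : (0 < size K <= N)%N by rewrite K0.
  have [_ _ dfM ddfM] := fM IN'; have [[fK _] _ _ _] := fM KN'.
  rewrite -scalerBr normrZ.
  have KIq : q ^+ size K <= e.
    apply: pow_q_le; move: KI; rewrite -ltnNge.
    by have gen i k : (N < k + i)%N -> (N.+1 - i <= k)%N; [lia|exact: gen].
  have B1 : `|coef Lam K| <= C * e by apply: le_trans (LamC K) _; rewrite ler_wpM2l.
  have B2 : `|'d (f I) x (f K x) - 'd (f I) z (f K z)|
     <= M * (M * `|x - z|) + M * `|x - z| * (M * (1 + `|z|)).
    rewrite (diff_split (f I) x z (f K x) (f K z)).
    apply: le_trans (ler_normD _ _) _; apply: lerD.
      by apply: le_trans (dfM _ _) _; rewrite ler_wpM2l.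
    apply: le_trans (ddfM _ _ _) _; rewrite ler_wpM2l ?mulr_ge0//.
    exact: word_growth.
  apply: le_trans (ler_pM (normr_ge0 _) (normr_ge0 _) B1 B2) _.
  by rewrite le_eqVlt; apply/orP; left; apply/eqP; ring.
rewrite big_const_seq count_predT iter_addr_0 -mulr_natl.
by rewrite le_eqVlt; apply/orP; left; apply/eqP; ring.
Qed.

Lemma word_curve_continuous J y x : ode_solution01 (log_field V Lam) x y ->
  (size J <= N)%N -> {within `[0, 1], continuous (fun r => f J (y r))}.
Proof.
move=> [_ yc _] JN r; apply: (@continuous_comp (subspace _) E E y (f J)); first exact: yc.
by apply: differentiable_continuous; case: (fC JN).
Qed.

Lemma taylor_continuous J x (D : set R) : (size J <= N)%N ->
  {within D, continuous (taylor V Lam J x)}.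
Proof.
move=> JN; apply: continuous_subspaceT => r.
apply: differentiable_continuous; apply/derivable1_diffP.
by case: (is_derive_taylor N0 V lieLam x r JN).
Qed.

Lemma taylor_error_continuous J y x : ode_solution01 (log_field V Lam) x y ->
  (size J <= N)%N ->
  {within `[0, 1], continuous (fun r => f J (y r) - taylor V Lam J x r)}.
Proof.
move=> ys JN; apply: (@within_continuousB R d (fun r => f J (y r)) (taylor V Lam J x)).
  exact: word_curve_continuous ys JN.
exact: taylor_continuous.
Qed.

Lemma is_derive_taylor_error I y x (r : R) : ode_solution01 (log_field V Lam) x y ->
  (size I <= N)%N -> 0 < r -> r < 1 ->
  is_derive r 1 (fun r => f I (y r) - taylor V Lam I x r)
    (\sum_(K <- allwords ell N | (size K + size I <= N)%N)
        coef Lam K *: (f (K ++ I) (y r) - taylor V Lam (K ++ I) x r)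
       + remainder_field V Lam I (y r)).
Proof.
move=> [yx yc yd] IN r0 r1.
have [fd _] := fC IN.
have D1 := is_derive_comp_curve (fd (y r)) (yd r r0 r1).
have D2 := is_derive_taylor N0 V lieLam x r IN.
apply: is_derive_eq (is_deriveB D1 D2) _.
rewrite (diff_log_field N0 fC lieLam (y r) IN) addrAC; congr (_ + _).
by rewrite -sumrB; apply: eq_bigr => K _; rewrite scalerBr.
Qed.

Let cE : R := (1 + cnt * C) ^+ N.

Let cE0 : 0 <= cE. Proof. by rewrite exprn_ge0// addr_ge0// mulr_ge0. Qed.

(** What remains of f_I(y_1) after the action of exp Lam, by [taylor1]. *)
Definition taylor_rest (y : R -> E) (I : word) (x : E) : E :=
  f I (y 1) - \sum_(n < (N - size I).+1) act V (tens_exp Lam) n I x.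

Lemma taylor_rest_bound y x I : ode_solution01 (log_field V Lam) x y ->
  (size I <= N)%N ->
  `|taylor_rest y I x|
    <= cE * (2 * (cnt * C * M ^+ 2)) * (1 + `|x|) * q ^+ (N.+1 - size I).
Proof.
move=> ys IN.
have := @triangular_bound R d ell N C (cnt * C * M ^+ 2 * (2 * (1 + `|x|))) q (coef Lam)
  (fun I r => f I (y r) - taylor V Lam I x r) (fun I r => remainder_field V Lam I (y r))
  C0 _ q0 LamC _ I 1 IN ler01 (lexx _).
rewrite -/cE taylor1 -/(taylor_rest y I x).
have -> : cE * (cnt * C * M ^+ 2 * (2 * (1 + `|x|))) = cE * (2 * (cnt * C * M ^+ 2)) * (1 + `|x|).
  by ring.
apply; first by rewrite !mulr_ge0 ?exprn_ge0 ?addr_ge0.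
move=> J JN; split.
- by rewrite taylor0; case: (ys) => -> _ _; rewrite subrr.
- exact: taylor_error_continuous.
- by move=> r r0 r1; exact: is_derive_taylor_error.
- move=> r r0 r1; apply: le_trans (remainder_bound _ JN) _.
  rewrite ler_wpM2r ?exprn_ge0// ler_wpM2l ?mulr_ge0 ?exprn_ge0//.
  exact: (flow_size ys (ltW r0) (ltW r1)).
Qed.

Lemma taylor_rest_lip y z x x' I : ode_solution01 (log_field V Lam) x y ->
  ode_solution01 (log_field V Lam) x' z -> (size I <= N)%N ->
  `|taylor_rest y I x - taylor_rest z I x'|
    <= cE * (6 * (cnt * C * M ^+ 2)) * (1 + `|x'|) * `|x - x'| * q ^+ (N.+1 - size I).
Proof.
move=> ys zs IN.
have := @triangular_bound R d ell N C (cnt * C * M ^+ 2 * (6 * ((1 + `|x'|) * `|x - x'|))) q (coef Lam)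
  (fun I r => (f I (y r) - taylor V Lam I x r) - (f I (z r) - taylor V Lam I x' r))
  (fun I r => remainder_field V Lam I (y r) - remainder_field V Lam I (z r))
  C0 _ q0 LamC _ I 1 IN ler01 (lexx _).
rewrite -/cE !taylor1 -/(taylor_rest y I x) -/(taylor_rest z I x').
have -> : cE * (cnt * C * M ^+ 2 * (6 * ((1 + `|x'|) * `|x - x'|)))
   = cE * (6 * (cnt * C * M ^+ 2)) * (1 + `|x'|) * `|x - x'| by ring.
apply; first by rewrite !mulr_ge0 ?exprn_ge0 ?addr_ge0.
move=> J JN; split.
- by rewrite !taylor0; case: (ys) => -> _ _; case: (zs) => -> _ _; rewrite !subrr.
- apply: (@within_continuousB R d (fun r => f J (y r) - taylor V Lam J x r)
    (fun r => f J (z r) - taylor V Lam J x' r)).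
    exact: (taylor_error_continuous ys JN).
  exact: (taylor_error_continuous zs JN).
- move=> r r0 r1.
  apply: is_derive_eq (is_deriveB (is_derive_taylor_error ys JN r0 r1)
    (is_derive_taylor_error zs JN r0 r1)) _.
  rewrite opprD addrACA; congr (_ + _).
  by rewrite -sumrB; apply: eq_bigr => K _; rewrite -scalerBr.
- move=> r r0 r1; apply: le_trans (remainder_lip _ _ JN) _.
  rewrite ler_wpM2r ?exprn_ge0// -mulrA ler_wpM2l ?mulr_ge0 ?exprn_ge0//.
  have zl := flow_size zs (ltW r0) (ltW r1).
  have yl : `|y r - z r| <= 2 * `|x - x'|.
    have H := flow_lip ys zs (ltW r0) (ltW r1).
    have H1 : `|y r - z r| <= `|y r - z r - (x - x')| + `|x - x'|.
      by rewrite -{1}(subrK (x - x') (y r - z r)) ler_normD.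
    have H2 : 2 * L * `|x - x'| <= 1 * `|x - x'|.
      by rewrite ler_wpM2r//; move: L1; rewrite ler_pdivlMr// mulrC.
    have H3 := le_trans H H2; apply: le_trans H1 _.
    by rewrite mulr_natl mulr2n lerD2r -[leRHS]mul1r.
  have zl' : 2 + `|z r| <= 3 * (1 + `|x'|).
    have : 0 <= `|x'| by [].
    by move: zl; move: `|z r| `|x'| => a b; lra.
  apply: le_trans (ler_pM (addr_ge0 _ (normr_ge0 _)) (normr_ge0 _) zl' yl) _ => //.
  by rewrite le_eqVlt; apply/orP; left; apply/eqP; ring.
Qed.

End LogODE.

(** * The log-ODE maps form an almost flow *)
Section LogODEFlow.
Variables (R : realType) (d ell N : nat).
Local Notation E := 'rV[R]_d.
Local Notation A := (talg R ell N).
Local Notation word := (seq 'I_ell).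
Local Notation cnt := ((size (allwords ell N))%:R : R).

Lemma big_words0 (W : nmodType) (F : word -> W) :
  \sum_(n < N.+1) \sum_(J <- words ell n) F J = F [::] + \sum_(J <- allwords ell N) F J.
Proof.
rewrite big_ord_recl /= big_seq1; congr (_ + _).
rewrite (big_allwords N xpredT) big_add1 big_mkord.
by apply: eq_bigr.
Qed.

Lemma sum_words_bound (C q g : R) (a : A) (G : word -> E) : 0 <= C -> 0 <= q ->
  homog_bound C q a ->
  (forall J : word, (size J <= N)%N -> `|G J| <= g * q ^+ (N.+1 - size J)) ->
  `|\sum_(n < N.+1) \sum_(J <- words ell n) coef a J *: G J|
    <= (cnt + 1) * C * g * q ^+ N.+1.
Proof.
move=> C0 q0 aC Gg.
have one J : (size J <= N)%N -> `|coef a J *: G J| <= C * g * q ^+ N.+1.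
  move=> JN; rewrite normrZ.
  apply: le_trans (ler_pM (normr_ge0 _) (normr_ge0 _) (aC J) (Gg J JN)) _.
  by rewrite mulrACA -exprD subnKC// leqW.
rewrite (big_words0 (fun J => coef a J *: G J)).
apply: le_trans (ler_normD _ _) _; rewrite -!mulrA [(cnt + 1) * _]mulrDl mul1r addrC !mulrA.
apply: lerD; last exact: one.
apply: le_trans (ler_norm_sum _ _ _) _.
apply: (@le_trans _ _ (\sum_(J <- allwords ell N) C * g * q ^+ N.+1)).
  rewrite big_seq [leRHS]big_seq; apply: ler_sum => J; rewrite mem_allwords => /andP[_ JN].
  exact: one.
by rewrite big_const_seq count_predT iter_addr_0 -mulr_natl le_eqVlt;
  apply/orP; left; apply/eqP; ring.
Qed.

Hypothesis N0 : (0 < N)%N.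
Variable V : 'I_ell -> E -> E.
Local Notation f := (vf_word V).
Variables (M C p T : R).
Hypotheses (M0 : 0 <= M) (C0 : 0 <= C) (p0 : 0 < p).
Hypothesis fC : forall J : word, (size J <= N)%N -> class_C 2 (f J).
Hypothesis fM : forall J : word, (0 < size J <= N)%N ->
  [/\ four_point_lip M (f J), `|f J 0| <= M, forall x v, `|'d (f J) x v| <= M * `|v|
    & forall x z v, `|'d (f J) x v - 'd (f J) z v| <= M * `|x - z| * `|v|].
Variable X : R -> R -> A.
Let Lam (t s : R) : A := tens_log (X t s).
Let q (h : R) : R := h `^ p^-1.
Hypothesis XC : forall t s, 0 <= s -> s <= t -> t <= T -> homog_bound C (q (t - s)) (X t s).
Hypothesis LamC : forall t s, 0 <= s -> s <= t -> t <= T -> homog_bound C (q (t - s)) (Lam t s).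
Hypothesis lieLam : forall t s, 0 <= s -> s <= t -> t <= T -> free_nilpotent_lie (Lam t s).
Hypothesis expLam : forall t s, 0 <= s -> s <= t -> t <= T -> tens_exp (Lam t s) = X t s.
Hypothesis X1 : forall t s, 0 <= s -> s <= t -> t <= T -> coef (X t s) [::] = 1.
Hypothesis chen : forall t u s, 0 <= s -> s <= u -> u <= t -> t <= T -> X u s * X t u = X t s.
Variable sol : R -> R -> E -> R -> E.
Hypothesis solP : forall t s x, 0 <= s -> s <= t -> t <= T ->
  ode_solution01 (log_field V (Lam t s)) x (sol t s x).

Let mu (t s : R) (x : E) : E := sol t s x 1.

Let cE : R := (1 + cnt * C) ^+ N.
(** The constant of [taylor_rest_lip], which dominates that of
    [taylor_rest_bound]. *)
Definition rest_const : R := cE * (6 * (cnt * C * M ^+ 2)).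

Let cE0 : 0 <= cE. Proof. by rewrite exprn_ge0// addr_ge0// mulr_ge0. Qed.
Let rest_const_ge0 : 0 <= rest_const.
Proof. by rewrite !mulr_ge0// exprn_ge0. Qed.

Variables (eps kap lam C1 : R).
Hypotheses (eps0 : 0 < eps) (kap0 : 0 <= kap) (kap1 : kap <= 1).
Hypothesis qeps1 : q eps <= 1.
Hypothesis qepsL : cnt * C * M * q eps <= kap / 2.

Let q_ge0 h : 0 <= q h. Proof. exact: powR_ge0. Qed.

Let q_le h k : 0 <= h -> h <= k -> q h <= q k.
Proof.
move=> h0 hk; apply: ge0_ler_powR; rewrite ?nnegrE//; first by rewrite invr_ge0 ltW.
exact: le_trans hk.
Qed.

Let window t s : s <= t -> t - s <= eps ->
  [/\ q (t - s) <= 1, 2 * (cnt * C * M * q (t - s)) <= kap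
    & cnt * C * M * q (t - s) <= 1 / 2].
Proof.
move=> st tse; have h0 : 0 <= t - s by rewrite subr_ge0.
have qq := q_le h0 tse.
have H : cnt * C * M * q (t - s) <= kap / 2.
  by apply: le_trans qepsL; rewrite ler_wpM2l// !mulr_ge0.
split; first exact: le_trans qq qeps1.
  by rewrite mulrC -ler_pdivlMr.
by apply: le_trans H _; rewrite ler_wpM2r.
Qed.

Let rest t s (I : word) (x : E) : E := taylor_rest V (Lam t s) (sol t s x) I x.

Lemma rest_bound t s I x : 0 <= s -> s <= t -> t <= T -> t - s <= eps -> (size I <= N)%N ->
  `|rest t s I x| <= rest_const * (1 + `|x|) * q (t - s) ^+ (N.+1 - size I).
Proof.
move=> s0 st tT tse IN; have [w1 _ w3] := window st tse.
apply: le_trans (taylor_rest_bound N0 M0 fC fM C0 (q_ge0 _) w1 (lieLam s0 st tT)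
  (LamC s0 st tT) w3 (solP x s0 st tT) IN) _.
rewrite ler_wpM2r ?exprn_ge0// ler_wpM2r ?addr_ge0// ler_wpM2l//.
by rewrite ler_wpM2r ?mulr_ge0 ?exprn_ge0// ler_nat.
Qed.

Lemma rest_lip t s I x z : 0 <= s -> s <= t -> t <= T -> t - s <= eps -> (size I <= N)%N ->
  `|rest t s I x - rest t s I z|
    <= rest_const * (1 + `|z|) * `|x - z| * q (t - s) ^+ (N.+1 - size I).
Proof.
move=> s0 st tT tse IN; have [w1 _ w3] := window st tse.
exact: (taylor_rest_lip N0 M0 fC fM C0 (q_ge0 _) w1 (lieLam s0 st tT)
  (LamC s0 st tT) w3 (solP x s0 st tT) (solP z s0 st tT) IN).
Qed.

Lemma mu_expansion t s x : 0 <= s -> s <= t -> t <= T ->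
  mu t s x = rest t s [::] x + \sum_(n < N.+1) act V (X t s) n [::] x.
Proof.
by move=> s0 st tT; rewrite /rest /taylor_rest subn0 expLam// subrK.
Qed.

(** f_J(mu_us x) is the action of X_us on f_J plus a rest.  Inserted in the
    expansion of mu_tu along X_tu, the main terms give the action of
    X_us X_tu = X_ts, which is the main term of mu_ts: only the rests survive. *)
Lemma defect_expansion t u s x : 0 <= s -> s <= u -> u <= t -> t <= T ->
  mu t u (mu u s x) - mu t s x =
  rest t u [::] (mu u s x) - rest t s [::] x
  + \sum_(n < N.+1) \sum_(J <- words ell n) coef (X t u) J *: rest u s J x.
Proof.
move=> s0 su ut tT.
have u0 := le_trans s0 su; have uT := le_trans ut tT; have st := le_trans su ut.
rewrite (mu_expansion (mu u s x) u0 ut tT) (mu_expansion x s0 st tT).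
have H : \sum_(n < N.+1) act V (X t s) n [::] x =
   \sum_(n < N.+1) act V (X t u) n [::] (mu u s x)
   - \sum_(n < N.+1) \sum_(J <- words ell n) coef (X t u) J *: rest u s J x.
  rewrite -(chen s0 su ut tT).
  have := act_mul_sum V (X u s) (X t u) (I := [::]) x (leq0n N).
  rewrite /= subn0 => ->; rewrite -sumrB; apply: eq_bigr => n _.
  rewrite /act -sumrB; apply: eq_bigr => J _; rewrite cats0 -scalerBr; congr (_ *: _).
  by rewrite /rest /taylor_rest (expLam s0 su uT) /mu opprB addrC subrK.
rewrite H; move: (rest t u [::] _) (rest t s [::] x) => a b.
by rewrite opprD opprB addrACA [X in _ + X]addrCA subrr addr0.
Qed.

Let om (h : R) : R := q h ^+ N.+1.

Let om_le h k : 0 <= h -> h <= k -> om h <= om k.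
Proof.
by move=> h0 hk; rewrite /om ler_pXn2r// ?nnegrE// q_le.
Qed.

Let defect_const : R := rest_const * (3 + (cnt + 1) * C).

Let pow_le (h k : R) (m : nat) : 0 <= h -> h <= k -> q h ^+ m <= q k ^+ m.
Proof. by move=> h0 hk; apply: lerXn2r; rewrite ?nnegrE// q_le. Qed.

Let mu_size t s x : 0 <= s -> s <= t -> t <= T -> t - s <= eps ->
  1 + `|mu t s x| <= 2 * (1 + `|x|).
Proof.
move=> s0 st tT tse; have [w1 _ w3] := window st tse.
exact: (flow_size M0 fM C0 (q_ge0 _) w1 (LamC s0 st tT) w3 (solP x s0 st tT) ler01 (lexx _)).
Qed.

Let mu_lip t s x z : 0 <= s -> s <= t -> t <= T -> t - s <= eps ->
  `|mu t s x - mu t s z| <= (1 + kap) * `|x - z|.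
Proof.
move=> s0 st tT tse; have [w1 w2 w3] := window st tse.
have H := flow_lip M0 fM C0 (q_ge0 _) w1 (LamC s0 st tT) w3 (solP x s0 st tT)
   (solP z s0 st tT) ler01 (lexx _).
rewrite -/(mu t s x) -/(mu t s z) in H.
rewrite -[mu t s x - _](subrK (x - z)); apply: le_trans (ler_normD _ _) _.
rewrite [1 + kap]addrC mulrDl mul1r lerD2r; apply: le_trans H _.
by rewrite ler_wpM2r.
Qed.

(** Each rest u s J has order q^(N + 1 - |J|) and is multiplied by a coefficient of
    order q^|J|; all rests grow linearly in x. *)
Lemma mu_defect t u s x : 0 <= s -> s <= u -> u <= t -> t <= T -> t - s <= eps ->
  `|mu t u (mu u s x) - mu t s x| <= defect_const * (1 + `|x|) * om (t - s).
Proof.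
move=> s0 su ut tT tse.
have u0 := le_trans s0 su; have uT := le_trans ut tT; have st := le_trans su ut.
have tu_ts : t - u <= t - s by rewrite lerB.
have us_ts : u - s <= t - s by rewrite lerD2r.
have tue := le_trans tu_ts tse; have use := le_trans us_ts tse.
have tu0 : 0 <= t - u by rewrite subr_ge0.
have us0 : 0 <= u - s by rewrite subr_ge0.
rewrite (defect_expansion x s0 su ut tT).
apply: le_trans (ler_normD _ _) _; apply: le_trans (lerD (ler_normB _ _) (lexx _)) _.
have B1 : `|rest t u [::] (mu u s x)| <= 2 * (rest_const * (1 + `|x|) * om (t - s)).
  apply: le_trans (rest_bound (mu u s x) u0 ut tT tue (leq0n N : (size [::] <= N)%N)) _; rewrite subn0.
  apply: (@le_trans _ _ (rest_const * (2 * (1 + `|x|)) * om (t - s))).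
    apply: ler_pM; rewrite ?exprn_ge0 ?mulr_ge0 ?addr_ge0//; last exact: pow_le.
    by rewrite ler_wpM2l// mu_size.
  by rewrite le_eqVlt; apply/orP; left; apply/eqP; ring.
have B2 := rest_bound x s0 st tT tse (leq0n N : (size [::] <= N)%N); rewrite subn0 -/(om _) in B2.
have B3 := @sum_words_bound C (q (t - s)) (rest_const * (1 + `|x|)) (X t u)
  (fun J => rest u s J x) C0 (q_ge0 _).
apply: le_trans (lerD (lerD B1 B2) (B3 _ _)) _.
- move=> w; apply: le_trans (XC u0 ut tT w) _.
  by rewrite ler_wpM2l// pow_le.
- move=> J JN; apply: le_trans (rest_bound x s0 su uT use JN) _.
  by rewrite ler_wpM2l ?mulr_ge0 ?addr_ge0// pow_le.
by rewrite le_eqVlt; apply/orP; left; apply/eqP; rewrite /defect_const /om; ring.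
Qed.

Lemma mu_defect_local r t u s x z : 0 <= r -> 0 <= s -> s <= u -> u <= t -> t <= T ->
  t - s <= eps -> `|z| <= r ->
  `|(mu t u (mu u s x) - mu t s x) - (mu t u (mu u s z) - mu t s z)|
    <= 2 * defect_const * (2 * (1 + r)) * om (t - s) * `|x - z|.
Proof.
move=> r0 s0 su ut tT tse zr.
have u0 := le_trans s0 su; have uT := le_trans ut tT; have st := le_trans su ut.
have tu_ts : t - u <= t - s by rewrite lerB.
have us_ts : u - s <= t - s by rewrite lerD2r.
have tue := le_trans tu_ts tse; have use := le_trans us_ts tse.
have tu0 : 0 <= t - u by rewrite subr_ge0.
have us0 : 0 <= u - s by rewrite subr_ge0.
rewrite (defect_expansion x s0 su ut tT) (defect_expansion z s0 su ut tT).
rewrite (_ : _ - _ = (rest t u [::] (mu u s x) - rest t u [::] (mu u s z))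
  - (rest t s [::] x - rest t s [::] z)
  + \sum_(n < N.+1) \sum_(J <- words ell n) coef (X t u) J *: (rest u s J x - rest u s J z)); last first.
  under [in RHS]eq_bigr => n _ do
    (under eq_bigr => J _ do rewrite scalerBr; rewrite sumrB).
  have key (a b e a' b' e' : E) :
      (a - b + e) - (a' - b' + e') = (a - a') - (b - b') + (e - e').
    by apply/rowP => i; rewrite !mxE; ring.
  rewrite sumrB; exact: key.
apply: le_trans (ler_normD _ _) _; apply: le_trans (lerD (ler_normB _ _) (lexx _)) _.
pose g := rest_const * (2 * (1 + r)) * `|x - z|.
have g0 : 0 <= g by rewrite !mulr_ge0// addr_ge0.
have o0 : 0 <= om (t - s) by rewrite exprn_ge0.
have zr' : 1 + `|z| <= 2 * (1 + r).
  apply: (@le_trans _ _ (1 + r)); first by rewrite lerD2l.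
  by rewrite ler_peMl ?addr_ge0// ler1n.
have B1 : `|rest t u [::] (mu u s x) - rest t u [::] (mu u s z)| <= 2 * (g * om (t - s)).
  apply: le_trans (rest_lip (mu u s x) (mu u s z) u0 ut tT tue (leq0n N : (size [::] <= N)%N)) _; rewrite subn0.
  apply: (@le_trans _ _ (rest_const * (2 * (1 + r)) * (2 * `|x - z|) * om (t - s))).
    apply: ler_pM; rewrite ?exprn_ge0 ?mulr_ge0 ?addr_ge0//; last exact: pow_le.
    apply: ler_pM; rewrite ?mulr_ge0 ?addr_ge0//.
      rewrite ler_wpM2l//; apply: le_trans (mu_size z s0 su uT use) _.
      by rewrite ler_wpM2l// lerD2l.
    apply: le_trans (mu_lip x z s0 su uT use) _; rewrite ler_wpM2r//.
    by rewrite (_ : 2 = 1 + 1) // lerD2l.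
  by rewrite le_eqVlt /g; apply/orP; left; apply/eqP; ring.
have B2 : `|rest t s [::] x - rest t s [::] z| <= g * om (t - s).
  apply: le_trans (rest_lip x z s0 st tT tse (leq0n N : (size [::] <= N)%N)) _; rewrite subn0.
  by rewrite ler_wpM2r// ler_wpM2r// ler_wpM2l.
have B3 := @sum_words_bound C (q (t - s)) g (X t u)
  (fun J => rest u s J x - rest u s J z) C0 (q_ge0 _).
apply: le_trans (lerD (lerD B1 B2) (B3 _ _)) _.
- move=> w; apply: le_trans (XC u0 ut tT w) _.
  by rewrite ler_wpM2l// pow_le.
- move=> J JN; apply: le_trans (rest_lip x z s0 su uT use JN) _.
  apply: ler_pM; rewrite ?exprn_ge0 ?mulr_ge0 ?addr_ge0//; last exact: pow_le.
  by rewrite ler_wpM2r// ler_wpM2l.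
have H0 : 0 <= defect_const * (2 * (1 + r)) * om (t - s) * `|x - z|.
  by rewrite !mulr_ge0 ?addr_ge0 ?mulr_ge0 ?addr_ge0.
rewrite (_ : 2 * defect_const * (2 * (1 + r)) * om (t - s) * `|x - z| =
  defect_const * (2 * (1 + r)) * om (t - s) * `|x - z|
  + (2 * (g * om (t - s)) + g * om (t - s) + (cnt + 1) * C * g * om (t - s))); last first.
  by rewrite /defect_const /g; ring.
by rewrite lerDr.
Qed.

(** mu_ts is x + F x up to a rest, where F is a combination of the f_J with small
    coefficients, for which the four-point estimate holds. *)
Lemma mu_four_points r t s a a' z z' : 0 <= r -> 0 <= s -> s <= t -> t <= T ->
  t - s <= eps -> `|a| <= r -> `|a'| <= r -> `|z| <= r -> `|z'| <= r ->
  `|(mu t s a - mu t s a') - (mu t s z - mu t s z')|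
     <= (1 + kap) * `|(a - a') - (z - z')|
        + (1 + rest_const * (1 + r)) * (`|a - z| + `|a' - z'| + om (t - s))
            * (`|a - a'| + `|z - z'|).
Proof.
move=> r0 s0 st tT tse ar ar' zr zr'; have [w1 w2 w3] := window st tse.
pose F x := \sum_(J <- allwords ell N) coef (X t s) J *: f J x.
have muE x : mu t s x = rest t s [::] x + (x + F x).
  rewrite (mu_expansion x s0 st tT); congr (_ + _).
  rewrite (_ : x + F x = coef (X t s) [::] *: f [::] x + F x); last first.
    by rewrite X1// scale1r.
  rewrite /F -[RHS](big_words0 (fun J => coef (X t s) J *: f J x)); apply: eq_bigr => n _.
  by apply: eq_bigr => J _; rewrite cats0.
have split4 (ea eb ec ed Fa Fb Fc Fd : E) :
    (ea + (a + Fa) - (eb + (a' + Fb))) - (ec + (z + Fc) - (ed + (z' + Fd)))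
    = (ea - eb - (ec - ed)) + ((a - a') - (z - z')) + ((Fa - Fb) - (Fc - Fd)).
  by apply/rowP => i; rewrite !mxE; ring.
rewrite !muE split4.
apply: le_trans (ler_normD _ _) _; apply: le_trans (lerD (ler_normD _ _) (lexx _)) _.
have F4 := four_point_lip_lincomb (s := allwords ell N) (coef (X t s)) (F := f) (M := M).
have [|_ F4'] := F4; first by move=> J; rewrite mem_allwords => /fM[].
have B3 := F4' a a' z z'; rewrite -/(F a) -/(F a') -/(F z) -/(F z') in B3.
have SL := sum_coef_le M0 C0 (q_ge0 _) w1 (XC s0 st tT).
have B1 x y : `|x| <= r -> `|y| <= r ->
    `|rest t s [::] x - rest t s [::] y| <= rest_const * (1 + r) * om (t - s) * `|x - y|.
  move=> xr yr; apply: le_trans (rest_lip x y s0 st tT tse (leq0n N : (size [::] <= N)%N)) _; rewrite subn0.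
  rewrite -/(om _) mulrAC ler_wpM2r// ler_wpM2r ?exprn_ge0// ler_wpM2l//.
  by rewrite lerD2l.
have B2 : `|rest t s [::] a - rest t s [::] a' - (rest t s [::] z - rest t s [::] z')|
    <= rest_const * (1 + r) * om (t - s) * (`|a - a'| + `|z - z'|).
  by apply: le_trans (ler_normB _ _) _; rewrite mulrDr; apply: lerD; exact: B1.
apply: le_trans (lerD (lerD B2 (lexx _)) B3) _.
set Y := `|a - a' - (z - z')|; set W := `|a - a'| + `|z - z'|; set Z := `|a - z| + `|a' - z'|.
have [Y0 W0 Z0] : [/\ 0 <= Y, 0 <= W & 0 <= Z].
  by split; [exact: normr_ge0|exact: addr_ge0|exact: addr_ge0].
have o0 : 0 <= om (t - s) by rewrite exprn_ge0.
have K1 : (\sum_(J <- allwords ell N) `|coef (X t s) J| * M) * (Y + Z * W)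
    <= kap * Y + Z * W.
  rewrite mulrDr; apply: lerD; last first.
    rewrite -[leRHS]mul1r ler_wpM2r ?mulr_ge0//; apply: le_trans SL _.
    by apply: le_trans w3 _; rewrite ler_pdivrMr// mul1r ler1n.
  rewrite ler_wpM2r//; apply: le_trans SL _.
  apply: le_trans w2; rewrite ler_peMl ?ler1n//.
  by rewrite !mulr_ge0.
apply: le_trans (lerD (lexx _) K1) _.
pose k := rest_const * (1 + r).
have k0 : 0 <= k by rewrite mulr_ge0// addr_ge0.
have K2 := mulr_ge0 k0 (mulr_ge0 Z0 W0); have K3 := mulr_ge0 o0 W0.
rewrite -/k -subr_ge0.
rewrite (_ : _ - _ = k * (Z * W) + om (t - s) * W); last by ring.
exact: addr_ge0.
Qed.

Hypotheses (lam0 : 0 <= lam) (lam1 : lam < 1) (C10 : 0 <= C1).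
Hypothesis om_half : forall h, 0 <= h -> h <= eps ->
  2 * (1 + kap) ^+ 2 * om (h / 2) <= lam * om h.
Hypothesis C1c : 4 * defect_const <= C1 * (1 - lam).
Hypothesis om_eps : C1 * om eps <= kap.

Lemma log_ode_almost_flow : almost_flow T eps kap lam defect_const C1 om mu.
Proof.
split=> //.
- by rewrite !mulr_ge0 ?addr_ge0 ?mulr_ge0 ?addr_ge0.
- by move=> h h0; rewrite exprn_ge0.
- move=> s x s0 sT; apply/eqP; rewrite -subr_eq0 -normr_le0.
  have sse : s - s <= eps by rewrite subrr ltW.
  have [w1 _ w3] := window (lexx s) sse.
  have := flow_growth M0 fM C0 (q_ge0 _) w1 (LamC s0 (lexx s) sT) w3 (solP x s0 (lexx s) sT) ler01 (lexx _).
  by rewrite subrr /q powR0 ?invr_eq0 ?gt_eqF// !mulr0 mul0r.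
- move=> t s x s0 st tT tse; have [w1 w2 w3] := window st tse.
  have := flow_growth M0 fM C0 (q_ge0 _) w1 (LamC s0 st tT) w3 (solP x s0 st tT) ler01 (lexx _).
  by move=> /le_trans; apply; rewrite ler_wpM2r ?addr_ge0.
- by move=> t u s x s0 su ut tT tse; exact: mu_defect.
- move=> r r0; exists (Num.max (2 * defect_const * (2 * (1 + r))) (1 + rest_const * (1 + r))).
    by rewrite le_max [X in _ || X]addr_ge0 ?orbT// mulr_ge0// addr_ge0.
  split=> [t u s x z s0 su ut tT tse xr zr|t s a a' z z' s0 st tT tse ar ar' zr zr'].
    apply: le_trans (mu_defect_local x r0 s0 su ut tT tse zr) _.
    by rewrite ler_wpM2r// ler_wpM2r ?exprn_ge0// le_max lexx.
  apply: le_trans (mu_four_points r0 s0 st tT tse ar ar' zr zr') _.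
  rewrite lerD2l ler_wpM2r ?addr_ge0// ler_wpM2r ?addr_ge0 ?exprn_ge0//.
  by rewrite le_max lexx orbT.
Qed.

End LogODEFlow.

(** * Rough paths *)
Section RoughPathFacts.
Variables (R : realType) (d ell : nat) (p T : R).
Local Notation E := 'rV[R]_d.
Local Notation N := (Num.truncn p).
Local Notation A := (talg R ell N).
Local Notation word := (seq 'I_ell).
Hypothesis p1 : 1 < p.
Variable X : R -> R -> A.
Hypothesis XP : weak_geometric_rough_path T X.

Let N0 : (0 < N)%N.
Proof. by rewrite -[0%N]/(1.-1) prednK// -(truncn1 R) le_truncn// ltW. Qed.

Lemma rough_log t s : 0 <= s -> s <= t -> t <= T ->
  free_nilpotent_lie (tens_log (X t s)) /\ tens_exp (tens_log (X t s)) = X t s.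
Proof.
move=> s0 st tT; have [a /= aL <-] := wgrp_group XP s0 st tT.
have [a0 _ _] := lie_dynkin N0 aL.
by rewrite tens_logK.
Qed.

Lemma rough_scalar t s : 0 <= s -> s <= t -> t <= T -> coef (X t s) [::] = 1.
Proof. by move=> s0 st tT; rewrite -(wgrp_scalar XP s0 st tT) -coef_bseq. Qed.

(** By Chen's relation X_ss is idempotent, and X_ss - 1 is nilpotent. *)
Lemma rough_diag s : 0 <= s -> s <= T -> X s s = 1.
Proof.
move=> s0 sT; pose n : A := X s s - 1.
have XX : X s s * X s s = X s s := wgrp_chen XP s0 (lexx s) (lexx s) sT.
have n0 : coef n [::] = 0.
  by rewrite /n coefB coef_one (rough_scalar s0 (lexx s) sT) subrr.
have nn : n * n = - n.
  by rewrite /n mulrBl mul1r mulrBr mulr1 XX subrr sub0r.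
have np k : n ^+ k.+1 = (-1) ^+ k * n.
  elim: k => [|k IH]; first by rewrite expr0 mul1r expr1.
  by rewrite exprSr IH -mulrA nn mulrN exprS mulN1r mulNr.
have := tens_nilpotent n0; rewrite np => /(congr1 (fun z => (-1) ^+ N * z)).
rewrite mulr0 mulrA -expr2 sqrr_sign mul1r => /eqP.
by rewrite subr_eq0 => /eqP.
Qed.

(** Raise the Hoelder bound on level k to the power k; the case s = t, which the
    norm does not see, is [rough_diag]. *)
Lemma rough_homog_bound : exists2 C, 0 <= C & forall t s, 0 <= s -> s <= t -> t <= T ->
  homog_bound C ((t - s) `^ p^-1) (X t s).
Proof.
pose K := fine (rough_norm T X).
have nz : (0 <= rough_norm T X)%E by apply: bigmax_ge_id.
have KE : rough_norm T X = K%:E.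
  by rewrite fineK// ge0_fin_numE// (wgrp_holder XP).
have K0 : 0 <= K by rewrite -lee_fin -KE.
have p0 : 0 < p by exact: lt_trans p1.
exists ((1 + K) ^+ N); first by rewrite exprn_ge0// addr_ge0.
have K1 : 1 <= (1 + K) ^+ N by rewrite exprn_ege1// lerDl.
move=> t s s0 st tT.
move: (st); rewrite le_eqVlt => /orP[/eqP <-|stl].
  rewrite (rough_diag s0 (le_trans st tT)).
  by apply: (homog_bound_le K1); [exact: powR_ge0|apply: homog_bound_one; exact: powR_ge0].
set q := _ `^ _; have q0 : 0 < q by rewrite powR_gt0// subr_gt0.
move=> w; case: (leqP (size w) N) => wN; last first.
  by rewrite coefN// normr0 mulr_ge0 ?exprn_ge0 ?addr_ge0// ltW.
case: (posnP (size w)) => [w0|wpos].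
  by rewrite (size0nil w0) expr0 mulr1 (rough_scalar s0 st tT) normr1.
have lev : `|coef (X t s) w| <= level_norm (size w) (X t s).
  rewrite /level_norm -sqrtr_sqr; apply: ler_wsqrtr.
  rewrite -[w]/(bseqval (Bseq wN)) coef_bseq (bigD1 (Bseq wN)) //= lerDl.
  by apply: sumr_ge0 => v _; exact: sqr_ge0.
have H : level_norm (size w) (X t s) `^ (size w)%:R^-1 <= K * q.
  rewrite -ler_pdivrMr// -lee_fin -KE.
  rewrite /rough_norm; apply: (@bigmax_sup_seq _ _ _ _ _ (size w)) => //.
    by rewrite mem_index_iota wpos ltnS.
  apply: ereal_sup_ubound; exists (t, s) => /=; first by split.
  by rewrite gtr0_norm ?subr_gt0.
apply: le_trans lev _.
have i0 : (size w)%:R != 0 :> R by rewrite pnatr_eq0 -lt0n.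
have -> : level_norm (size w) (X t s) =
   (level_norm (size w) (X t s) `^ (size w)%:R^-1) ^+ size w.
  rewrite -powR_mulrn ?powR_ge0// -powRrM mulVf// powRr1//; exact: sqrtr_ge0.
apply: (@le_trans _ _ ((K * q) ^+ size w)).
  by apply: lerXn2r; rewrite ?nnegrE ?powR_ge0// mulr_ge0// ltW.
rewrite exprMn ler_wpM2r ?exprn_ge0 ?(ltW q0)//.
apply: (@le_trans _ _ ((1 + K) ^+ size w)).
  by apply: lerXn2r; rewrite ?nnegrE ?addr_ge0// lerDr.
by apply: ler_weXn2l => //; rewrite lerDl.
Qed.

End RoughPathFacts.

(** Replace each V_[I] by the action of e_[I] on the identity and apply Dynkin's
    formula. *)
Lemma log_vfE (R : realType) (d ell N : nat) (N0 : (0 < N)%N)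
    (V : 'I_ell -> 'rV[R]_d -> 'rV[R]_d) (Lam : talg R ell N) :
  (forall J : seq 'I_ell, (size J <= N)%N -> class_C 2 (vf_word V J)) ->
  free_nilpotent_lie Lam ->
  (fun x => \sum_(I : N.-bseq 'I_ell | (0 < size I)%N)
     ((size I)%:R^-1 * Lam I) *: vf_bracket_word V I x) = log_field V Lam.
Proof.
move=> fC lieL; apply/funext => x.
have [L0 _ _] := lie_dynkin N0 lieL.
transitivity (word_sum N (coef Lam) (fun J => vf_word V J x)); last first.
  by rewrite /word_sum (big_words0 N (fun J => coef Lam J *: vf_word V J x)) L0 scale0r add0r.
rewrite -(dynkin N0 (fun J => vf_word V J x) lieL); apply: eq_bigr => I I0.
congr (_ *: _); rewrite (bracket_wordE N0 fC I0 (size_bseq I)) /word_sum.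
have IN : (size I < N.+1)%N by rewrite ltnS size_bseq.
rewrite (bigD1 (Ordinal IN)) //= [X in _ + X]big1 ?addr0 => [|n nI].
  by rewrite /act; apply: eq_bigr => K _; rewrite cats0.
rewrite big1_seq// => K; rewrite mem_words => /andP[_ /eqP Kn].
rewrite homog_bracket_tensor// ?scale0r// Kn; apply: contra nI => /eqP nI.
by rewrite -val_eqE /= nI.
Qed.

Lemma words_constant (R : realType) (d ell : nat) (V : 'I_ell -> 'rV[R]_d -> 'rV[R]_d)
    (s : seq (seq 'I_ell)) :
  (forall J, J \in s -> C2_bounded_derivatives (vf_word V J)) ->
  exists2 M, 0 <= M & forall J, J \in s ->
  [/\ four_point_lip M (vf_word V J), `|vf_word V J 0| <= M,
     forall x v, `|'d (vf_word V J) x v| <= M * `|v|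
    & forall x z v, `|'d (vf_word V J) x v - 'd (vf_word V J) z v| <= M * `|x - z| * `|v|].
Proof.
elim: s => [_|I s IH HC]; first by exists 0.
have [|M M0 MP] := IH; first by move=> J Js; apply: HC; rewrite inE Js orbT.
have [M1 [M10 l4 dl ddl]] := C2_estimates (HC I (mem_head _ _)).
pose K := M + M1 + `|vf_word V I 0|.
have MK : M <= K by rewrite /K -addrA lerDl addr_ge0.
have M1K : M1 <= K by rewrite /K addrAC lerDr addr_ge0.
exists K; first exact: le_trans MK.
move=> J; rewrite inE => /orP[/eqP ->|Js].
  split; [exact: four_point_lip_le l4|by rewrite /K lerDr addr_ge0| |] => x *.
    by apply: le_trans (dl _ _) _; rewrite ler_wpM2r.
  by apply: le_trans (ddl _ _ _) _; rewrite ler_wpM2r// ler_wpM2r.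
have [a b e g] := MP J Js; split; [exact: four_point_lip_le a|exact: le_trans b MK| |] => x *.
  by apply: le_trans (e _ _) _; rewrite ler_wpM2r.
by apply: le_trans (g _ _ _) _; rewrite ler_wpM2r// ler_wpM2r.
Qed.

(** 2 * 2^(- eta) = 2^(1 - eta); this is where eta > 1 is used. *)
Lemma half_powR_lt (R : realType) (eta : R) : 1 < eta -> 2 * (2^-1 `^ eta) < 1.
Proof.
move=> e1; rewrite mulrC -ltr_pdivlMr// mul1r.
rewrite -[eta](subrK 1) powRD; last by rewrite invr_eq0 pnatr_eq0 implybT.
rewrite powRr1 ?invr_ge0// gtr_pMl ?invr_gt0//.
have := @gt0_ltr_powR R (eta - 1); rewrite subr_gt0 => /(_ e1) H.
have := H 2^-1 1; rewrite powR1; apply; rewrite ?nnegrE ?invr_ge0//.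
by rewrite invf_lt1// ltr1n.
Qed.

(** * Absence of explosion *)
Theorem theorem1 (R : realType) (p T : R) (ell d : nat)
    (V : 'I_ell -> 'rV[R]_d -> 'rV[R]_d) :
  1 < p -> 0 < T ->
  (forall I : seq 'I_ell, (1 <= size I <= Num.truncn p)%N ->
     C2_bounded_derivatives (vf_word V I)) ->
  exists2 eta : R, 1 < eta &
  forall X : R -> R -> tens R ell (Num.truncn p),
    weak_geometric_rough_path T X ->
    exists phi : R -> R -> 'rV[R]_d -> 'rV[R]_d,
      is_solution_flow T V X eta phi.
Proof.
move=> p1 T0 VC; set N := Num.truncn p.
have p0 : 0 < p by exact: lt_trans p1.
have N0 : (0 < N)%N by rewrite /N -[1%N](truncn1 R) le_truncn// ltW.
exists (N.+1%:R / p); first by rewrite ltr_pdivlMr// mul1r truncnS_gt.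
move=> X XP.
have [Cx Cx0 XC] := rough_homog_bound p1 XP.
have [Cl Cl0 logC] := homog_bound_log ell N Cx0.
have [M M0 fM] := words_constant (s := allwords ell N)
  (fun J JN => VC J (etrans (esym (mem_allwords N J)) JN)).
have {}fM J : (0 < size J <= N)%N -> _ := fun JN => fM J (etrans (mem_allwords N J) JN).
have fC J : (size J <= N)%N -> class_C 2 (vf_word V J).
  case: J => [_|i J JN]; first exact: class_C2_id.
  by case: (VC (i :: J) JN).
set cnt := ((size (allwords ell N))%:R : R).
pose C := Cx + Cl; have C0 : 0 <= C by rewrite addr_ge0.
pose q (h : R) := h `^ p^-1; pose Lam t s : talg R ell N := tens_log (X t s).
have XC' t s : 0 <= s -> s <= t -> t <= T -> homog_bound C (q (t - s)) (X t s : talg R ell N).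
  move=> s0 st tT; apply: (homog_bound_le _ (powR_ge0 _ _) (XC t s s0 st tT)).
  by rewrite lerDl.
have LC t s : 0 <= s -> s <= t -> t <= T -> homog_bound C (q (t - s)) (Lam t s).
  move=> s0 st tT.
  apply: (homog_bound_le _ (powR_ge0 _ _) (logC _ _ (powR_ge0 _ _) (XC t s s0 st tT))).
  by rewrite lerDr.
have lieL t s : 0 <= s -> s <= t -> t <= T -> free_nilpotent_lie (Lam t s).
  by move=> s0 st tT; case: (rough_log p1 XP s0 st tT).
have vfE t s : 0 <= s -> s <= t -> t <= T -> log_vf V X t s = log_field V (Lam t s).
  by move=> s0 st tT; exact: (log_vfE N0 fC (lieL t s s0 st tT)).
have W4 t s := log_field_four_point_lip fM (Lam t s).
have S0 t s : 0 <= \sum_(J <- allwords ell N) `|coef (Lam t s) J| * M.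
  by apply: sumr_ge0 => J _; rewrite mulr_ge0.
pose sol t s x := sval (cid (ode_exists (S0 t s) (W4 t s) x)).
have solP t s x : ode_solution01 (log_field V (Lam t s)) x (sol t s x).
  exact: svalP (cid (ode_exists (S0 t s) (W4 t s) x)).
pose eta := N.+1%:R / p.
have eta1 : 1 < eta by rewrite /eta ltr_pdivlMr// mul1r truncnS_gt.
have powN h : 0 <= h -> h `^ eta = q h ^+ N.+1.
  by move=> h0; rewrite /eta mulrC powRrM powR_mulrn// powR_ge0.
(* Halving an interval costs the factor theta < 1; kap is so small that
   theta * (1 + kap)^2 <= lam, and eps so small that the multiples of
   q eps = q0 required to be below kap are so. *)
pose theta : R := 2 * (2^-1 `^ eta).
have th1 : theta < 1 := half_powR_lt eta1.
have th0 : 0 <= theta by rewrite mulr_ge0// powR_ge0.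
pose kap := (1 - theta) / 8; pose lam := (1 + theta) / 2.
have kap_gt0 : 0 < kap by rewrite divr_gt0// subr_gt0.
have kap1 : kap <= 1 by rewrite /kap; clear -th0; lra.
have lam0 : 0 <= lam by rewrite divr_ge0// addr_ge0.
have lam1 : lam < 1 by rewrite /lam; clear -th1; lra.
pose dc := rest_const ell N M C * (3 + (cnt + 1) * C).
have cnt0 : 0 <= cnt by [].
have rc0 : 0 <= rest_const ell N M C.
  by rewrite /rest_const -/cnt mulr_ge0 ?exprn_ge0 ?addr_ge0 ?mulr_ge0 ?exprn_ge0.
have dc0 : 0 <= dc by rewrite mulr_ge0// addr_ge0// mulr_ge0// addr_ge0.
pose C1 := 4 * dc / (1 - lam).
have C10 : 0 <= C1 by apply: divr_ge0; [rewrite mulr_ge0 | rewrite subr_ge0 ltW].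
have C1c : 4 * dc <= C1 * (1 - lam) by rewrite divfK// subr_eq0 gt_eqF.
pose S := cnt * C * M + C1 + 1.
have CM0 : 0 <= cnt * C * M by rewrite !mulr_ge0.
have S1 : 1 <= S by rewrite lerDr addr_ge0.
have Spos : 0 < S by exact: lt_le_trans S1.
pose q0 := kap / (2 * S).
have q0pos : 0 < q0 by rewrite divr_gt0// mulr_gt0.
have Sq : S * q0 = kap / 2 by rewrite /q0; field; rewrite gt_eqF.
have q0le a : 0 <= a -> a <= S -> a * q0 <= kap / 2.
  by move=> a0 aS; rewrite -Sq ler_wpM2r// ltW.
have q01 : q0 <= 1.
  have := q0le 1 ler01 S1; rewrite mul1r => /le_trans; apply.
  by clear -kap1; lra.
pose eps := q0 `^ p.
have eps0 : 0 < eps by rewrite powR_gt0.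
have qeps : q eps = q0.
  by rewrite /q /eps -powRrM divff ?gt_eqF// powRr1// ltW.
have om_half h : 0 <= h -> h <= eps ->
    2 * (1 + kap) ^+ 2 * q (h / 2) ^+ N.+1 <= lam * q h ^+ N.+1.
  move=> h0 _; rewrite -!powN ?divr_ge0// powRM ?invr_ge0//.
  rewrite (_ : 2 * _ * _ = theta * (1 + kap) ^+ 2 * h `^ eta); last first.
    by rewrite /theta; clearbody kap; ring.
  rewrite ler_wpM2r ?powR_ge0//.
  have k2 : kap * kap <= kap * 1 by rewrite ler_wpM2l// ltW.
  have k3 : theta * kap <= 1 * kap by rewrite ler_wpM2r// ltW.
  have k4 : theta * (kap * kap) <= 1 * (kap * kap).
    by apply: ler_wpM2r; [rewrite mulr_ge0// ltW | rewrite ltW].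
  have kE : 8 * kap = 1 - theta by rewrite /kap; field.
  by rewrite /lam expr2; clear -k2 k3 k4 kE kap_gt0; clearbody theta kap; lra.
have AF := @log_ode_almost_flow R d ell N N0 V M C p T M0 C0 p0 fC fM X XC' LC lieL
  (fun t s s0 st tT => proj2 (rough_log p1 XP s0 st tT))
  (rough_scalar XP) (wgrp_chen XP) sol (fun t s x _ _ _ => solP t s x)
  eps kap lam C1 eps0 (ltW kap_gt0) kap1.
have {}AF := AF _ _ lam0 lam1 C10 om_half C1c _.
have [||| phi phiF phiE] := exists_flow (AF _ _ _).
- by rewrite -/(q eps) qeps.
- by rewrite -/(q eps) qeps -/cnt; apply: q0le => //; rewrite /S -addrA lerDl addr_ge0.
- rewrite -/(q eps) qeps; apply: (@le_trans _ _ (C1 * q0)).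
    by rewrite ler_wpM2l// exprS ler_piMr ?exprn_ile1// ltW.
  have C1S : C1 <= S by rewrite /S addrAC lerDr addr_ge0.
  have := q0le C1 C10 C1S; move/le_trans; apply.
  by clear -kap_gt0; lra.
exists phi; split=> //.
exists (fun t s x => sol t s x 1).
  move=> t s s0 st tT x; rewrite vfE//; split; first by exists (sol t s x).
  by move=> y ys; apply: (ode_unique (S0 t s) (W4 t s) ys (solP t s x)).
exists eps => // r r0; exists (C1 * (1 + r) + 1).
  by rewrite ltr_wpDl// mulr_ge0// addr_ge0// ltW.
move=> t s s0 st tT; have ts0 : 0 <= t - s by rewrite subr_ge0.
rewrite ger0_norm// => tse x xr; apply: le_trans (phiE t s x s0 st tT tse) _.
rewrite powN// ler_wpM2r ?exprn_ge0 ?powR_ge0//.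
apply: (@le_trans _ _ (C1 * (1 + r))); last by rewrite lerDl.
by rewrite ler_wpM2l// lerD2l.
Qed.
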